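(* Let $v\in\mathbb{C}$, and let $G$ and $H_1$ be functions as described in the context, with $\jmath^*=1$ (so $G(t,\varepsilon)$ is $2\pi$-periodic in $t$). Consider the center bundle equation $$\dot p=e^{it}\Big[v+\varepsilon\, G(t,\varepsilon)+\mu_1 H_1\big(pe^{-it},\overline{p}\,e^{it},\mu_1\big)\Big],\qquad p\in\mathbb{C},\quad (\varepsilon,\mu_1)\in\mathbb{R}^2\text{ near }(0,0).\qquad ( * )$$ Let $g_m(\varepsilon)$, $m\in\mathbb{Z}$, be the Fourier coefficients of $G$, that is, $G(t,\varepsilon)=\sum_{m\in\mathbb{Z}}g_m(\varepsilon)e^{imt}$, and let $\alpha_1=D_1H_1(-iv,i\overline{v},0)$. Assume that $g_{-1}(0)\neq 0$ and $\operatorname{Re}(\alpha_1)\neq 0$. Then for every sufficiently small neighbourhood $V$ of $0$ in $\mathbb{C}$ there are constants $K>0$ and $\delta>0$ such that, with the wedge-shaped region $$\mathcal{W}=\{(\varepsilon,\mu_1)\in\mathbb{R}^2 : |\varepsilon|<K|\mu_1|,\ |\mu_1|<\delta\},$$ the following holds for all $(\varepsilon,\mu_1)\in\mathcal{W}$ with $\varepsilon\neq 0$: 1. Equation $( * )$ has a unique hyperbolic discrete rotating wave $\mathcal{D}^1_{\varepsilon,\mu_1}$ with trivial spatio-temporal symmetry whose center $[\mathcal{D}^1_{\varepsilon,\mu_1}]_{\mathrm A}$ lies in $V$ (i.e. is near the origin). 2. The center is generically not at the origin: $[\mathcal{D}^1_{\varepsilon,\mu_1}]_{\mathrm A}\neq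 0$ for all $(\varepsilon,\mu_1)$ in an open dense subset of $\mathcal{W}\cap\{\varepsilon\neq 0\}$. 3. If $\mu_1\operatorname{Re}(\alpha_1)<0$, then $[\mathcal{D}^1_{\varepsilon,\mu_1}]_{\mathrm A}$ is a center of anchoring.
   Context: Equation $( * )$ is the reduced equation on the center bundle $\mathbb{C}\times\mathbb{S}^1$ (with $\varphi(t)=t$) near a normally hyperbolic rotating wave, in the case of one inhomogeneity located at the origin. Standing assumptions. $G(t,\varepsilon)$ is a smooth $\mathbb{C}$-valued function of $t\in\mathbb{R}$ and of $\varepsilon$ near $0$ in $\mathbb{R}$, and is $2\pi/\jmath^*$-periodic in $t$, where $\jmath^*\ge 1$ is an integer (here $\jmath^*=1$). $H_1(w,\overline{w},\mu_1)$ is a smooth (in the real sense) $\mathbb{C}$-valued function of $w\in\mathbb{C}$ and of $\mu_1$ near $0$ in $\mathbb{R}$, uniformly bounded in $w$. Notation. $D_1H_1$ is the partial derivative of $H_1$ with respect to its first argument, with $w$ and $\overline{w}$ treated as independent variables (i.e. the Wirtinger derivative $\partial/\partial w$). Thus $\alpha_1$ is this derivative at $w=-iv$, $\mu_1=0$. Definitions. A perturbed rotating wave (discrete rotating wave with trivial spatio-temporal symmetry) of $( * )$ is a $2\pi$-periodic solution $p(t)$ of $( * )$. Its center is the average $[p]_{\mathrm A}=\frac{1}{2\pi}\int_0^{2\pi}p(t)\,dt$. It is hyperbolic if none of its Floquet multipliers (the eigenvalues of the derivative at $p(0)$, as a real $2\times2$ matrix, of the time-$2\pi$ map of $( * )$)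 lies on the unit circle. If all its Floquet multipliers lie strictly inside the unit circle, $[p]_{\mathrm A}$ is called a center of anchoring (anchoring center). *)

(* Defs.v *)
From Stdlib Require Export Reals.
From Coquelicot Require Export Coquelicot.
Open Scope R_scope.

(* [Ck_on k U f]: f is of class C^k on the open set U.  The derivative is the
   real Frechet derivative; for a finite-dimensional E, the map x |-> Df x is
   of class C^k as soon as each x |-> Df x h is. *)
Fixpoint Ck_on {E F : NormedModule R_AbsRing} (k : nat) (U : E -> Prop)
    (f : E -> F) : Prop :=
  match k with
  | O => forall x : E, U x -> continuous f x
  | S k' => exists Df : E -> E -> F,
      (forall x : E, U x -> filterdiff f (locally x) (Df x)) /\
      (forall h : E, Ck_on k' U (fun x : E => Df x h))
  end.

Definition smooth_on {E F : NormedModule R_AbsRing} (U : E -> Prop)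
    (f : E -> F) : Prop :=
  forall k : nat, Ck_on k U f.

(* Here, and everywhere below, smoothness and derivatives are real ones: C is
   used as a normed module over R. *)
Definition smooth_R_R_C (eta : R) (G : R -> R -> C) : Prop :=
  smooth_on (E := prod_NormedModule R_AbsRing R_NormedModule R_NormedModule)
            (F := C_R_NormedModule)
    (fun x => Rabs (snd x) < eta) (fun x => G (fst x) (snd x)).

Definition smooth_C_R_C (eta : R) (H : C -> R -> C) : Prop :=
  smooth_on (E := prod_NormedModule R_AbsRing C_R_NormedModule R_NormedModule)
            (F := C_R_NormedModule)
    (fun x => Rabs (snd x) < eta) (fun x => H (fst x) (snd x)).

Definition cis (t : R) : C := (cos t, sin t).

Definition is_derive_C (p : R -> C) (t : R) (l : C) : Prop :=
  is_derive (K := R_AbsRing) (V := C_R_NormedModule) p t l.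

(* d/dw = (d/dx - i d/dy) / 2, where w = x + i y. *)
Definition is_wirtinger (f : C -> C) (w a : C) : Prop :=
  exists fx fy : C,
    is_derive_C (fun s : R => f (w + RtoC s)%C) 0 fx /\
    is_derive_C (fun s : R => f (w + Ci * RtoC s)%C) 0 fy /\
    a = ((fx - Ci * fy) / RtoC 2)%C.

Definition average (f : R -> C) : C :=
  (RInt (fun t => Re (f t)) 0 (2 * PI) / (2 * PI),
   RInt (fun t => Im (f t)) 0 (2 * PI) / (2 * PI)).

Definition fourier_coeff (f : R -> C) (m : Z) : C :=
  average (fun t => f t * cis (- (IZR m * t)))%C.

(* The function H of (w, mu) stands for (w, mu) |-> H_1(w, conj w, mu), so the
   argument conj p e^{it} of H_1 is implicit. *)
Definition rhs (v : C) (G : R -> R -> C) (H : C -> R -> C) (eps mu : R)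
    (t : R) (p : C) : C :=
  (cis t * (v + RtoC eps * G t eps + RtoC mu * H (p * cis (- t)) mu))%C.

(* Below, X is the right-hand side of the equation p' = X t p. *)

Definition rotating_wave (X : R -> C -> C) (p : R -> C) : Prop :=
  (forall t : R, is_derive_C p t (X t (p t))) /\
  (forall t : R, p (t + 2 * PI) = p t).

(* y is the image of x under the time-2 PI map.  Outside [0, 2 PI], u need only
   extend the solution differentiably across the two endpoints. *)
Definition time_2PI (X : R -> C -> C) (x y : C) : Prop :=
  exists u : R -> C,
    u 0 = x /\ u (2 * PI) = y /\
    (forall t : R, 0 <= t <= 2 * PI -> is_derive_C u t (X t (u t))).

Definition is_monodromy (X : R -> C -> C) (p : R -> C)
    (L : C -> C) : Prop :=
  exists Phi : C -> C,
    locally (T := C_R_NormedModule) (p 0)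
      (fun x : C => time_2PI X x (Phi x)) /\
    filterdiff (K := R_AbsRing) (U := C_R_NormedModule) (V := C_R_NormedModule)
      Phi (locally (T := C_R_NormedModule) (p 0)) L.

(* Complex eigenvalues of the real 2 x 2 matrix, in the basis (1, i), of the
   real-linear map L. *)
Definition is_eigenvalue (L : C -> C) (lam : C) : Prop :=
  exists z1 z2 : C,
    ~ (z1 = RtoC 0 /\ z2 = RtoC 0) /\
    (RtoC (Re (L (RtoC 1))) * z1 + RtoC (Re (L Ci)) * z2 = lam * z1)%C /\
    (RtoC (Im (L (RtoC 1))) * z1 + RtoC (Im (L Ci)) * z2 = lam * z2)%C.

Definition hyperbolic (X : R -> C -> C) (p : R -> C) : Prop :=
  exists L : C -> C, is_monodromy X p L /\
    forall lam : C, is_eigenvalue L lam -> Cmod lam <> 1.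

(* The center [average p] of the rotating wave p is a center of anchoring. *)
Definition anchoring (X : R -> C -> C) (p : R -> C) : Prop :=
  exists L : C -> C, is_monodromy X p L /\
    forall lam : C, is_eigenvalue L lam -> Cmod lam < 1.

Definition wedge (K delta eps mu : R) : Prop :=
  Rabs eps < K * Rabs mu /\ Rabs mu < delta.

Definition open_dense_subset {T : UniformSpace} (A O : T -> Prop) : Prop :=
  open O /\ (forall x : T, O x -> A x) /\
  (forall x : T, A x -> forall N : T -> Prop, locally x N ->
     exists y : T, N y /\ O y).

Definition nbhd0 (V : C -> Prop) : Prop :=
  locally (T := C_R_NormedModule) (RtoC 0) V.

(* Main.v *)
From Stdlib Require Import ZArith Lra Lia List Classical ClassicalEpsilon
  FunctionalExtensionality.
Require Import Defs.

(** Why the theorem holds.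

    In the unforced equation the solution is a circle of radius |v|.  Write
    p(t) = q(t) - i v e^{it}, where the second summand is a primitive of
    v e^{it} with mean zero; then p and q have the same average and the
    equation becomes

      q' = eps a(t, eps) + mu h(t, q, mu),
      a(t, eps) = e^{it} G(t, eps),
      h(t, q, mu) = e^{it} H(q e^{-it} - i v, mu).

    For q near 0 the function H is evaluated near the single point -i v, so
    only its Taylor expansion there matters: up to a small Lipschitz error,
    h(t, q, mu) - h(t, q', mu) is al (q - q') + be conj(q - q') e^{2it} with
    al = alpha1.  Averaged over a period, h(t, 0, 0) = e^{it} H(-i v, 0) and
    the be-term vanish and al is left.  The record reduced_field
    collects exactly the estimates that are used, and the lemma reduction
    derives them from the smoothness of G and H.

    - Existence.  In the wedge eps/mu is small, and a 2 pi-periodic solution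
      is a fixed point of a Lyapunov-Schmidt map, which corrects q(0) by
      -1/al times the average of the right-hand side divided by mu.  It is a
      contraction of a small ball of periodic functions
      (periodic_solution_exists).
    - Uniqueness.  The difference of two small periodic solutions oscillates
      by O(mu) around its mean c, and its averaged equation reads
      mu al c = small terms (comparison).  The lemma allows different
      parameters for the two solutions, so that it also shows that the center
      depends continuously on (eps, mu).  Any wave whose center is near 0 is
      small as a whole, because G and H are bounded (periodic_solution_small).
    - Center different from 0.  Two solutions with the same mu and the same
      center differ by O(eps - eps'), and their averaged equations then give
      (eps - eps') g_{-1}(0) = small multiple of (eps - eps').  So on each line
      where mu is constant the center vanishes at most once
      (average_injective_eps); since the zero set of the center is closed, its
      complement is open and dense.
    - Stability.  The derivative L of the time-2 pi map comes from the
      variational equation, and L = 1 + 2 pi mu al up to an error which is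
      small compared with mu Re al (flow_derivative).  If L shrinks (expands)
      every vector then all its eigenvalues lie inside (outside) the unit
      circle (eigenvalue_modulus), and the sign of mu Re al decides which
      case occurs (spectrum_near_scaling). *)

(** * Complex-valued functions of a real variable *)

Definition continuousC (f : R -> C) (t : R) : Prop :=
  continuous (T := R_UniformSpace) (U := C_R_NormedModule) f t.

Lemma continuousC_pair f t :
  continuousC f t <->
  continuous (fun s => Re (f s)) t /\ continuous (fun s => Im (f s)) t.
Proof.
split.
- intros Hf; split.
  + apply (continuous_comp (V := C_R_NormedModule) f (fun z : C => fst z)).
    exact Hf. destruct (f t); apply continuous_fst.
  + apply (continuous_comp (V := C_R_NormedModule) f (fun z : C => snd z)).
    exact Hf. destruct (f t); apply continuous_snd.
- intros [H1 H2].
  apply (continuous_ext (fun s => (Re (f s), Im (f s)))).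
  { intros s; destruct (f s); reflexivity. }
  apply (continuous_comp_2 (V := R_UniformSpace) (W := R_UniformSpace)
           (X := C_R_NormedModule) _ _ (fun x y => (x, y)) t H1 H2).
  apply (continuous_ext (fun x => x)).
  { intros [x y]; reflexivity. }
  apply continuous_id.
Qed.

Lemma is_derive_C_pair f t l :
  is_derive_C f t l <->
  is_derive (fun s => Re (f s)) t (Re l) /\
  is_derive (fun s => Im (f s)) t (Im l).
Proof.
split.
- intros Hf; split.
  + apply (filterdiff_ext_lin _ (fun y => fst (scal (V := C_R_NormedModule) y l))).
    2: intros y; reflexivity.
    apply (filterdiff_comp' (V := C_R_NormedModule) f (fun z : C => fst z) t _
             (fun z : C => fst z) Hf).
    apply filterdiff_linear, is_linear_fst.
  + apply (filterdiff_ext_lin _ (fun y => snd (scal (V := C_R_NormedModule) y l))).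
    2: intros y; reflexivity.
    apply (filterdiff_comp' (V := C_R_NormedModule) f (fun z : C => snd z) t _
             (fun z : C => snd z) Hf).
    apply filterdiff_linear, is_linear_snd.
- intros [H1 H2].
  apply (is_derive_ext (V := C_R_NormedModule)
    (fun s => plus (scal (V := C_R_NormedModule) (Re (f s)) (RtoC 1))
                   (scal (V := C_R_NormedModule) (Im (f s)) Ci))).
  { intros s. apply injective_projections; simpl;
      unfold scal, plus; simpl; unfold mult; simpl; unfold Re, Im; ring. }
  replace l with (plus (scal (V := C_R_NormedModule) (Re l) (RtoC 1))
                   (scal (V := C_R_NormedModule) (Im l) Ci)).
  2: apply injective_projections; simpl;
      unfold scal, plus; simpl; unfold mult; simpl; unfold Re, Im; ring.
  apply (is_derive_plus (V := C_R_NormedModule)); apply is_derive_scal_l; assumption.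
Qed.

Ltac C_calc :=
  apply injective_projections; simpl; unfold Re, Im; simpl; ring.

Lemma is_derive_C_eq f t l l' : is_derive_C f t l -> l = l' -> is_derive_C f t l'.
Proof. intros H <-; exact H. Qed.

Lemma is_derive_C_ext f g t l :
  (forall s, f s = g s) -> is_derive_C f t l -> is_derive_C g t l.
Proof. intros E H; apply (is_derive_ext (V := C_R_NormedModule) f g t l E H). Qed.

Lemma is_derive_C_continuous f t l : is_derive_C f t l -> continuousC f t.
Proof.
intros H; apply (filterdiff_continuous (U := R_NormedModule) (V := C_R_NormedModule) f t); eexists; apply H.
Qed.

Lemma is_derive_C_const (c : C) t : is_derive_C (fun _ => c) t (RtoC 0).
Proof. apply is_derive_C_pair; split; simpl; auto_derive; auto. Qed.

Lemma is_derive_C_plus f g t lf lg :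
  is_derive_C f t lf -> is_derive_C g t lg ->
  is_derive_C (fun s => f s + g s)%C t (lf + lg)%C.
Proof. apply (is_derive_plus (V := C_R_NormedModule)). Qed.

Lemma is_derive_C_mult f g t lf lg :
  is_derive_C f t lf -> is_derive_C g t lg ->
  is_derive_C (fun s => f s * g s)%C t (lf * g t + f t * lg)%C.
Proof.
intros Hf Hg.
apply is_derive_C_pair in Hf; apply is_derive_C_pair in Hg.
destruct Hf as [F1 F2], Hg as [G1 G2].
apply is_derive_C_pair; split.
- apply (is_derive_ext (fun s => Re (f s) * Re (g s) - Im (f s) * Im (g s))).
  { intros s; reflexivity. }
  evar_last.
  apply (is_derive_minus (V := R_NormedModule)).
  apply (is_derive_mult _ _ _ _ _ F1 G1). intros; apply Rmult_comm.
  apply (is_derive_mult _ _ _ _ _ F2 G2). intros; apply Rmult_comm.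
  unfold minus, plus, opp, mult; simpl; unfold Re, Im; ring.
- apply (is_derive_ext (fun s => Re (f s) * Im (g s) + Im (f s) * Re (g s))).
  { intros s; reflexivity. }
  evar_last.
  apply (is_derive_plus (V := R_NormedModule)).
  apply (is_derive_mult _ _ _ _ _ F1 G2). intros; apply Rmult_comm.
  apply (is_derive_mult _ _ _ _ _ F2 G1). intros; apply Rmult_comm.
  unfold minus, plus, opp, mult; simpl; unfold Re, Im; ring.
Qed.

Lemma is_derive_C_cmult (c : C) f t l :
  is_derive_C f t l -> is_derive_C (fun s => c * f s)%C t (c * l)%C.
Proof.
intros H. eapply is_derive_C_eq.
apply is_derive_C_mult. apply is_derive_C_const. exact H. C_calc.
Qed.

Lemma is_derive_C_minus f g t lf lg :
  is_derive_C f t lf -> is_derive_C g t lg ->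
  is_derive_C (fun s => f s - g s)%C t (lf - lg)%C.
Proof. apply (is_derive_minus (V := C_R_NormedModule)). Qed.

Lemma is_derive_C_RtoC f t l :
  is_derive f t l -> is_derive_C (fun s => RtoC (f s)) t (RtoC l).
Proof.
intros H; apply is_derive_C_pair; split; simpl; [exact H | auto_derive; auto].
Qed.

Lemma is_derive_C_cis (k t : R) :
  is_derive_C (fun s => cis (k * s)) t (RtoC k * Ci * cis (k * t))%C.
Proof.
apply is_derive_C_pair; split; unfold cis; simpl; auto_derive; auto; ring.
Qed.

Lemma cis_plus s t : cis (s + t) = (cis s * cis t)%C.
Proof.
unfold cis; rewrite cos_plus, sin_plus; apply injective_projections; simpl; ring.
Qed.

Lemma cis_0 : cis 0 = RtoC 1.
Proof. unfold cis; rewrite cos_0, sin_0; reflexivity. Qed.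

Lemma cis_opp_r t : (cis t * cis (- t) = RtoC 1)%C.
Proof. rewrite <- cis_plus, Rplus_opp_r; apply cis_0. Qed.

Lemma Cconj_cis t : Cconj (cis t) = cis (- t).
Proof. unfold cis, Cconj; simpl; rewrite cos_neg, sin_neg; reflexivity. Qed.

Lemma cis_2PI : cis (2 * PI) = RtoC 1.
Proof. unfold cis; rewrite cos_2PI, sin_2PI; reflexivity. Qed.

Lemma cis_period t : cis (t + 2 * PI) = cis t.
Proof. rewrite cis_plus, cis_2PI; ring. Qed.

Lemma Cmod_cis t : Cmod (cis t) = 1.
Proof.
unfold Cmod, cis; cbn [fst snd]. rewrite <- !Rsqr_pow2, Rplus_comm, sin2_cos2.
apply sqrt_1.
Qed.

Lemma Cmod_minus_le a b : Cmod (a - b) <= Cmod a + Cmod b.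
Proof.
unfold Cminus; eapply Rle_trans; [apply Cmod_triangle |].
rewrite Cmod_opp; lra.
Qed.

Lemma Cmod_minus_sym a b : Cmod (a - b) = Cmod (b - a).
Proof. rewrite <- Cmod_opp; f_equal; ring. Qed.

Lemma Cmod_le_plus a b : Cmod a <= Cmod b + Cmod (a - b).
Proof.
eapply Rle_trans; [| apply Cmod_triangle]. apply Req_le; f_equal; ring.
Qed.

Lemma Cmod_sqr (z : C) : Cmod z * Cmod z = Re z * Re z + Im z * Im z.
Proof.
unfold Cmod, Re, Im; rewrite sqrt_sqrt; [simpl; ring |].
generalize (pow2_ge_0 (fst z)) (pow2_ge_0 (snd z)); lra.
Qed.

Lemma continuousC_const (c : C) t : continuousC (fun _ => c) t.
Proof. apply continuous_const. Qed.

Lemma continuousC_plus f g t :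
  continuousC f t -> continuousC g t -> continuousC (fun s => f s + g s)%C t.
Proof. apply (continuous_plus (V := C_R_NormedModule)). Qed.

Lemma continuousC_minus f g t :
  continuousC f t -> continuousC g t -> continuousC (fun s => f s - g s)%C t.
Proof. apply (continuous_minus (V := C_R_NormedModule)). Qed.

Lemma continuousC_mult f g t :
  continuousC f t -> continuousC g t -> continuousC (fun s => f s * g s)%C t.
Proof.
intros Hf Hg.
apply continuousC_pair in Hf; apply continuousC_pair in Hg.
destruct Hf as [F1 F2], Hg as [G1 G2].
apply continuousC_pair; split.
- apply (continuous_ext (fun s => minus (mult (Re (f s)) (Re (g s))) (mult (Im (f s)) (Im (g s))))).
  { reflexivity. }
  apply (continuous_minus (V := R_NormedModule));
  apply (continuous_mult (K := R_AbsRing)); assumption.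
- apply (continuous_ext (fun s => plus (mult (Re (f s)) (Im (g s))) (mult (Im (f s)) (Re (g s))))).
  { reflexivity. }
  apply (continuous_plus (V := R_NormedModule));
  apply (continuous_mult (K := R_AbsRing)); assumption.
Qed.

Lemma continuousC_RtoC f t : continuous f t -> continuousC (fun s => RtoC (f s)) t.
Proof.
intros H; apply continuousC_pair; split; [exact H | apply continuous_const].
Qed.

Lemma continuousC_cis k t : continuousC (fun s => cis (k * s)) t.
Proof. eapply is_derive_C_continuous, is_derive_C_cis. Qed.

Lemma continuousC_eps f t :
  continuousC f t <->
  forall e, 0 < e -> exists d, 0 < d /\
    forall s, Rabs (s - t) < d -> Cmod (f s - f t) < e.
Proof.
split.
- intros Hf e He.
  destruct (proj1 (filterlim_locally_ball_norm (U := C_R_NormedModule) f (f t)) Hf (mkposreal e He)) as [d Hd].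
  exists d; split; [apply cond_pos |].
  intros s Hs. rewrite Cmod_norm. exact (Hd s Hs).
- intros Hf. apply (filterlim_locally_ball_norm (U := C_R_NormedModule) f (f t)).
  intros [e He]. destruct (Hf e He) as [d [Hd Hd']].
  exists (mkposreal d Hd). intros s Hs. unfold ball_norm.
  generalize (Hd' s Hs). rewrite Cmod_norm. exact (fun K => K).
Qed.

(** The scalar mean value theorem is applied to the component of f in the
    direction of f b - f a. *)
Lemma mean_value_C (f f' : R -> C) (a b D : R) :
  a <= b ->
  (forall t, a <= t <= b -> is_derive_C f t (f' t)) ->
  (forall t, a <= t <= b -> Cmod (f' t) <= D) ->
  Cmod (f b - f a) <= D * (b - a).
Proof.
intros Hab Hf HD.
set (e := (f b - f a)%C).
pose (g := fun t => Re (f t) * Re e + Im (f t) * Im e).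
assert (Hg : forall t, a <= t <= b ->
   is_derive g t (Re (f' t) * Re e + Im (f' t) * Im e)).
{ intros t Ht. destruct (proj1 (is_derive_C_pair _ _ _) (Hf t Ht)) as [H1 H2].
  apply (is_derive_plus (V := R_NormedModule));
  [apply (is_derive_scal_l (V := R_NormedModule) _ t _ (Re e) H1)
  |apply (is_derive_scal_l (V := R_NormedModule) _ t _ (Im e) H2)]. }
destruct (MVT_gen g a b (fun t => Re (f' t) * Re e + Im (f' t) * Im e)) as [c [Hc E]].
{ intros t Ht. rewrite Rmin_left, Rmax_right in Ht by lra. apply Hg; lra. }
{ intros t Ht. rewrite Rmin_left, Rmax_right in Ht by lra.
  apply continuity_pt_filterlim.
  apply (ex_derive_continuous (V := R_NormedModule) g t). eexists; apply Hg; lra. }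
rewrite Rmin_left, Rmax_right in Hc by lra.
assert (E2 : Cmod e * Cmod e = g b - g a).
{ rewrite Cmod_sqr. unfold g, e, Re, Im; simpl; ring. }
assert (CS : Re (f' c) * Re e + Im (f' c) * Im e <= Cmod (f' c) * Cmod e).
{ generalize (Cmod_sqr (f' c)) (Cmod_sqr e); intros P1 P2.
  generalize (Cmod_ge_0 (f' c)) (Cmod_ge_0 e); intros.
  assert (0 <= Cmod (f' c) * Cmod e) by nra.
  destruct (Rle_lt_dec (Re (f' c) * Re e + Im (f' c) * Im e) 0). lra.
  apply Rsqr_incr_0; try lra. unfold Rsqr.
  replace (Cmod (f' c) * Cmod e * (Cmod (f' c) * Cmod e)) with
   ((Cmod (f' c) * Cmod (f' c)) * (Cmod e * Cmod e)) by ring.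
  rewrite P1, P2.
  generalize (Rle_0_sqr (Re (f' c) * Im e - Im (f' c) * Re e)); unfold Rsqr.
  intros; nra. }
specialize (HD c Hc).
generalize (Cmod_ge_0 e); intros He.
destruct He as [He | He].
2: { rewrite <- He. generalize (Cmod_ge_0 (f' c)); intros; apply Rmult_le_pos; lra. }
apply (Rmult_le_reg_r (Cmod e)); trivial. rewrite E2, E.
apply Rle_trans with (Cmod (f' c) * Cmod e * (b - a)).
- apply Rmult_le_compat_r; lra.
- replace (D * (b - a) * Cmod e) with (D * Cmod e * (b - a)) by ring.
  apply Rmult_le_compat_r; [lra | apply Rmult_le_compat_r; lra].
Qed.

Definition primitive (f : R -> C) (t : R) : C :=
  (RInt (fun s => Re (f s)) 0 t, RInt (fun s => Im (f s)) 0 t).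

Lemma primitive_0 f : primitive f 0 = RtoC 0.
Proof. unfold primitive; rewrite !RInt_point; reflexivity. Qed.

Lemma is_derive_RInt_0 (f : R -> R) t :
  (forall s, continuous f s) -> is_derive (fun x => RInt f 0 x) t (f t).
Proof.
intros Hf. apply (is_derive_RInt f (fun x => RInt f 0 x) 0 t).
2: apply Hf.
exists (mkposreal 1 Rlt_0_1). intros y _.
apply (RInt_correct f), ex_RInt_continuous. intros; apply Hf.
Qed.

Lemma primitive_derive f t :
  (forall s, continuousC f s) -> is_derive_C (primitive f) t (f t).
Proof.
intros Hf. apply is_derive_C_pair; split; unfold primitive; simpl;
apply (is_derive_RInt_0 (fun s => _ (f s))); intros s; apply (continuousC_pair f s), Hf.
Qed.

Lemma average_primitive (F f : R -> C) :
  (forall t, 0 <= t <= 2 * PI -> is_derive_C F t (f t)) ->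
  (forall t, continuousC f t) ->
  average f = ((F (2 * PI)%R - F 0) / RtoC (2 * PI))%C.
Proof.
intros HF Hf. generalize PI_RGT_0; intros Hpi.
assert (E1 : RInt (fun t => Re (f t)) 0 (2 * PI) = Re (F (2*PI)%R) - Re (F 0)).
{ apply is_RInt_unique.
  apply (is_RInt_derive (V := R_CompleteNormedModule) (fun t => Re (F t)));
  intros t Ht; rewrite Rmin_left, Rmax_right in Ht by lra.
  apply (is_derive_C_pair F t), HF, Ht. apply (continuousC_pair f t), Hf. }
assert (E2 : RInt (fun t => Im (f t)) 0 (2 * PI) = Im (F (2*PI)%R) - Im (F 0)).
{ apply is_RInt_unique.
  apply (is_RInt_derive (V := R_CompleteNormedModule) (fun t => Im (F t)));
  intros t Ht; rewrite Rmin_left, Rmax_right in Ht by lra.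
  apply (is_derive_C_pair F t), HF, Ht. apply (continuousC_pair f t), Hf. }
unfold average. rewrite E1, E2.
assert (RtoC (2 * PI) <> 0)%C.
{ intros K. apply (f_equal fst) in K. simpl in K. lra. }
apply injective_projections; simpl; unfold Re, Im; field; lra.
Qed.

(** * Periodic functions *)

(** Estimates on [0, 2 pi] extend to the real line: one representative of t
    serves all 2 pi-periodic functions at once. *)
Lemma reduce_period (t : R) :
  exists s, 0 <= s <= 2 * PI /\
    forall f : R -> C, (forall x, f (x + 2 * PI) = f x) -> f t = f s.
Proof.
generalize PI_RGT_0; intros Hpi.
assert (N : forall (f : R -> C), (forall x, f (x + 2 * PI) = f x) ->
   forall n x, f (x + INR n * (2 * PI)) = f x).
{ intros f Hf n; induction n; intros x. simpl; f_equal; ring.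
  rewrite S_INR. replace (x + (INR n + 1) * (2 * PI)) with
   (x + INR n * (2 * PI) + 2 * PI) by ring. rewrite Hf; apply IHn. }
assert (Z : forall (f : R -> C), (forall x, f (x + 2 * PI) = f x) ->
   forall k x, f (x + IZR k * (2 * PI)) = f x).
{ intros f Hf k x. destruct (Z_le_gt_dec 0 k).
  - rewrite <- (Z2Nat.id k), <- INR_IZR_INZ by lia. apply N, Hf.
  - rewrite <- (N f Hf (Z.to_nat (- k)) (x + IZR k * (2 * PI))).
    rewrite INR_IZR_INZ, Z2Nat.id, opp_IZR by lia. f_equal; ring. }
destruct (archimed (t / (2 * PI))) as [A B].
set (k := (up (t / (2 * PI)) - 1)%Z).
assert (Hk : IZR k = IZR (up (t / (2 * PI))) - 1) by (unfold k; rewrite minus_IZR; ring).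
exists (t - IZR k * (2 * PI)). split.
- assert (t = t / (2 * PI) * (2 * PI)) by (field; lra).
  rewrite Hk. split; nra.
- intros f Hf. rewrite <- (Z f Hf k (t - _)). f_equal; ring.
Qed.

Lemma periodic_le (f : R -> C) d :
  (forall x, f (x + 2 * PI) = f x) ->
  (forall t, 0 <= t <= 2 * PI -> Cmod (f t) <= d) -> forall t, Cmod (f t) <= d.
Proof.
intros Hf Hd t. destruct (reduce_period t) as [s [Hs E]]. rewrite (E f Hf). auto.
Qed.

(** * Taylor estimates in several real variables *)

(** E is finite-dimensional, in a form that is convenient for bounds: a linear
    map on E is controlled by its values on finitely many vectors.  Since
    Ck_on speaks of Df x h for one h at a time, this is what turns continuity
    of each x |-> Df x h into a bound for the operator norm of Df x. *)
Definition finitely_tested (E : NormedModule R_AbsRing) : Prop :=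
  exists (l : list E) (K : R), 0 < K /\
  forall L : E -> C, is_linear (V := C_R_NormedModule) L ->
  forall M, 0 <= M -> (forall e, In e l -> Cmod (L e) <= M) ->
  forall h, Cmod (L h) <= K * M * norm h.

Lemma Cmod_scal_R (s : R) (z : C) : Cmod (scal (V := C_R_NormedModule) s z) = Rabs s * Cmod z.
Proof.
replace (scal (V := C_R_NormedModule) s z) with (RtoC s * z)%C.
rewrite Cmod_mult, Cmod_R; reflexivity.
apply injective_projections; simpl; unfold scal; simpl; unfold mult; simpl; ring.
Qed.

Lemma finitely_tested_R : finitely_tested R_NormedModule.
Proof.
exists (1 :: nil), 1; split; [lra |]. intros L HL M HM Hl h.
replace h with (scal (V := R_NormedModule) h 1) at 1 by (unfold scal; simpl; unfold mult; simpl; ring).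
rewrite (linear_scal L HL), Cmod_scal_R.
specialize (Hl 1 (or_introl eq_refl)).
change (norm h) with (Rabs h). generalize (Rabs_pos h); intros; nra.
Qed.

Lemma norm_pair_l {E F : NormedModule R_AbsRing} (x : E) (y : F) :
  norm x <= norm (V := prod_NormedModule R_AbsRing E F) (x, y).
Proof.
change (norm x <= sqrt (norm x ^ 2 + norm y ^ 2)).
rewrite <- (sqrt_pow2 (norm x)) at 1 by apply norm_ge_0.
apply sqrt_le_1_alt. generalize (pow2_ge_0 (norm y)); lra.
Qed.

Lemma norm_pair_r {E F : NormedModule R_AbsRing} (x : E) (y : F) :
  norm y <= norm (V := prod_NormedModule R_AbsRing E F) (x, y).
Proof.
change (norm y <= sqrt (norm x ^ 2 + norm y ^ 2)).
rewrite <- (sqrt_pow2 (norm y)) at 1 by apply norm_ge_0.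
apply sqrt_le_1_alt. generalize (pow2_ge_0 (norm x)); lra.
Qed.

Lemma norm_pair_le {E F : NormedModule R_AbsRing} (x : E) (y : F) :
  norm (V := prod_NormedModule R_AbsRing E F) (x, y) <= norm x + norm y.
Proof.
change (sqrt (norm x ^ 2 + norm y ^ 2) <= norm x + norm y).
generalize (norm_ge_0 x) (norm_ge_0 y); intros.
rewrite <- (sqrt_pow2 (norm x + norm y)) by lra.
apply sqrt_le_1_alt. nra.
Qed.

Lemma is_linear_inl {E F : NormedModule R_AbsRing} :
  is_linear (V := prod_NormedModule R_AbsRing E F) (fun x : E => (x, zero)).
Proof.
split.
- intros x y. apply injective_projections; simpl; [reflexivity | symmetry; apply plus_zero_l].
- intros k x. apply injective_projections; simpl; [reflexivity | symmetry; apply (scal_zero_r (V := F) k)].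
- exists 1; split; [lra |]. intros x. eapply Rle_trans; [apply norm_pair_le |].
  rewrite norm_zero; lra.
Qed.

Lemma is_linear_inr {E F : NormedModule R_AbsRing} :
  is_linear (V := prod_NormedModule R_AbsRing E F) (fun y : F => (zero, y)).
Proof.
split.
- intros x y. apply injective_projections; simpl; [symmetry; apply plus_zero_l | reflexivity].
- intros k x. apply injective_projections; simpl; [symmetry; apply (scal_zero_r (V := E) k) | reflexivity].
- exists 1; split; [lra |]. intros x. eapply Rle_trans; [apply norm_pair_le |].
  rewrite norm_zero; lra.
Qed.

Lemma linear_pair {E F : NormedModule R_AbsRing} (L : E * F -> C) x y :
  is_linear (U := prod_NormedModule R_AbsRing E F) (V := C_R_NormedModule) L ->
  L (x, y) = (L (x, zero) + L (zero, y))%C.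
Proof.
intros HL.
replace (x, y) with (plus (G := prod_NormedModule R_AbsRing E F) (x, zero) (zero, y)).
apply (linear_plus L HL).
apply injective_projections; simpl; [apply plus_zero_r | apply plus_zero_l].
Qed.

Lemma finitely_tested_prod (E F : NormedModule R_AbsRing) :
  finitely_tested E -> finitely_tested F ->
  finitely_tested (prod_NormedModule R_AbsRing E F).
Proof.
intros [l1 [K1 [HK1 H1]]] [l2 [K2 [HK2 H2]]].
exists (map (fun x => (x, zero)) l1 ++ map (fun y => (zero, y)) l2), (K1 + K2).
split; [lra |]. intros L HL M HM Hl [x y].
assert (A := H1 (fun x => L (x, zero))
  (is_linear_comp _ L is_linear_inl HL) M HM
  (fun e He => Hl _ (in_or_app _ _ _ (or_introl (in_map _ _ _ He)))) x).
assert (B := H2 (fun y => L (zero, y))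
  (is_linear_comp _ L is_linear_inr HL) M HM
  (fun e He => Hl _ (in_or_app _ _ _ (or_intror (in_map _ _ _ He)))) y).
rewrite (linear_pair L x y HL).
eapply Rle_trans; [apply Cmod_triangle |].
simpl in A, B.
generalize (norm_pair_l x y) (norm_pair_r x y). intros P Q.
assert (0 <= K1 * M) by nra. assert (0 <= K2 * M) by nra.
apply (Rmult_le_compat_l (K1 * M)) in P; trivial.
apply (Rmult_le_compat_l (K2 * M)) in Q; trivial.
rewrite 2!Rmult_plus_distr_r.
eapply Rle_trans; [apply Rplus_le_compat; [exact A | exact B] | lra].
Qed.

Lemma locally_norm_radius {E : NormedModule R_AbsRing} (x0 : E) (P : E -> Prop) :
  locally x0 P ->
  exists r, 0 < r /\ forall x, norm (minus x x0) < r -> P x.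
Proof.
intros H. destruct (locally_norm_le_locally x0 P H) as [r Hr].
exists r; split; [apply cond_pos | exact Hr].
Qed.

Lemma continuous_C_radius {E : NormedModule R_AbsRing} (f : E -> C) (x0 : E) :
  continuous (U := C_R_NormedModule) f x0 -> forall e, 0 < e ->
  exists r, 0 < r /\ forall x, norm (minus x x0) < r -> Cmod (f x - f x0) < e.
Proof.
intros Hf e He.
apply (locally_norm_radius x0 (fun x => Cmod (f x - f x0) < e)).
generalize (proj1 (filterlim_locally_ball_norm (U := C_R_NormedModule) f (f x0)) Hf (mkposreal e He)).
apply filter_imp. intros x Hx. rewrite Cmod_norm. exact Hx.
Qed.

Lemma derivative_locally_bounded {E : NormedModule R_AbsRing}
    (Df : E -> E -> C) (x0 : E) :
  finitely_tested E ->
  locally x0 (fun x => is_linear (V := C_R_NormedModule) (Df x)) ->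
  (forall h, continuous (U := C_R_NormedModule) (fun x => Df x h) x0) ->
  exists M r, 0 < M /\ 0 < r /\
  forall x, norm (minus x x0) < r -> forall h, Cmod (Df x h) <= M * norm h.
Proof.
intros [l [K [HK Hl]]] Hlin Hc.
assert (B : exists M r, 0 < M /\ 0 < r /\
  forall x, norm (minus x x0) < r -> forall e, In e l -> Cmod (Df x e) <= M).
{ clear Hl. induction l as [| e l IH].
  - exists 1, 1. repeat split; try lra. intros x _ e [].
  - destruct IH as [M [r [HM [Hr IH]]]].
    destruct (continuous_C_radius _ _ (Hc e) 1 Rlt_0_1) as [r' [Hr' He]].
    generalize (Cmod_ge_0 (Df x0 e)); intros.
    exists (M + Cmod (Df x0 e) + 1), (Rmin r r'). repeat split.
    lra. apply Rmin_pos; lra.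
    intros x Hx e' [-> | Hin].
    + assert (Cmod (Df x e' - Df x0 e') < 1).
      { apply He. eapply Rlt_le_trans; [exact Hx | apply Rmin_r]. }
      generalize (Cmod_le_plus (Df x e') (Df x0 e')); lra.
    + assert (Cmod (Df x e') <= M); [| lra].
      apply IH; trivial. eapply Rlt_le_trans; [exact Hx | apply Rmin_l]. }
destruct B as [M [r [HM [Hr B]]]].
destruct (locally_norm_radius _ _ Hlin) as [r' [Hr' HL]].
exists (K * M), (Rmin r r'). repeat split.
nra. apply Rmin_pos; lra.
intros x Hx h. apply Hl; try lra.
apply HL. eapply Rlt_le_trans; [exact Hx | apply Rmin_r].
apply B. eapply Rlt_le_trans; [exact Hx | apply Rmin_l].
Qed.

Lemma derivative_along_line {E : NormedModule R_AbsRing} (f Df : E -> C) (y k : E) (s : R) :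
  filterdiff (V := C_R_NormedModule) f (locally (plus y (scal s k))) Df ->
  is_derive_C (fun s => f (plus y (scal s k))) s (Df k).
Proof.
intros Hz.
assert (G : is_derive (fun s : R => plus y (scal s k)) s k).
{ evar_last. apply is_derive_plus. apply is_derive_const.
  apply (is_derive_scal_l (fun s : R => s) s 1 k). apply (is_derive_id s).
  rewrite plus_zero_l. apply (scal_one k). }
apply (filterdiff_ext_lin _ (fun t : R => Df (scal t k))).
2: { intros t. apply (linear_scal _ (proj1 Hz)). }
apply (filterdiff_comp' (U := R_NormedModule) (V := E) (W := C_R_NormedModule)
  (fun s : R => plus y (scal s k)) f s (fun t : R => scal t k) _ G Hz).
Qed.

(** With A = 0 this is the mean value inequality; with A = Df y it bounds the
    first-order Taylor remainder. *)
Lemma mean_value_segment {E : NormedModule R_AbsRing} (f A : E -> C)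
    (Df : E -> E -> C) (x y : E) (D : R) :
  (forall s, 0 <= s <= 1 ->
     let z := plus y (scal s (minus x y)) in
     filterdiff (V := C_R_NormedModule) f (locally z) (Df z) /\
     Cmod (Df z (minus x y) - A (minus x y)) <= D) ->
  Cmod (f x - f y - A (minus x y)) <= D.
Proof.
intros H.
set (k := minus x y) in *.
pose (phi := fun s : R => (f (plus y (scal s k)) - RtoC s * A k)%C).
assert (P : Cmod (phi 1 - phi 0) <= D * (1 - 0)).
{ apply (mean_value_C phi (fun s => (Df (plus y (scal s k)) k - RtoC 1 * A k)%C)).
  lra. 2: { intros s Hs. rewrite Cmult_1_l. apply H, Hs. }
  intros s Hs. apply is_derive_C_minus.
  2: { eapply is_derive_C_eq. apply is_derive_C_mult.
       apply (is_derive_C_RtoC (fun s => s) s 1). apply (is_derive_id s).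
       apply is_derive_C_const. C_calc. }
  apply derivative_along_line, H, Hs. }
unfold phi in P.
replace (plus y (scal 1 k)) with x in P.
replace (plus y (scal 0 k)) with y in P.
replace (f x - f y - A k)%C with (f x - RtoC 1 * A k - (f y - RtoC 0 * A k))%C by ring.
lra.
- symmetry; etransitivity; [apply f_equal; apply (scal_zero_l k) | apply plus_zero_r].
- symmetry; etransitivity; [apply f_equal; apply (scal_one k) |].
  etransitivity; [apply plus_comm |]. unfold k, minus.
  etransitivity; [symmetry; apply plus_assoc |].
  etransitivity; [apply f_equal; apply (plus_opp_l y) | apply plus_zero_r].
Qed.

(** Crude bounds with the factor 3 are enough here and avoid the convexity of
    balls. *)
Lemma segment_radius {E : NormedModule R_AbsRing} (x0 x y : E) r s :
  norm (minus x x0) < r -> norm (minus y x0) < r -> 0 <= s <= 1 ->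
  norm (minus (plus y (scal s (minus x y))) x0) < 3 * r /\
  norm (minus (plus y (scal s (minus x y))) y) <= norm (minus x y) /\
  norm (minus x y) < 2 * r.
Proof.
intros Hx Hy Hs.
assert (A : norm (minus x y) < 2 * r).
{ rewrite (minus_trans x0). eapply Rle_lt_trans; [apply norm_triangle |].
  rewrite <- (norm_opp (minus x0 y)), opp_minus. lra. }
assert (B : norm (scal s (minus x y)) <= norm (minus x y)).
{ eapply Rle_trans; [apply (norm_scal (K := R_AbsRing) s (minus x y)) |].
  change (abs s) with (Rabs s). rewrite Rabs_pos_eq by lra.
  generalize (norm_ge_0 (minus x y)); nra. }
repeat split; trivial.
- unfold minus at 1. rewrite <- plus_assoc, (plus_comm _ (opp x0)), plus_assoc.
  eapply Rle_lt_trans; [apply norm_triangle |]. unfold minus in *. lra.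
- replace (minus (plus y (scal s (minus x y))) y) with (scal s (minus x y)); [exact B |].
  unfold minus at 2. rewrite (plus_comm y).
  symmetry; etransitivity; [symmetry; apply plus_assoc |].
  etransitivity; [apply f_equal; apply (plus_opp_r y) | apply plus_zero_r].
Qed.

Lemma Ck_on_S_lipschitz {E : NormedModule R_AbsRing} (U : E -> Prop) (f : E -> C) x0 :
  finitely_tested E -> locally x0 U ->
  Ck_on (F := C_R_NormedModule) 1 U f ->
  exists M r, 0 < M /\ 0 < r /\
  forall x y, norm (minus x x0) < r -> norm (minus y x0) < r ->
  Cmod (f x - f y) <= M * norm (minus x y).
Proof.
intros HE HU [Df [H1 H2]].
assert (Ux0 : U x0) by (apply locally_singleton, HU).
destruct (derivative_locally_bounded Df x0 HE) as [M [r [HM [Hr B]]]].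
{ revert HU. apply filter_imp. intros x Hx. apply (proj1 (H1 x Hx)). }
{ intros h. apply H2, Ux0. }
destruct (locally_norm_radius _ _ HU) as [r' [Hr' HU']].
exists M, (Rmin r r' / 3). repeat split; trivial.
{ apply Rdiv_lt_0_compat; [apply Rmin_pos; lra | lra]. }
intros x y Hx Hy.
replace (f x - f y)%C with (f x - f y - RtoC 0)%C by C_calc.
apply (mean_value_segment f (fun _ => RtoC 0) Df).
intros s Hs z. destruct (segment_radius x0 x y _ s Hx Hy Hs) as [P _].
fold z in P. generalize (Rmin_l r r') (Rmin_r r r'); intros.
split.
- apply H1, HU'. lra.
- replace (Df z (minus x y) - RtoC 0)%C with (Df z (minus x y)) by C_calc.
  apply B. lra.
Qed.

(** Each x |-> Df x e is of class C^1, hence locally Lipschitz; finitely many e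
    suffice, so Df is locally Lipschitz in the operator norm, and the
    quadratic Taylor remainder follows by the mean value inequality. *)
Lemma Ck_on_2_taylor {E : NormedModule R_AbsRing} (U : E -> Prop) (f : E -> C) x0 :
  finitely_tested E -> locally x0 U ->
  Ck_on (F := C_R_NormedModule) 2 U f ->
  exists Df : E -> E -> C,
  (forall x, U x -> filterdiff (V := C_R_NormedModule) f (locally x) (Df x)) /\
  (forall h x, U x -> continuous (U := C_R_NormedModule) (fun x => Df x h) x) /\
  exists M r, 0 < M /\ 0 < r /\
  (forall x, norm (minus x x0) < r -> U x) /\
  (forall x y h, norm (minus x x0) < r -> norm (minus y x0) < r ->
     Cmod (Df x h - Df y h) <= M * norm (minus x y) * norm h) /\
  (forall x y, norm (minus x x0) < r -> norm (minus y x0) < r ->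
     Cmod (f x - f y - Df y (minus x y)) <= M * norm (minus x y) * norm (minus x y)).
Proof.
intros HE HU [Df [H1 H2]].
assert (HE' := HE). destruct HE' as [l [K [HK Hl]]].
exists Df. split; [exact H1 |]. split.
{ intros h x Hx. destruct (H2 h) as [D2 [HD _]].
  apply (filterdiff_continuous (V := C_R_NormedModule) (fun x => Df x h)).
  eexists; apply HD, Hx. }
assert (B : exists M r, 0 < M /\ 0 < r /\
  forall x y e, norm (minus x x0) < r -> norm (minus y x0) < r -> In e l ->
    Cmod (Df x e - Df y e) <= M * norm (minus x y)).
{ clear Hl. induction l as [| e l IH].
  - exists 1, 1. repeat split; try lra. intros x y e _ _ [].
  - destruct IH as [M [r [HM [Hr IH]]]].
    destruct (Ck_on_S_lipschitz U (fun x => Df x e) x0 HE HU (H2 e)) as [M' [r' [HM' [Hr' He]]]].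
    exists (M + M'), (Rmin r r'). generalize (Rmin_l r r') (Rmin_r r r'); intros.
    repeat split. lra. apply Rmin_pos; lra.
    intros x y e' Hx Hy [-> | Hin]; generalize (norm_ge_0 (minus x y)); intros.
    + assert (Cmod (Df x e' - Df y e') <= M' * norm (minus x y)) by (apply He; lra). nra.
    + assert (Cmod (Df x e' - Df y e') <= M * norm (minus x y)) by (apply IH; trivial; lra). nra. }
destruct B as [M [r [HM [Hr B]]]].
destruct (locally_norm_radius _ _ HU) as [r' [Hr' HU']].
generalize (Rmin_l r r') (Rmin_r r r') (Rmin_pos r r' Hr Hr'); intros m1 m2 m3.
assert (L : forall x y h, norm (minus x x0) < Rmin r r' -> norm (minus y x0) < Rmin r r' ->
     Cmod (Df x h - Df y h) <= K * M * norm (minus x y) * norm h).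
{ intros x y h Hx Hy. replace (K * M * norm (minus x y)) with (K * (M * norm (minus x y))) by ring.
  apply (Hl (fun h => Df x h - Df y h)%C).
  - assert (Lx := proj1 (H1 x (HU' x ltac:(lra)))).
    assert (Ly := proj1 (H1 y (HU' y ltac:(lra)))).
    split.
    + intros a b. rewrite (linear_plus _ Lx), (linear_plus _ Ly).
      unfold plus; simpl. unfold prod_plus, plus; simpl. C_calc.
    + intros k a. rewrite (linear_scal _ Lx), (linear_scal _ Ly).
      apply injective_projections; simpl; unfold scal; simpl; unfold mult; simpl; ring.
    + destruct (linear_norm _ Lx) as [M1 [P1 Q1]]. destruct (linear_norm _ Ly) as [M2 [P2 Q2]].
      exists (M1 + M2). split; [lra |]. intros a.
      specialize (Q1 a). specialize (Q2 a).
      change (norm (Df x a)) with (norm (V := prod_NormedModule R_AbsRing R_NormedModule R_NormedModule) (Df x a)) in Q1.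
      change (norm (Df y a)) with (norm (V := prod_NormedModule R_AbsRing R_NormedModule R_NormedModule) (Df y a)) in Q2.
      rewrite <- Cmod_norm in Q1, Q2.
      assert (Z := Cmod_minus_le (Df x a) (Df y a)).
      apply Rle_trans with (Cmod (Df x a - Df y a)). rewrite Cmod_norm; apply Rle_refl.
      lra.
  - generalize (norm_ge_0 (minus x y)); nra.
  - intros e He. apply B; trivial; lra. }
exists (K * M), (Rmin r r' / 3). split; [nra |]. split; [lra |]. split; [| split].
- intros x Hx. apply HU'. lra.
- intros x y h Hx Hy. apply L; lra.
- intros x y Hx Hy. apply (mean_value_segment f (Df y) Df).
  intros s Hs z. destruct (segment_radius x0 x y _ s Hx Hy Hs) as [P [Q _]].
  fold z in P, Q. split.
  + apply H1, HU'. lra.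
  + eapply Rle_trans. apply L; lra.
    apply Rmult_le_compat_r. apply norm_ge_0.
    apply Rmult_le_compat_l. nra. exact Q.
Qed.

(** * Fixed points of contractions and the Cauchy problem *)

(** The numbers x n - 2 b / 2^n increase and the numbers x n + 2 b / 2^n
    decrease; the limit is the supremum of the former. *)
Lemma geometric_Cauchy_limit (x : nat -> R) (b : R) :
  (forall n, Rabs (x (S n) - x n) <= b * (/ 2) ^ n) ->
  exists l, forall n, Rabs (x n - l) <= 2 * b * (/ 2) ^ n.
Proof.
intros Hx.
pose (z := fun n => x n - 2 * b * (/ 2) ^ n).
pose (y := fun n => x n + 2 * b * (/ 2) ^ n).
assert (Hz : forall n k, z n <= z (k + n)%nat).
{ intros n k; induction k as [| k IH]; cbn [Nat.add]; [lra |].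
  generalize (proj1 (Rabs_le_between _ _) (Hx (k + n)%nat)).
  unfold z in *; simpl; lra. }
assert (Hy : forall n k, y (k + n)%nat <= y n).
{ intros n k; induction k as [| k IH]; cbn [Nat.add]; [lra |].
  generalize (proj1 (Rabs_le_between _ _) (Hx (k + n)%nat)).
  unfold y in *; simpl; lra. }
assert (Hb : forall n, z n <= y n).
{ intros n. unfold z, y.
  assert (0 <= b * (/ 2) ^ n) by (eapply Rle_trans; [apply Rabs_pos | apply Hx]). lra. }
assert (Hzy : forall n m, z n <= y m).
{ intros n m. apply Rle_trans with (z (m + n)%nat); [apply Hz |].
  apply Rle_trans with (y (m + n)%nat); [apply Hb |]. rewrite Nat.add_comm; apply Hy. }
destruct (completeness (fun r => exists n, r = z n)) as [l [Hl1 Hl2]].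
{ exists (y 0%nat). intros r [n ->]; apply Hzy. }
{ exists (z 0%nat), 0%nat; reflexivity. }
exists l. intros n. apply Rabs_le.
assert (z n <= l) by (apply Hl1; exists n; reflexivity).
assert (l <= y n) by (apply Hl2; intros r [m ->]; apply Hzy).
unfold z, y in *; lra.
Qed.

Lemma half_pow_small (b e : R) : 0 < e -> exists n, b * (/ 2) ^ n <= e.
Proof.
intros He.
destruct (pow_lt_1_zero (/ 2) ltac:(rewrite Rabs_pos_eq; lra) (e / (Rabs b + 1))) as [n Hn].
{ apply Rdiv_lt_0_compat; [lra | generalize (Rabs_pos b); lra]. }
exists n. specialize (Hn n (le_n n)).
assert (0 < (/ 2) ^ n) by (apply pow_lt; lra).
rewrite Rabs_pos_eq in Hn by lra.
generalize (Rabs_pos b) (Rle_abs b); intros.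
assert ((/ 2) ^ n * (Rabs b + 1) < e).
{ apply (Rmult_lt_compat_r (Rabs b + 1)) in Hn; [| lra].
  unfold Rdiv in Hn. rewrite Rmult_assoc, Rinv_l, Rmult_1_r in Hn by lra. exact Hn. }
nra.
Qed.

(** The contraction principle for the sup norm on functions from R to C, on a
    class P closed under uniform limits.  Continuity, periodicity and bounds
    are all put into P. *)
Lemma contraction_fixed_point (P : (R -> C) -> Prop)
    (T : (R -> C) -> R -> C) (u0 : R -> C) (b : R) :
  P u0 -> (forall u, P u -> P (T u)) ->
  (forall t, Cmod (T u0 t - u0 t) <= b) ->
  (forall u v d, P u -> P v -> (forall t, Cmod (u t - v t) <= d) ->
     forall t, Cmod (T u t - T v t) <= / 2 * d) ->
  (forall (w : nat -> R -> C) u, (forall n, P (w n)) ->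
     (forall e, 0 < e -> exists n, forall t, Cmod (w n t - u t) <= e) -> P u) ->
  exists u, P u /\ forall t, T u t = u t.
Proof.
intros P0 PT Hb Hc Hcl.
pose (w := fix w n := match n with O => u0 | S n => T (w n) end).
assert (Pw : forall n, P (w n)) by (induction n; simpl; auto).
assert (Hw : forall n t, Cmod (w (S n) t - w n t) <= b * (/ 2) ^ n).
{ induction n; intros t. simpl. rewrite Rmult_1_r; apply Hb.
  replace (b * (/ 2) ^ S n) with (/ 2 * (b * (/ 2) ^ n)) by (simpl; ring).
  apply (Hc (w (S n)) (w n)); auto. }
assert (L : forall t, exists l, forall n, Cmod (w n t - l) <= 4 * b * (/ 2) ^ n).
{ intros t.
  assert (RI : forall z : C, Rabs (Re z) <= Cmod z /\ Rabs (Im z) <= Cmod z).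
  { intros z; split; (eapply Rle_trans; [| apply Rmax_Cmod]); [apply Rmax_l | apply Rmax_r]. }
  destruct (geometric_Cauchy_limit (fun n => Re (w n t)) b) as [l1 H1].
  { intros n. eapply Rle_trans; [| apply (Hw n t)].
    replace (Re (w (S n) t) - Re (w n t)) with (Re (w (S n) t - w n t)) by reflexivity. apply RI. }
  destruct (geometric_Cauchy_limit (fun n => Im (w n t)) b) as [l2 H2].
  { intros n. eapply Rle_trans; [| apply (Hw n t)].
    replace (Im (w (S n) t) - Im (w n t)) with (Im (w (S n) t - w n t)) by reflexivity. apply RI. }
  exists (l1, l2). intros n.
  replace (w n t - (l1, l2))%C with (RtoC (Re (w n t) - l1) + Ci * RtoC (Im (w n t) - l2))%C
    by C_calc.
  eapply Rle_trans; [apply Cmod_triangle |].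
  rewrite Cmod_mult, !Cmod_R.
  replace (Cmod Ci) with 1.
  specialize (H1 n); specialize (H2 n); simpl in H1, H2; lra.
  unfold Cmod, Ci; simpl. replace (0 * (0 * 1) + 1 * (1 * 1)) with 1 by ring. symmetry; apply sqrt_1. }
pose (u := fun t => proj1_sig (constructive_indefinite_description _ (L t))).
assert (Hu : forall n t, Cmod (w n t - u t) <= 4 * b * (/ 2) ^ n).
{ intros n t. unfold u. destruct (constructive_indefinite_description _ (L t)) as [l Hl].
  apply Hl. }
assert (Pu : P u).
{ apply (Hcl w); trivial. intros e He.
  destruct (half_pow_small (4 * b) e He) as [n Hn]. exists n. intros t.
  eapply Rle_trans; [apply Hu | exact Hn]. }
exists u; split; trivial. intros t.
assert (Z : Cmod (T u t - u t) <= 0).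
{ apply le_epsilon. intros e He.
  destruct (half_pow_small (4 * b) e He) as [n Hn].
  assert (A1 : Cmod (T (w n) t - T u t) <= / 2 * (4 * b * (/ 2) ^ n)) by (apply Hc; auto).
  assert (A2 := Hu (S n) t). simpl in A2.
  replace (T u t - u t)%C with ((T (w n) t - u t) - (T (w n) t - T u t))%C by ring.
  eapply Rle_trans; [apply Cmod_minus_le |]. lra. }
assert (E : (T u t - u t)%C = RtoC 0).
{ apply Cmod_eq_0. generalize (Cmod_ge_0 (T u t - u t)); lra. }
replace (T u t) with (u t + (T u t - u t))%C by ring. rewrite E; ring.
Qed.

Lemma continuousC_uniform_limit (w : nat -> R -> C) (u : R -> C) :
  (forall n t, continuousC (w n) t) ->
  (forall e, 0 < e -> exists n, forall t, Cmod (w n t - u t) <= e) ->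
  forall t, continuousC u t.
Proof.
intros Hw Hl t. apply continuousC_eps. intros e He.
destruct (Hl (e / 4)) as [n Hn]; [lra |].
destruct (proj1 (continuousC_eps _ _) (Hw n t) (e / 4)) as [d [Hd H]]; [lra |].
exists d; split; trivial. intros s Hs. specialize (H s Hs).
replace (u s - u t)%C with ((w n s - w n t) - (w n s - u s) + (w n t - u t))%C by ring.
eapply Rle_lt_trans; [apply Cmod_triangle |].
generalize (Cmod_minus_le (w n s - w n t) (w n s - u s)) (Hn s) (Hn t); lra.
Qed.

Lemma Cmod_le_uniform_limit (w : nat -> R -> C) (u : R -> C) (c : R -> C) (r : R) :
  (forall n t, Cmod (w n t - c t) <= r) ->
  (forall e, 0 < e -> exists n, forall t, Cmod (w n t - u t) <= e) ->
  forall t, Cmod (u t - c t) <= r.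
Proof.
intros Hw Hl t. apply le_epsilon. intros e He. destruct (Hl e He) as [n Hn].
replace (u t - c t)%C with ((w n t - c t) - (w n t - u t))%C by ring.
eapply Rle_trans; [apply Cmod_minus_le |]. generalize (Hw n t) (Hn t); lra.
Qed.

Lemma Cmod_attains_max (f : R -> C) (a b : R) :
  a <= b -> (forall t, a <= t <= b -> continuousC f t) ->
  exists s, a <= s <= b /\ forall t, a <= t <= b -> Cmod (f t) <= Cmod (f s).
Proof.
intros Hab Hf.
destruct (continuity_ab_maj (fun t => Cmod (f t)) a b Hab) as [s [Hs Hs']].
2: { exists s; auto. }
intros t Ht. apply continuity_pt_locally. intros [e He].
destruct (proj1 (continuousC_eps _ _) (Hf t Ht) e He) as [d [Hd H]].
exists (mkposreal d Hd). intros s Hs. specialize (H s Hs).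
simpl. apply Rle_lt_trans with (2 := H).
generalize (Cmod_le_plus (f s) (f t)) (Cmod_le_plus (f t) (f s)).
rewrite (Cmod_minus_sym (f t)). intros. apply Rabs_le; lra.
Qed.

Lemma primitive_bound_fwd (f : R -> C) (D t : R) :
  (forall s, continuousC f s) -> (forall s, 0 <= s <= t -> Cmod (f s) <= D) -> 0 <= t ->
  Cmod (primitive f t) <= D * t.
Proof.
intros Hf HD Ht.
replace (primitive f t) with (primitive f t - primitive f 0)%C by (rewrite primitive_0; ring).
eapply Rle_trans; [apply (mean_value_C (primitive f) f 0 t D) |]; trivial.
intros; apply primitive_derive, Hf. lra.
Qed.

Lemma primitive_bound (f : R -> C) (D t : R) :
  (forall s, continuousC f s) -> (forall s, Cmod (f s) <= D) ->
  Cmod (primitive f t) <= D * Rabs t.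
Proof.
intros Hf HD. destruct (Rle_lt_dec 0 t) as [Ht | Ht].
- rewrite Rabs_pos_eq by lra. apply primitive_bound_fwd; auto.
- rewrite Rabs_left by lra.
  replace (primitive f t) with (- (primitive f 0 - primitive f t))%C by (rewrite primitive_0; ring).
  rewrite Cmod_opp.
  eapply Rle_trans; [apply (mean_value_C (primitive f) f t 0 D) |]; auto.
  lra. intros; apply primitive_derive, Hf. lra.
Qed.

Lemma primitive_minus_bound (f g : R -> C) (D t : R) :
  (forall s, continuousC f s) -> (forall s, continuousC g s) ->
  (forall s, Cmod (f s - g s) <= D) ->
  Cmod (primitive f t - primitive g t) <= D * Rabs t.
Proof.
intros Hf Hg HD.
assert (Hd : forall s, is_derive_C (fun s => primitive f s - primitive g s)%C s (f s - g s)%C).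
{ intros s. apply is_derive_C_minus; apply primitive_derive; assumption. }
assert (Z : (primitive f 0 - primitive g 0 = RtoC 0)%C) by (rewrite !primitive_0; ring).
destruct (Rle_lt_dec 0 t) as [Ht | Ht].
- rewrite Rabs_pos_eq by lra.
  replace (primitive f t - primitive g t)%C with
    ((primitive f t - primitive g t) - (primitive f 0 - primitive g 0))%C by (rewrite Z; ring).
  eapply Rle_trans; [apply (mean_value_C (fun s => primitive f s - primitive g s)%C
    (fun s => f s - g s)%C 0 t D) |]; auto. lra.
- rewrite Rabs_left by lra.
  replace (primitive f t - primitive g t)%C with
    (- ((primitive f 0 - primitive g 0) - (primitive f t - primitive g t)))%C by (rewrite Z; ring).
  rewrite Cmod_opp.
  eapply Rle_trans; [apply (mean_value_C (fun s => primitive f s - primitive g s)%C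
    (fun s => f s - g s)%C t 0 D) |]; auto; lra.
Qed.

(** A primitive from 0 to clamp t is bounded on the whole real line, while near
    [0, 2 pi] it still is the ordinary primitive.  Thus Picard iteration runs
    on functions defined on R, and the solution is differentiable across both
    endpoints. *)
Definition clamp (t : R) : R := Rmax (-1) (Rmin t 9).

Lemma clamp_bound t : Rabs (clamp t) <= 9.
Proof.
unfold clamp. apply Rabs_le. split.
generalize (Rmax_l (-1) (Rmin t 9)); lra.
apply Rmax_lub; [lra | apply Rmin_r].
Qed.

Lemma clamp_id t : -1 <= t <= 9 -> clamp t = t.
Proof. intros H; unfold clamp; rewrite Rmin_left, Rmax_right; lra. Qed.

Lemma clamp_lip s t : Rabs (clamp s - clamp t) <= Rabs (s - t).
Proof.
unfold clamp, Rmax, Rmin.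
repeat destruct (Rle_dec _ _); unfold Rabs; repeat destruct (Rcase_abs _); lra.
Qed.

(** One Picard contraction covers the whole period because the field is small:
    an interval of length 9 contains [0, 2 pi], and 9 l <= 1/2. *)
Lemma cauchy_problem (n : R -> C -> C) (x : C) (rho b l : R) :
  (forall u, (forall t, continuousC u t) -> forall t, continuousC (fun s => n s (u s)) t) ->
  (forall t z, Cmod (z - x) <= rho -> Cmod (n t z) <= b) ->
  (forall t y z, Cmod (y - x) <= rho -> Cmod (z - x) <= rho ->
     Cmod (n t y - n t z) <= l * Cmod (y - z)) ->
  0 <= rho -> 9 * b <= rho -> 0 <= l -> 18 * l <= 1 ->
  exists u, (forall t, continuousC u t) /\ u 0 = x /\
    (forall t, Cmod (u t - x) <= rho) /\
    (forall t, 0 <= t <= 2 * PI -> is_derive_C u t (n t (u t))).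
Proof.
intros Hc Hb Hl Hrho Hb' Hl0 Hl'.
pose (P := fun u : R -> C => (forall t, continuousC u t) /\ forall t, Cmod (u t - x) <= rho).
pose (T := fun (u : R -> C) t => (x + primitive (fun s => n s (u s)) (clamp t))%C).
destruct (contraction_fixed_point P T (fun _ => x) rho) as [u [[Cu Bu] Hu]].
- split. intros; apply continuousC_const.
  intros t. replace (x - x)%C with (RtoC 0) by ring. rewrite Cmod_0; exact Hrho.
- intros u [Cu Bu]. split.
  + intros t. apply continuousC_eps. intros e He.
    assert (K : continuousC (primitive (fun s => n s (u s))) (clamp t)).
    { eapply is_derive_C_continuous, primitive_derive, Hc, Cu. }
    destruct (proj1 (continuousC_eps _ _) K e He) as [d [Hd H]].
    exists d; split; trivial. intros s Hs. unfold T.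
    match goal with |- Cmod ?z < e => replace z with
     (primitive (fun s => n s (u s)) (clamp s) - primitive (fun s => n s (u s)) (clamp t))%C by ring end.
    apply H. eapply Rle_lt_trans; [apply clamp_lip | exact Hs].
  + intros t. unfold T.
    match goal with |- Cmod ?z <= _ => replace z with
     (primitive (fun s => n s (u s)) (clamp t))%C by ring end.
    eapply Rle_trans; [apply primitive_bound with (D := b) |].
    apply Hc, Cu. intros; apply Hb, Bu.
    generalize (clamp_bound t); intros.
    assert (0 <= b) by (eapply Rle_trans; [apply Cmod_ge_0 | apply (Hb 0 (u 0)), Bu]). nra.
- intros t. unfold T.
    match goal with |- Cmod ?z <= _ => replace z with
     (primitive (fun s => n s x) (clamp t))%C by ring end.
    assert (X : Cmod (x - x) <= rho).
    { replace (x - x)%C with (RtoC 0) by ring. rewrite Cmod_0; exact Hrho. }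
    eapply Rle_trans; [apply primitive_bound with (D := b) |].
    apply (Hc (fun _ => x)); intros; apply continuousC_const. intros; apply Hb, X.
    generalize (clamp_bound t); intros.
    assert (0 <= b) by (eapply Rle_trans; [apply Cmod_ge_0 | apply (Hb 0 x), X]). nra.
- intros u v d [Cu Bu] [Cv Bv] Hd t. unfold T.
    match goal with |- Cmod ?z <= _ => replace z with
     (primitive (fun s => n s (u s)) (clamp t) - primitive (fun s => n s (v s)) (clamp t))%C by ring end.
    eapply Rle_trans; [apply primitive_minus_bound with (D := l * d) |].
    apply Hc, Cu. apply Hc, Cv.
    intros s. eapply Rle_trans; [apply Hl; auto |]. apply Rmult_le_compat_l; auto.
    assert (0 <= d) by (eapply Rle_trans; [apply Cmod_ge_0 | apply (Hd 0)]).
    generalize (clamp_bound t) (Rabs_pos (clamp t)); intros.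
    assert (0 <= l * d) by nra.
    apply Rle_trans with (l * d * 9); [apply Rmult_le_compat_l; lra | nra].
- intros w u Pw Hw. split.
  + apply (continuousC_uniform_limit w); trivial. intros n0; apply (Pw n0).
  + apply (Cmod_le_uniform_limit w u (fun _ => x)); trivial. intros n0; apply (Pw n0).
- exists u. split; [exact Cu |]. split; [| split; [exact Bu |]].
  + rewrite <- Hu. unfold T. rewrite clamp_id, primitive_0 by lra. ring.
  + intros t Ht. generalize PI_4; intros Hpi.
    apply (is_derive_ext_loc (V := C_R_NormedModule) (fun t => x + primitive (fun s => n s (u s)) t)%C).
    * assert (Hpos : 0 < 1/2) by lra. exists (mkposreal _ Hpos). intros s Hs.
      assert (Rabs (s - t) < 1/2) by exact Hs. apply Rabs_def2 in H.
      rewrite <- (Hu s). unfold T. rewrite clamp_id by lra. reflexivity.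
    * eapply is_derive_C_eq. apply is_derive_C_plus. apply is_derive_C_const.
      apply primitive_derive, Hc, Cu. ring.
Qed.

(** * Averages over a period *)

Lemma PI_8 : 0 < 2 * PI <= 8.
Proof. generalize PI_4 PI_RGT_0; lra. Qed.

Lemma RtoC_2PI_neq0 : RtoC (2 * PI) <> 0%C.
Proof. intros K. apply (f_equal fst) in K. simpl in K. generalize PI_8; lra. Qed.

Lemma average_close (f g : R -> C) D :
  (forall t, continuousC f t) -> (forall t, continuousC g t) ->
  (forall t, 0 <= t <= 2 * PI -> Cmod (f t - g t) <= D) ->
  Cmod (average f - average g) <= D.
Proof.
intros Hf Hg HD. generalize PI_8; intros Hpi.
rewrite (average_primitive (primitive f) f), (average_primitive (primitive g) g); auto;
 try (intros; apply primitive_derive; assumption).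
rewrite !primitive_0.
assert (P : Cmod ((primitive f (2 * PI) - primitive g (2 * PI)) - (primitive f 0 - primitive g 0)) <= D * (2 * PI - 0)).
{ apply (mean_value_C (fun t => primitive f t - primitive g t)%C (fun t => f t - g t)%C); trivial. lra.
  intros; apply is_derive_C_minus; apply primitive_derive; assumption. }
rewrite !primitive_0 in P.
replace ((primitive f (2 * PI) - 0) / RtoC (2 * PI) - (primitive g (2 * PI) - 0) / RtoC (2 * PI))%C
 with ((primitive f (2 * PI) - primitive g (2 * PI) - (0 - 0)) * / RtoC (2 * PI))%C
 by (field; apply RtoC_2PI_neq0).
rewrite Cmod_mult, Cmod_inv by apply RtoC_2PI_neq0. rewrite Cmod_R, Rabs_pos_eq by lra.
apply (Rmult_le_reg_r (2 * PI)). lra. rewrite Rmult_assoc, Rinv_l by lra. lra.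
Qed.

Lemma average_trig (c0 k1 k2 : C) :
  average (fun t => c0 + k1 * cis (1 * t) + k2 * cis (2 * t))%C = c0.
Proof.
rewrite (average_primitive (fun t => c0 * RtoC t + (- Ci * k1) * cis (1 * t) + (- Ci * k2 / 2) * cis (2 * t))%C).
- replace (1 * (2 * PI)) with (2 * PI) by ring.
  replace (2 * (2 * PI)) with (2 * PI + 2 * PI) by ring.
  rewrite cis_period, cis_2PI, !Rmult_0_r, cis_0. field. apply RtoC_2PI_neq0.
- intros t _. eapply is_derive_C_eq.
  apply is_derive_C_plus; [apply is_derive_C_plus |]; apply is_derive_C_cmult.
  apply (is_derive_C_RtoC (fun s => s) t 1). apply (is_derive_id t).
  apply is_derive_C_cis. apply is_derive_C_cis.
  apply injective_projections; simpl; field.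
- intros t. apply continuousC_plus; [apply continuousC_plus |].
  apply continuousC_const. apply continuousC_mult. apply continuousC_const. apply continuousC_cis.
  apply continuousC_mult. apply continuousC_const. apply continuousC_cis.
Qed.

(** The Fourier modes 1 and 2 do not contribute to the average: this is how the
    terms k e^{it} and be conj c e^{2it} disappear. *)
Lemma average_near (f : R -> C) (c0 k1 k2 : C) D :
  (forall t, continuousC f t) ->
  (forall t, 0 <= t <= 2 * PI -> Cmod (f t - (c0 + k1 * cis (1 * t) + k2 * cis (2 * t))) <= D) ->
  Cmod (average f - c0) <= D.
Proof.
intros Hf HD. rewrite <- (average_trig c0 k1 k2). apply average_close; trivial.
intros t. apply continuousC_plus; [apply continuousC_plus |].
  apply continuousC_const. apply continuousC_mult. apply continuousC_const. apply continuousC_cis.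
  apply continuousC_mult. apply continuousC_const. apply continuousC_cis.
Qed.

Lemma average_near_const (f : R -> C) (c0 : C) D :
  (forall t, continuousC f t) ->
  (forall t, 0 <= t <= 2 * PI -> Cmod (f t - c0) <= D) ->
  Cmod (average f - c0) <= D.
Proof.
intros Hf HD. apply (average_near f c0 0 0); trivial. intros t Ht.
replace (c0 + 0 * cis (1 * t) + 0 * cis (2 * t))%C with c0 by ring. auto.
Qed.

Lemma average_cmult (c : C) (f : R -> C) :
  (forall t, continuousC f t) -> average (fun t => c * f t)%C = (c * average f)%C.
Proof.
intros Hf.
rewrite (average_primitive (primitive f) f); auto.
2: intros; apply primitive_derive; assumption.
rewrite (average_primitive (fun t => c * primitive f t)%C).
field. apply RtoC_2PI_neq0.
intros; apply is_derive_C_cmult, primitive_derive, Hf.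
intros t; apply continuousC_mult; [apply continuousC_const | apply Hf].
Qed.

Lemma average_minus (f g : R -> C) :
  (forall t, continuousC f t) -> (forall t, continuousC g t) ->
  average (fun t => f t - g t)%C = (average f - average g)%C.
Proof.
intros Hf Hg.
rewrite (average_primitive (primitive f) f), (average_primitive (primitive g) g); auto;
 try (intros; apply primitive_derive; assumption).
rewrite (average_primitive (fun t => primitive f t - primitive g t)%C).
field. apply RtoC_2PI_neq0.
intros; apply is_derive_C_minus; apply primitive_derive; assumption.
intros t; apply continuousC_minus; auto.
Qed.

Lemma average_derivative_periodic (f f' : R -> C) :
  (forall t, is_derive_C f t (f' t)) -> (forall t, continuousC f' t) ->
  (forall t, f (t + 2 * PI) = f t) -> average f' = 0%C.
Proof.
intros Hf Hc Hp. rewrite (average_primitive f f'); auto.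
rewrite <- (Rplus_0_l (2 * PI)) at 1. rewrite Hp. field. apply RtoC_2PI_neq0.
Qed.

(** A periodic function is close to its mean when its derivative is small;
    8 is an upper bound for 2 pi. *)
Lemma oscillation (f f' : R -> C) D :
  (forall t, is_derive_C f t (f' t)) ->
  (forall t, 0 <= t <= 2 * PI -> Cmod (f' t) <= D) ->
  forall t, 0 <= t <= 2 * PI -> Cmod (f t - average f) <= 8 * D.
Proof.
intros Hf HD t Ht. rewrite Cmod_minus_sym. generalize PI_8; intros Hpi.
assert (0 <= D) by (eapply Rle_trans; [apply Cmod_ge_0 | apply (HD t Ht)]).
apply average_near_const. intros s; eapply is_derive_C_continuous, Hf.
intros s Hs.
destruct (Rle_lt_dec t s).
- eapply Rle_trans; [apply (mean_value_C f f' t s D) |]; trivial.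
  intros; apply HD; lra. nra.
- rewrite Cmod_minus_sym. eapply Rle_trans; [apply (mean_value_C f f' s t D) |]; trivial. lra.
  intros; apply HD; lra. nra.
Qed.

(** * The equation near the circle *)

Lemma lin_part_bound (al be z : C) t :
  Cmod (al * z + be * Cconj z * cis (2 * t)) <= (Cmod al + Cmod be) * Cmod z.
Proof.
eapply Rle_trans; [apply Cmod_triangle |].
rewrite !Cmod_mult, Cmod_conj, Cmod_cis. lra.
Qed.

(** The hypotheses on q' = eps a + mu h under which everything below is proved.
    The map B is the derivative of h in q.  The number om is the error allowed
    in the linearization; it must be a fixed small fraction of Re al, and M is
    one bound for everything else.  The condition h_center says that the
    unperturbed circle satisfies the averaged equation at eps = 0, mu = 0. *)
Record reduced_field (al be : C) (om M r d : R)
    (a : R -> R -> C) (h : R -> C -> R -> C) (B : R -> C -> R -> C -> C) : Prop := {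
  om_gt0 : 0 < om;
  om_small : 32 * om <= Rabs (Re al);
  M_ge1 : 1 <= M;
  lin_part_le_M : Cmod al + Cmod be + om <= M;
  r_gt0 : 0 < r;
  d_gt0 : 0 < d;
  d_le1 : d <= 1;
  a_bound : forall t eps, Rabs eps < d -> Cmod (a t eps) <= M;
  a_lip : forall t eps eps', Rabs eps < d -> Rabs eps' < d ->
    Cmod (a t eps - a t eps') <= M * Rabs (eps - eps');
  a_cont : forall eps, Rabs eps < d -> forall t, continuousC (fun t => a t eps) t;
  a_per : forall eps, Rabs eps < d -> forall t, a (t + 2 * PI) eps = a t eps;
  h_bound : forall t q mu, Rabs mu < d -> Cmod (h t q mu) <= M;
  h_strict : forall t q q' mu mu', Cmod q <= r -> Cmod q' <= r ->
    Rabs mu < d -> Rabs mu' < d ->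
    Cmod (h t q mu - h t q' mu' -
      (al * (q - q') + be * Cconj (q - q') * cis (2 * t))) <=
    om * Cmod (q - q') + M * Rabs (mu - mu');
  h_cont : forall mu u, Rabs mu < d -> (forall t, continuousC u t) ->
    forall t, continuousC (fun t => h t (u t) mu) t;
  h_per : forall t q mu, h (t + 2 * PI) q mu = h t q mu;
  h_center : exists k, forall t, h t 0%C 0 = (k * cis (1 * t))%C;
  B_add : forall t q mu y z, Rabs mu < d -> B t q mu (y + z)%C = (B t q mu y + B t q mu z)%C;
  B_scal : forall t q mu (s : R) z, Rabs mu < d -> B t q mu (RtoC s * z)%C = (RtoC s * B t q mu z)%C;
  B_cont : forall mu u y, Rabs mu < d -> (forall t, continuousC u t) ->
    forall t, continuousC (fun t => B t (u t) mu y) t;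
  B_strict : forall t q mu y, Cmod q <= r -> Rabs mu < d ->
    Cmod (B t q mu y - (al * y + be * Cconj y * cis (2 * t))) <= om * Cmod y;
  B_taylor : forall t q q' mu, Cmod q <= r -> Cmod q' <= r -> Rabs mu < d ->
    Cmod (h t q mu - h t q' mu - B t q' mu (q - q')%C) <= M * Cmod (q - q') * Cmod (q - q') }.

Arguments om_gt0 {al be om M r d a h B} _.
Arguments om_small {al be om M r d a h B} _.
Arguments M_ge1 {al be om M r d a h B} _.
Arguments lin_part_le_M {al be om M r d a h B} _.
Arguments r_gt0 {al be om M r d a h B} _.
Arguments d_gt0 {al be om M r d a h B} _.
Arguments d_le1 {al be om M r d a h B} _.
Arguments a_bound {al be om M r d a h B} _.
Arguments a_lip {al be om M r d a h B} _.
Arguments a_cont {al be om M r d a h B} _.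
Arguments a_per {al be om M r d a h B} _.
Arguments h_bound {al be om M r d a h B} _.
Arguments h_strict {al be om M r d a h B} _.
Arguments h_cont {al be om M r d a h B} _.
Arguments h_per {al be om M r d a h B} _.
Arguments h_center {al be om M r d a h B} _.
Arguments B_add {al be om M r d a h B} _.
Arguments B_scal {al be om M r d a h B} _.
Arguments B_cont {al be om M r d a h B} _.
Arguments B_strict {al be om M r d a h B} _.
Arguments B_taylor {al be om M r d a h B} _.

Definition vfield (a : R -> R -> C) (h : R -> C -> R -> C) (eps mu t : R) (q : C) : C :=
  (RtoC eps * a t eps + RtoC mu * h t q mu)%C.

Definition periodic_solution (a : R -> R -> C) (h : R -> C -> R -> C) (eps mu : R)
    (q : R -> C) : Prop :=
  (forall t, is_derive_C q t (vfield a h eps mu t (q t))) /\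
  (forall t, q (t + 2 * PI) = q t).

Lemma h_lip {al be om M r d a h B} (F : reduced_field al be om M r d a h B) t q q' mu mu' :
  Cmod q <= r -> Cmod q' <= r -> Rabs mu < d -> Rabs mu' < d ->
  Cmod (h t q mu - h t q' mu') <= M * Cmod (q - q') + M * Rabs (mu - mu').
Proof.
intros H1 H2 H3 H4.
eapply Rle_trans;
  [apply (Cmod_le_plus _ (al * (q - q') + be * Cconj (q - q') * cis (2 * t))%C) |].
generalize (h_strict F t q q' mu mu' H1 H2 H3 H4).
generalize (lin_part_bound al be (q - q') t) (lin_part_le_M F) (Cmod_ge_0 (q - q')).
intros. set (m := Cmod (q - q')) in *.
assert ((Cmod al + Cmod be + om) * m <= M * m) by (apply Rmult_le_compat_r; lra).
lra.
Qed.

Lemma B_lip {al be om M r d a h B} (F : reduced_field al be om M r d a h B) t q mu y :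
  Cmod q <= r -> Rabs mu < d -> Cmod (B t q mu y) <= M * Cmod y.
Proof.
intros H1 H3.
eapply Rle_trans; [apply (Cmod_le_plus _ (al * y + be * Cconj y * cis (2 * t))%C) |].
generalize (B_strict F t q mu y H1 H3).
generalize (lin_part_bound al be y t) (lin_part_le_M F) (Cmod_ge_0 y).
intros. set (m := Cmod y) in *.
assert ((Cmod al + Cmod be + om) * m <= M * m) by (apply Rmult_le_compat_r; lra).
lra.
Qed.

Lemma B_minus {al be om M r d a h B} (F : reduced_field al be om M r d a h B) t q mu y z :
  Rabs mu < d -> B t q mu (y - z)%C = (B t q mu y - B t q mu z)%C.
Proof.
intros H. replace (y - z)%C with (y + RtoC (-1) * z)%C by C_calc.
rewrite (B_add F), (B_scal F) by trivial.
C_calc.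
Qed.

Lemma vfield_bound {al be om M r d a h B} (F : reduced_field al be om M r d a h B) eps mu t q :
  Rabs eps < d -> Rabs mu < d -> Cmod (vfield a h eps mu t q) <= (Rabs eps + Rabs mu) * M.
Proof.
intros H1 H2. unfold vfield. eapply Rle_trans; [apply Cmod_triangle |].
rewrite !Cmod_mult, !Cmod_R.
generalize (a_bound F t eps H1) (h_bound F t q mu H2)
 (Rabs_pos eps) (Rabs_pos mu). intros. nra.
Qed.

Lemma vfield_cont {al be om M r d a h B} (F : reduced_field al be om M r d a h B) eps mu u :
  Rabs eps < d -> Rabs mu < d -> (forall t, continuousC u t) ->
  forall t, continuousC (fun t => vfield a h eps mu t (u t)) t.
Proof.
intros H1 H2 Hu t. unfold vfield. apply continuousC_plus; apply continuousC_mult.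
apply continuousC_const. apply (a_cont F); trivial.
apply continuousC_const. apply (h_cont F); trivial.
Qed.

Lemma a_eps_lip {al be om M r d a h B} (F : reduced_field al be om M r d a h B) t eps eps' :
  Rabs eps < d -> Rabs eps' < d ->
  Cmod (RtoC eps * a t eps - RtoC eps' * a t eps') <= 2 * M * Rabs (eps - eps').
Proof.
intros H1 H2.
replace (RtoC eps * a t eps - RtoC eps' * a t eps')%C with
 (RtoC (eps - eps') * a t eps + RtoC eps' * (a t eps - a t eps'))%C by (rewrite RtoC_minus; ring).
eapply Rle_trans; [apply Cmod_triangle |]. rewrite !Cmod_mult, !Cmod_R.
generalize (a_bound F t eps H1) (a_lip F t eps eps' H1 H2)
  (d_le1 F) (M_ge1 F).
generalize (Rabs_pos (eps - eps')) (Rabs_pos eps') (Cmod_ge_0 (a t eps - a t eps')). intros.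
assert (Rabs (eps - eps') * Cmod (a t eps) <= Rabs (eps - eps') * M) by (apply Rmult_le_compat_l; lra).
assert (Rabs eps' * Cmod (a t eps - a t eps') <= 1 * (M * Rabs (eps - eps'))).
{ apply Rmult_le_compat; lra. }
lra.
Qed.

(** The difference D of the two solutions stays within e = O(s) + O(mu) sup D of
    its mean c, and D' has mean zero.  Up to the Fourier modes 1 and 2, D' is
    mu al c plus terms of size s, mu e and mu om sup D; this bounds mu al c.
    For equal parameters s = 0, so that solutions with the same mean
    coincide. *)
Lemma comparison {al be om M r d a h B} (F : reduced_field al be om M r d a h B)
    eps eps' mu mu' q q' :
  Rabs eps < d -> Rabs eps' < d -> Rabs mu < d -> Rabs mu' < d ->
  8 * Rabs mu * (M * M) <= om -> 8 * Rabs mu * (M * M) <= / 4 ->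
  periodic_solution a h eps mu q -> periodic_solution a h eps' mu' q' ->
  (forall t, Cmod (q t) <= r) -> (forall t, Cmod (q' t) <= r) ->
  let c := (average q - average q')%C in
  let s := Rabs (eps - eps') + Rabs (mu - mu') in
  Rabs mu * Cmod al * Cmod c <= 220 * (M * M) * s /\
  forall t, Cmod (q t - q' t) <= 2 * Cmod c + 64 * M * s.
Proof.
intros He He' Hm Hm' S1 S2 [Dq Pq] [Dq' Pq'] Bq Bq' c s.
assert (Cq : forall t, continuousC q t) by (intros; eapply is_derive_C_continuous, Dq).
assert (Cq' : forall t, continuousC q' t) by (intros; eapply is_derive_C_continuous, Dq').
assert (Hom := om_gt0 F). assert (Hal := om_small F).
assert (HM := M_ge1 F). assert (HM' := lin_part_le_M F).
assert (Hd1 := d_le1 F).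
assert (al1 : Rabs (Re al) <= Cmod al) by (eapply Rle_trans; [apply Rmax_l | apply Rmax_Cmod]).
generalize PI_8 (Rabs_pos mu) (Cmod_ge_0 c) (Cmod_ge_0 be); intros Hpi Hmu0 Hc0 Hbe0.
assert (Hs0 : 0 <= s) by (unfold s; generalize (Rabs_pos (eps - eps')) (Rabs_pos (mu - mu')); lra).
assert (se : Rabs (eps - eps') <= s) by (unfold s; generalize (Rabs_pos (mu - mu')); lra).
assert (sm : Rabs (mu - mu') <= s) by (unfold s; generalize (Rabs_pos (eps - eps')); lra).
pose (D := fun t => (q t - q' t)%C).
pose (D' := fun t => (vfield a h eps mu t (q t) - vfield a h eps' mu' t (q' t))%C).
assert (HD : forall t, is_derive_C D t (D' t)) by (intros; apply is_derive_C_minus; auto).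
assert (CD : forall t, continuousC D t) by (intros; eapply is_derive_C_continuous, HD).
assert (CD' : forall t, continuousC D' t).
{ intros; apply continuousC_minus; eapply vfield_cont; eauto. }
assert (PD : forall t, D (t + 2 * PI) = D t) by (intros; unfold D; rewrite Pq, Pq'; reflexivity).
assert (AD : average D = c) by (unfold D, c; apply average_minus; trivial).
destruct (Cmod_attains_max D 0 (2 * PI)) as [t0 [Ht0 Hmax]]; [lra | auto |].
set (m := Cmod (D t0)) in *.
assert (Hm0 : 0 <= m) by apply Cmod_ge_0.
(* The part of D' that vanishes when the parameters agree. *)
pose (P := fun t => (RtoC eps * a t eps - RtoC eps' * a t eps' + RtoC (mu - mu') * h t (q' t) mu')%C).
assert (ED : forall t, D' t = (P t + RtoC mu * (h t (q t) mu - h t (q' t) mu'))%C).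
{ intros t. unfold D', P, vfield. rewrite RtoC_minus. ring. }
assert (BP : forall t, Cmod (P t) <= 3 * M * s).
{ intros t. unfold P. eapply Rle_trans; [apply Cmod_triangle |]. rewrite Cmod_mult, Cmod_R.
  generalize (a_eps_lip F t eps eps' He He') (h_bound F t (q' t) mu' Hm')
    (Rabs_pos (mu - mu')) (Rabs_pos (eps - eps')); intros.
  assert (Rabs (mu - mu') * Cmod (h t (q' t) mu') <= s * M).
  { apply Rmult_le_compat; trivial. apply Cmod_ge_0. }
  assert (2 * M * Rabs (eps - eps') <= 2 * M * s) by (apply Rmult_le_compat_l; lra). lra. }
assert (MM : M <= M * M) by nra.
assert (BD' : forall t, 0 <= t <= 2 * PI -> Cmod (D' t) <= 4 * M * s + Rabs mu * M * m).
{ intros t Ht. rewrite ED. eapply Rle_trans; [apply Cmod_triangle |]. rewrite Cmod_mult, Cmod_R.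
  generalize (h_lip F t (q t) (q' t) mu mu' (Bq t) (Bq' t) Hm Hm'); intros X.
  specialize (Hmax t Ht). fold (D t) in X.
  assert (Cmod (h t (q t) mu - h t (q' t) mu') <= M * m + M * s).
  { eapply Rle_trans; [exact X |]. apply Rplus_le_compat; apply Rmult_le_compat_l; lra. }
  assert (Rabs mu * Cmod (h t (q t) mu - h t (q' t) mu') <= Rabs mu * (M * m + M * s))
    by (apply Rmult_le_compat_l; lra).
  assert (Rabs mu * (M * s) <= 1 * (M * s)) by (apply Rmult_le_compat_r; nra).
  specialize (BP t). lra. }
set (e := 8 * (4 * M * s + Rabs mu * M * m)).
assert (Osc : forall t, 0 <= t <= 2 * PI -> Cmod (D t - c) <= e).
{ intros t Ht. rewrite <- AD. apply (oscillation D D'); trivial. }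
assert (Hme : m <= Cmod c + e).
{ unfold m. eapply Rle_trans; [apply (Cmod_le_plus _ c) |]. specialize (Osc t0 Ht0). lra. }
assert (Z1 : 8 * (Rabs mu * M * m) <= m / 4).
{ apply Rle_trans with (8 * Rabs mu * (M * M) * m).
  - replace (8 * (Rabs mu * M * m)) with (8 * Rabs mu * M * m) by ring.
    apply Rmult_le_compat_r; trivial. apply Rmult_le_compat_l; lra.
  - replace (m / 4) with (/ 4 * m) by field. apply Rmult_le_compat_r; trivial. }
assert (Hm2 : m <= 2 * Cmod c + 64 * M * s).
{ unfold e in Hme. assert (0 <= M * s) by nra. lra. }
split.
2: { apply periodic_le; [exact PD |]. intros t Ht. eapply Rle_trans; [apply Hmax, Ht | exact Hm2]. }
assert (Z2 : M * e <= 32 * (M * M) * s + om * m).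
{ unfold e. assert (8 * Rabs mu * (M * M) * m <= om * m) by (apply Rmult_le_compat_r; trivial). lra. }
(* The be-term at the constant c is a pure Fourier mode of order 2. *)
assert (K : Cmod (average D' - RtoC mu * al * c) <= 3 * M * s + Rabs mu * (M * e + om * m + M * s)).
{ apply (average_near D' _ 0 (RtoC mu * be * Cconj c)%C); trivial.
  intros t Ht.
  replace (D' t - _)%C with (P t + RtoC mu * ((al * (D t - c) + be * Cconj (D t - c) * cis (2 * t)) +
    (h t (q t) mu - h t (q' t) mu' - (al * (q t - q' t) + be * Cconj (q t - q' t) * cis (2 * t)))))%C.
  2: { rewrite ED. unfold D. rewrite !Cminus_conj. ring. }
  eapply Rle_trans; [apply Cmod_triangle |]. apply Rplus_le_compat; [apply BP |].
  rewrite Cmod_mult, Cmod_R. apply Rmult_le_compat_l; trivial.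
  eapply Rle_trans; [apply Cmod_triangle |]. rewrite Rplus_assoc. apply Rplus_le_compat.
  - eapply Rle_trans; [apply lin_part_bound |].
    apply Rmult_le_compat; [generalize (Cmod_ge_0 al); lra | apply Cmod_ge_0 | lra | auto].
  - eapply Rle_trans; [apply (h_strict F); auto |].
    apply Rplus_le_compat; apply Rmult_le_compat_l; try lra. apply (Hmax t Ht). }
rewrite (average_derivative_periodic D D') in K; trivial.
replace (0 - RtoC mu * al * c)%C with (- (RtoC mu * al * c))%C in K by ring.
rewrite Cmod_opp, !Cmod_mult, Cmod_R in K.
assert (mu1 : Rabs mu <= 1) by lra.
assert (om1 : om <= M) by (generalize (Cmod_ge_0 al); lra).
assert (K2 : M * e + om * m + M * s <= 4 * om * Cmod c + 164 * (M * M) * s - 3 * M * s).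
{ assert (om * m <= om * (2 * Cmod c + 64 * M * s)) by (apply Rmult_le_compat_l; lra).
  assert (om * (M * s) <= M * (M * s)) by (apply Rmult_le_compat_r; nra).
  assert (M * s <= M * M * s) by (apply Rmult_le_compat_r; lra). lra. }
assert (K3 : Rabs mu * (M * e + om * m + M * s) <= Rabs mu * (4 * om * Cmod c) + 1 * (164 * (M * M) * s - 3 * M * s)).
{ apply Rle_trans with (Rabs mu * (4 * om * Cmod c + (164 * (M * M) * s - 3 * M * s))).
  apply Rmult_le_compat_l; lra. rewrite Rmult_plus_distr_l. apply Rplus_le_compat_l.
  apply Rmult_le_compat_r; trivial.
  assert (M * s <= M * M * s) by (apply Rmult_le_compat_r; lra).
  assert (0 <= M * s) by nra. lra. }
assert (K4 : Rabs mu * (4 * om * Cmod c) <= / 4 * (Rabs mu * Cmod al * Cmod c)).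
{ replace (/ 4 * (Rabs mu * Cmod al * Cmod c)) with (Rabs mu * (/ 4 * Cmod al * Cmod c)) by ring.
  apply Rmult_le_compat_l; trivial. apply Rmult_le_compat_r; lra. }
assert (0 <= M * M * s) by nra.
lra.
Qed.

(** By comparison, equal means force the solutions to be within O(eps - eps') of
    each other, so that the mu h-terms contribute only O(mu (eps - eps')) to
    the averaged equation, too little to balance (eps - eps') times the mean
    of a. *)
Lemma average_injective_eps {al be om M r d a h B} (F : reduced_field al be om M r d a h B)
    eps eps' mu q q' :
  Rabs eps < d -> Rabs eps' < d -> Rabs mu < d ->
  8 * Rabs mu * (M * M) <= om -> 8 * Rabs mu * (M * M) <= / 4 ->
  periodic_solution a h eps mu q -> periodic_solution a h eps' mu q' ->
  (forall t, Cmod (q t) <= r) -> (forall t, Cmod (q' t) <= r) ->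
  M * (Rabs eps + Rabs eps') + 64 * (M * M) * Rabs mu < Cmod (average (fun t => a t 0)) ->
  average q = average q' -> eps = eps'.
Proof.
intros He He' Hm S1 S2 Sq Sq' Bq Bq' Hg Eq.
destruct (comparison F eps eps' mu mu q q') as [_ K]; trivial.
destruct Sq as [Dq Pq], Sq' as [Dq' Pq'].
assert (Cq : forall t, continuousC q t) by (intros; eapply is_derive_C_continuous, Dq).
assert (Cq' : forall t, continuousC q' t) by (intros; eapply is_derive_C_continuous, Dq').
assert (HM := M_ge1 F).
replace (average q - average q')%C with (RtoC 0) in K by (rewrite Eq; ring).
rewrite Cmod_0, Rminus_diag, Rabs_R0 in K.
assert (d0 : Rabs 0 < d) by (rewrite Rabs_R0; apply (d_gt0 F)).
assert (Ca : forall t, continuousC (fun t => a t 0) t) by (apply (a_cont F); trivial).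
pose (D' := fun t => (vfield a h eps mu t (q t) - vfield a h eps' mu t (q' t))%C).
assert (CD' : forall t, continuousC D' t).
{ intros; apply continuousC_minus; eapply vfield_cont; eauto. }
assert (A0 : average D' = 0%C).
{ apply (average_derivative_periodic (fun t => q t - q' t)%C); trivial.
  intros; apply is_derive_C_minus; auto. intros; rewrite Pq, Pq'; reflexivity. }
set (s := Rabs (eps - eps')) in *.
assert (Hs : 0 <= s) by apply Rabs_pos.
(* The leading part of D' is (eps - eps') a(., 0). *)
assert (Z : Cmod (average D' - average (fun t => RtoC (eps - eps') * a t 0)%C) <=
  s * (M * (Rabs eps + Rabs eps') + 64 * (M * M) * Rabs mu)).
{ apply average_close; trivial.
  intros; apply continuousC_mult; [apply continuousC_const | apply Ca].
  intros t _.
  replace (D' t - RtoC (eps - eps') * a t 0)%C with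
    (RtoC (eps - eps') * (a t eps - a t 0) + RtoC eps' * (a t eps - a t eps') +
     RtoC mu * (h t (q t) mu - h t (q' t) mu))%C.
  2: { unfold D', vfield. rewrite RtoC_minus. ring. }
  eapply Rle_trans; [apply Cmod_triangle |].
  eapply Rle_trans; [apply Rplus_le_compat_r, Cmod_triangle |].
  rewrite !Cmod_mult, !Cmod_R. fold s.
  assert (X1 := a_lip F t eps 0 He d0). rewrite Rminus_0_r in X1.
  assert (X2 := a_lip F t eps eps' He He'). fold s in X2.
  assert (X3 := h_lip F t _ _ mu mu (Bq t) (Bq' t) Hm Hm).
  rewrite Rminus_diag, Rabs_R0, Rmult_0_r, Rplus_0_r in X3.
  assert (X4 : Cmod (h t (q t) mu - h t (q' t) mu) <= M * (64 * M * s)).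
  { eapply Rle_trans; [exact X3 |]. apply Rmult_le_compat_l; [lra |]. specialize (K t). lra. }
  apply (Rmult_le_compat_l s) in X1; trivial.
  apply (Rmult_le_compat_l (Rabs eps')) in X2; [| apply Rabs_pos].
  apply (Rmult_le_compat_l (Rabs mu)) in X4; [| apply Rabs_pos]. lra. }
rewrite A0, average_cmult in Z by trivial.
replace (0 - RtoC (eps - eps') * average (fun t => a t 0))%C with
 (- (RtoC (eps - eps') * average (fun t => a t 0)))%C in Z by ring.
rewrite Cmod_opp, Cmod_mult, Cmod_R in Z. fold s in Z.
destruct Hs as [Hs | Hs].
- apply Rmult_le_reg_l in Z; lra.
- symmetry in Hs. unfold s in Hs. destruct (Req_dec (eps - eps') 0); [lra |].
  apply Rabs_no_R0 in Hs; tauto.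
Qed.

(** * Existence of a periodic solution *)

Lemma is_derive_C_shift f c t l :
  is_derive_C f (t + c) l -> is_derive_C (fun s => f (s + c)) t l.
Proof.
intros H. unfold is_derive_C.
replace l with (scal (V := C_R_NormedModule) 1 l)
  by (apply injective_projections; simpl; unfold scal; simpl; unfold mult; simpl; ring).
apply (is_derive_comp (V := C_R_NormedModule) f (fun s => s + c) t l 1 H).
auto_derive; auto.
Qed.

Lemma constant_of_derive_0 f :
  (forall t, is_derive_C f t 0%C) -> forall s t, f s = f t.
Proof.
intros Hf.
assert (A : forall s t, s <= t -> f s = f t).
{ intros s t Hst.
  assert (Z : Cmod (f t - f s) <= 0 * (t - s)).
  { apply (mean_value_C f (fun _ => 0%C)); auto. intros; rewrite Cmod_0; lra. }
  assert (E : (f t - f s)%C = RtoC 0).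
  { apply Cmod_eq_0. generalize (Cmod_ge_0 (f t - f s)); lra. }
  replace (f t) with (f s + (f t - f s))%C by ring. rewrite E; ring. }
intros s t. destruct (Rle_lt_dec s t). auto. symmetry; apply A; lra.
Qed.

(** The part of f with mean zero is integrated, so the result is periodic
    whenever f is. *)
Definition periodic_primitive (f : R -> C) (t : R) : C :=
  (primitive f t - RtoC t * average f)%C.

Lemma periodic_primitive_0 f : periodic_primitive f 0 = 0%C.
Proof. unfold periodic_primitive; rewrite primitive_0; ring. Qed.

Lemma periodic_primitive_derive f t :
  (forall s, continuousC f s) ->
  is_derive_C (periodic_primitive f) t (f t - average f)%C.
Proof.
intros Hf. apply is_derive_C_minus. apply primitive_derive, Hf.
eapply is_derive_C_eq.
apply is_derive_C_mult. apply (is_derive_C_RtoC (fun s => s) t 1). apply (is_derive_id t).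
apply is_derive_C_const. C_calc.
Qed.

Lemma periodic_primitive_periodic f :
  (forall s, continuousC f s) -> (forall t, f (t + 2 * PI) = f t) ->
  forall t, periodic_primitive f (t + 2 * PI) = periodic_primitive f t.
Proof.
intros Hf Hp t.
pose (g := fun t => (periodic_primitive f (t + 2 * PI) - periodic_primitive f t)%C).
assert (E : g t = g 0).
{ apply constant_of_derive_0. intros s. eapply is_derive_C_eq. apply is_derive_C_minus.
  apply is_derive_C_shift, periodic_primitive_derive, Hf.
  apply periodic_primitive_derive, Hf. rewrite Hp; ring. }
assert (E0 : g 0 = 0%C).
{ unfold g. rewrite Rplus_0_l, periodic_primitive_0. unfold periodic_primitive.
  rewrite (average_primitive (primitive f) f), primitive_0; trivial.
  field. apply RtoC_2PI_neq0. intros; apply primitive_derive, Hf. }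
rewrite E0 in E. unfold g in E.
replace (periodic_primitive f (t + 2 * PI)) with
  ((periodic_primitive f (t + 2 * PI) - periodic_primitive f t) + periodic_primitive f t)%C by ring.
rewrite E; ring.
Qed.

Lemma periodic_primitive_bound f D :
  (forall s, continuousC f s) -> (forall t, f (t + 2 * PI) = f t) ->
  (forall t, Cmod (f t) <= D) -> forall t, Cmod (periodic_primitive f t) <= 16 * D.
Proof.
intros Hf Hp HD. apply periodic_le. apply periodic_primitive_periodic; trivial.
intros t Ht. generalize PI_8; intros Hpi.
assert (0 <= D) by (eapply Rle_trans; [apply Cmod_ge_0 | apply (HD 0)]).
replace (periodic_primitive f t) with (periodic_primitive f t - periodic_primitive f 0)%C
 by (rewrite periodic_primitive_0; ring).
eapply Rle_trans; [apply (mean_value_C _ (fun t => f t - average f)%C 0 t (2 * D)) |]; try lra.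
- intros; apply periodic_primitive_derive, Hf.
- intros s _. eapply Rle_trans; [apply Cmod_minus_le |].
  assert (Cmod (average f - 0) <= D).
  { apply average_near_const; trivial. intros x _. replace (f x - 0)%C with (f x) by ring. auto. }
  replace (average f - 0)%C with (average f) in H0 by ring. specialize (HD s). lra.
- nra.
Qed.

Lemma periodic_primitive_minus_bound f g D :
  (forall s, continuousC f s) -> (forall t, f (t + 2 * PI) = f t) ->
  (forall s, continuousC g s) -> (forall t, g (t + 2 * PI) = g t) ->
  (forall t, Cmod (f t - g t) <= D) ->
  forall t, Cmod (periodic_primitive f t - periodic_primitive g t) <= 16 * D.
Proof.
intros Hf Pf Hg Pg HD. apply (periodic_le (fun t => periodic_primitive f t - periodic_primitive g t)%C).
{ intros t; rewrite !periodic_primitive_periodic; trivial. }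
intros t Ht. generalize PI_8; intros Hpi.
assert (0 <= D) by (eapply Rle_trans; [apply Cmod_ge_0 | apply (HD 0)]).
replace (periodic_primitive f t - periodic_primitive g t)%C with
  ((periodic_primitive f t - periodic_primitive g t) - (periodic_primitive f 0 - periodic_primitive g 0))%C
 by (rewrite !periodic_primitive_0; ring).
eapply Rle_trans; [apply (mean_value_C (fun t => periodic_primitive f t - periodic_primitive g t)%C
  (fun t => (f t - average f) - (g t - average g))%C 0 t (2 * D)) |]; try lra.
- intros; apply is_derive_C_minus; apply periodic_primitive_derive; trivial.
- intros s _. replace (f s - average f - (g s - average g))%C with
   ((f s - g s) - (average f - average g))%C by ring.
  eapply Rle_trans; [apply Cmod_minus_le |].
  assert (Cmod (average f - average g) <= D) by (apply average_close; auto).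
  specialize (HD s). lra.
- nra.
Qed.

(** Let N u = (eps / mu) a + h(., u), so that the equation is q' = mu N q.  For a
    periodic function u put J u = mu times the periodic primitive of N u, and
    W u = u(0) + J u; replace u by

      T u = u(0) - average (N (W u)) / al + J u.

    At a fixed point J u (0) = 0 gives average (N (W u)) = 0, hence W u = u, and
    u' = mu N u.  The nonlinearity is averaged along W u rather than along u,
    because W u differs from a constant by O(mu): the be-term then
    contributes only O(mu), although be need not be small, and T is a
    contraction in the sup norm. *)
Lemma periodic_solution_exists {al be om M r d a h B}
    (F : reduced_field al be om M r d a h B) (rho : R) :
  0 < rho -> rho <= r / 2 ->
  exists K delta, 0 < K /\ 0 < delta /\
  forall eps mu, Rabs eps <= K * Rabs mu -> mu <> 0 -> Rabs mu < delta -> Rabs eps < d ->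
  exists q, periodic_solution a h eps mu q /\ forall t, Cmod (q t) <= rho.
Proof.
intros Hrho Hrho'.
assert (Hom := om_gt0 F). assert (Hal := om_small F).
assert (HM := M_ge1 F). assert (HM' := lin_part_le_M F).
assert (Hd := d_gt0 F).
assert (al1 : Rabs (Re al) <= Cmod al) by (eapply Rle_trans; [apply Rmax_l | apply Rmax_Cmod]).
assert (al0 : 0 < Cmod al) by lra.
assert (be0 : 0 <= Cmod be) by apply Cmod_ge_0.
assert (alM : Cmod al <= M) by lra.
assert (MM : M <= M * M) by nra.
assert (M2 : 0 < M * M) by nra.
exists (Rmin 1 (Cmod al * rho / (4 * M))),
  (Rmin d (Rmin (Cmod al * rho / (388 * (M * M))) (Rmin (Cmod al / (128 * (M * M))) (r / (64 * M))))).
assert (q1 : 0 < Cmod al * rho / (4 * M)) by (apply Rdiv_lt_0_compat; nra).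
assert (q2 : 0 < Cmod al * rho / (388 * (M * M))) by (apply Rdiv_lt_0_compat; nra).
assert (q3 : 0 < Cmod al / (128 * (M * M))) by (apply Rdiv_lt_0_compat; nra).
assert (q4 : 0 < r / (64 * M)) by (apply Rdiv_lt_0_compat; lra).
split; [apply Rmin_pos; lra |]. split; [repeat apply Rmin_pos; lra |].
intros eps mu Hem Hmu Hmd Hed.
set (K := Rmin 1 _) in Hem.
assert (K1 : K <= 1) by apply Rmin_l.
assert (K2 : K * M <= Cmod al * rho / 4).
{ apply Rle_trans with (Cmod al * rho / (4 * M) * M). apply Rmult_le_compat_r; [lra | apply Rmin_r].
  right; field; lra. }
clearbody K.
apply Rmin_Rgt_l in Hmd; destruct Hmd as [m1 Hmd].
apply Rmin_Rgt_l in Hmd; destruct Hmd as [m2 Hmd].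
apply Rmin_Rgt_l in Hmd; destruct Hmd as [m3 m4].
apply Rgt_lt in m1, m2, m3, m4.
apply (Rmult_lt_compat_l (388 * (M * M))) in m2; [| lra].
replace (388 * (M * M) * (Cmod al * rho / (388 * (M * M)))) with (Cmod al * rho) in m2 by (field; lra).
apply (Rmult_lt_compat_l (128 * (M * M))) in m3; [| lra].
replace (128 * (M * M) * (Cmod al / (128 * (M * M)))) with (Cmod al) in m3 by (field; lra).
apply (Rmult_lt_compat_l (64 * M)) in m4; [| lra].
replace (64 * M * (r / (64 * M))) with r in m4 by (field; lra).
assert (mu0 : 0 < Rabs mu) by (apply Rabs_pos_lt; trivial).
set (k := eps / mu).
assert (Hk : Rabs k <= K).
{ unfold k, Rdiv. rewrite Rabs_mult, Rabs_inv.
  apply (Rmult_le_reg_r (Rabs mu)); trivial. rewrite Rmult_assoc, Rinv_l by lra. lra. }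
pose (N := fun (u : R -> C) t => (RtoC k * a t eps + h t (u t) mu)%C).
assert (CN : forall u, (forall t, continuousC u t) -> forall t, continuousC (N u) t).
{ intros u Hu t. apply continuousC_plus. apply continuousC_mult. apply continuousC_const.
  apply (a_cont F); trivial.
  apply (h_cont F); trivial. }
assert (PN : forall u, (forall t, u (t + 2 * PI) = u t) -> forall t, N u (t + 2 * PI) = N u t).
{ intros u Hu t. unfold N. rewrite Hu, (a_per F), (h_per F); trivial. }
assert (Bk : forall t, Cmod (RtoC k * a t eps) <= K * M).
{ intros t. rewrite Cmod_mult, Cmod_R. apply Rmult_le_compat; trivial using Rabs_pos, Cmod_ge_0.
  apply (a_bound F); trivial. }
assert (BN : forall u t, Cmod (N u t) <= 2 * M).
{ intros u t. eapply Rle_trans; [apply Cmod_triangle |].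
  generalize (Bk t) (h_bound F t (u t) mu m1); intros.
  assert (K * M <= 1 * M) by (apply Rmult_le_compat_r; lra). lra. }
pose (P := fun u : R -> C => (forall t, continuousC u t) /\ (forall t, u (t + 2 * PI) = u t) /\
   forall t, Cmod (u t) <= rho).
pose (J := fun (u : R -> C) t => (RtoC mu * periodic_primitive (N u) t)%C).
pose (W := fun (u : R -> C) t => (u 0 + J u t)%C).
pose (T := fun (u : R -> C) t => (u 0%R - average (N (W u)) / al + J u t)%C).
assert (al0' : al <> 0%C) by (intros E; rewrite E, Cmod_0 in al0; lra).
assert (CJ : forall u, P u -> forall t, continuousC (J u) t).
{ intros u [Cu _] t. apply continuousC_mult; [apply continuousC_const |].
  eapply is_derive_C_continuous, periodic_primitive_derive, CN, Cu. }
assert (PJ : forall u, P u -> forall t, J u (t + 2 * PI) = J u t).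
{ intros u [Cu [Pu _]] t. unfold J. rewrite periodic_primitive_periodic; auto. }
assert (BJ : forall u, P u -> forall t, Cmod (J u t) <= 32 * M * Rabs mu).
{ intros u [Cu [Pu _]] t. unfold J. rewrite Cmod_mult, Cmod_R.
  assert (Cmod (periodic_primitive (N u) t) <= 16 * (2 * M)) by (apply periodic_primitive_bound; auto).
  nra. }
assert (J0 : forall u, J u 0 = 0%C) by (intros; unfold J; rewrite periodic_primitive_0; ring).
assert (CW : forall u, P u -> forall t, continuousC (W u) t).
{ intros u Pu t. apply continuousC_plus; [apply continuousC_const | auto]. }
assert (BW : forall u, P u -> forall t, Cmod (W u t) <= r).
{ intros u Pu t. eapply Rle_trans; [apply Cmod_triangle |].
  generalize (BJ u Pu t) (proj2 (proj2 Pu) 0); lra. }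
assert (A1 : forall u, P u -> Cmod (average (N (W u)) - al * u 0%R) <= K * M + 65 * (M * M) * Rabs mu + om * rho).
{ intros u Pu. destruct (h_center F) as [k0 Hk0].
  apply (average_near _ _ k0 (be * Cconj (u 0%R))%C). apply CN, CW, Pu.
  intros t _.
  replace (N (W u) t - _)%C with (RtoC k * a t eps + ((al * J u t + be * Cconj (J u t) * cis (2 * t)) +
   (h t (W u t) mu - h t 0%C 0 - (al * (W u t - 0) + be * Cconj (W u t - 0) * cis (2 * t)))))%C.
  2: { rewrite Hk0. unfold N, W. rewrite Cminus_conj, Cplus_conj.
       assert (E0 : Cconj 0 = RtoC 0) by (apply injective_projections; simpl; ring).
       rewrite E0. ring. }
  eapply Rle_trans; [apply Cmod_triangle |].
  eapply Rle_trans; [apply Rplus_le_compat_l, Cmod_triangle |].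
  assert (X1 := h_strict F t (W u t) 0%C mu 0 (BW u Pu t)
     ltac:(rewrite Cmod_0; lra) m1 ltac:(rewrite Rabs_R0; lra)).
  rewrite Rminus_0_r in X1.
  assert (X2 : Cmod (W u t - 0) <= rho + 32 * M * Rabs mu).
  { replace (W u t - 0)%C with (W u t) by ring. eapply Rle_trans; [apply Cmod_triangle |].
    generalize (BJ u Pu t) (proj2 (proj2 Pu) 0); lra. }
  apply (Rmult_le_compat_l om) in X2; [| lra].
  generalize (lin_part_bound al be (J u t) t) (Bk t); intros X3 X4.
  assert (X5 : (Cmod al + Cmod be) * Cmod (J u t) <= (M - om) * (32 * M * Rabs mu)).
  { apply Rmult_le_compat; trivial using Cmod_ge_0; lra || apply BJ, Pu. }
  assert (M * Rabs mu <= M * M * Rabs mu) by (apply Rmult_le_compat_r; lra).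
  assert (0 <= M * M * Rabs mu) by nra. lra. }
assert (PT : forall u, P u -> P (T u)).
{ intros u Pu. split; [| split].
  - intros t. apply continuousC_plus; [apply continuousC_const | auto].
  - intros t. unfold T. rewrite PJ; trivial.
  - intros t. apply (Rmult_le_reg_l (Cmod al)); trivial. rewrite <- Cmod_mult.
    replace (al * T u t)%C with (- (average (N (W u)) - al * u 0%R) + al * J u t)%C.
    2: { unfold T. field. trivial. }
    eapply Rle_trans; [apply Cmod_triangle |]. rewrite Cmod_opp, Cmod_mult.
    specialize (A1 u Pu). specialize (BJ u Pu t).
    assert (Cmod al * Cmod (J u t) <= M * (32 * M * Rabs mu)).
    { apply Rmult_le_compat; trivial using Cmod_ge_0. }
    assert (om * rho <= / 16 * Cmod al * rho) by (apply Rmult_le_compat_r; lra).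
    assert (0 < Cmod al * rho) by nra. lra. }
destruct (contraction_fixed_point P T (fun _ => 0%C) rho) as [u [Pu Hu]]; trivial.
- split; [| split]; intros. apply continuousC_const. reflexivity. rewrite Cmod_0; lra.
- intros t. replace (T (fun _ => 0%C) t - 0)%C with (T (fun _ => 0%C) t) by ring.
  apply PT. split; [| split]; intros. apply continuousC_const. reflexivity. rewrite Cmod_0; lra.
- intros u v e Pu Pv He.
  assert (He0 : 0 <= e) by (eapply Rle_trans; [apply Cmod_ge_0 | apply (He 0)]).
  assert (DN : forall x y z t, Cmod x <= r -> Cmod y <= r -> Cmod (x - y) <= z ->
    Cmod (RtoC k * a t eps + h t x mu - (RtoC k * a t eps + h t y mu)) <= M * z).
  { intros x y z t Hx Hy Hz.
    replace (RtoC k * a t eps + h t x mu - (RtoC k * a t eps + h t y mu))%C with (h t x mu - h t y mu)%C by ring.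
    eapply Rle_trans; [apply (h_lip F); trivial |].
    rewrite Rminus_diag, Rabs_R0, Rmult_0_r, Rplus_0_r. apply Rmult_le_compat_l; lra. }
  assert (DJ : forall t, Cmod (J u t - J v t) <= 16 * M * Rabs mu * e).
  { intros t. unfold J.
    replace (RtoC mu * periodic_primitive (N u) t - RtoC mu * periodic_primitive (N v) t)%C with
     (RtoC mu * (periodic_primitive (N u) t - periodic_primitive (N v) t))%C by ring.
    rewrite Cmod_mult, Cmod_R.
    assert (Cmod (periodic_primitive (N u) t - periodic_primitive (N v) t) <= 16 * (M * e)).
    { destruct Pu as [Cu [Pu Bu]], Pv as [Cv [Pv Bv]].
      apply periodic_primitive_minus_bound; auto.
      intros s. apply DN; trivial. specialize (Bu s); lra. specialize (Bv s); lra. }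
    apply (Rmult_le_compat_l (Rabs mu)) in H; lra. }
  assert (DA : Cmod (average (fun t => N (W u) t - N (W v) t)%C - al * (u 0%R - v 0%R)) <=
     16 * (M * M) * Rabs mu * e + om * e).
  { apply (average_near _ _ 0%C (be * Cconj (u 0%R - v 0%R))%C).
    intros; apply continuousC_minus; apply CN, CW; trivial.
    intros t _.
    replace (N (W u) t - N (W v) t - _)%C with
     ((al * (J u t - J v t) + be * Cconj (J u t - J v t) * cis (2 * t)) +
      (h t (W u t) mu - h t (W v t) mu - (al * (W u t - W v t) + be * Cconj (W u t - W v t) * cis (2 * t))))%C.
    2: { unfold N. replace (W u t - W v t)%C with ((u 0%R - v 0%R) + (J u t - J v t))%C by (unfold W; ring).
         rewrite (Cplus_conj (u 0 - v 0)). ring. }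
    eapply Rle_trans; [apply Cmod_triangle |].
    assert (X1 := h_strict F t (W u t) (W v t) mu mu (BW u Pu t) (BW v Pv t) m1 m1).
    rewrite Rminus_diag, Rabs_R0, Rmult_0_r, Rplus_0_r in X1.
    assert (X2 : Cmod (W u t - W v t) <= e + 16 * M * Rabs mu * e).
    { replace (W u t - W v t)%C with ((u 0%R - v 0%R) + (J u t - J v t))%C by (unfold W; ring).
      eapply Rle_trans; [apply Cmod_triangle |]. apply Rplus_le_compat; auto. }
    apply (Rmult_le_compat_l om) in X2; [| lra].
    generalize (lin_part_bound al be (J u t - J v t) t); intros X3.
    assert (X5 : (Cmod al + Cmod be) * Cmod (J u t - J v t) <= (M - om) * (16 * M * Rabs mu * e)).
    { apply Rmult_le_compat; trivial using Cmod_ge_0; lra. }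
    lra. }
  rewrite average_minus in DA by (apply CN, CW; trivial).
  intros t. apply (Rmult_le_reg_l (Cmod al)); trivial. rewrite <- Cmod_mult.
  replace (al * (T u t - T v t))%C with
   (- (average (N (W u)) - average (N (W v)) - al * (u 0%R - v 0%R)) + al * (J u t - J v t))%C.
  2: { unfold T. field. trivial. }
  eapply Rle_trans; [apply Cmod_triangle |]. rewrite Cmod_opp, Cmod_mult.
  assert (X6 : Cmod al * Cmod (J u t - J v t) <= M * (16 * M * Rabs mu * e)).
  { apply Rmult_le_compat; trivial using Cmod_ge_0. }
  assert (X7 : om * e <= / 16 * Cmod al * e) by (apply Rmult_le_compat_r; lra).
  assert (X8 : 128 * (M * M) * Rabs mu * e <= Cmod al * e) by (apply Rmult_le_compat_r; lra).
  assert (0 <= Cmod al * e) by nra.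
  lra.
- intros w u Hw Hlim. split; [| split].
  + apply (continuousC_uniform_limit w); trivial. intros n; apply (Hw n).
  + intros t. assert (Z : Cmod (u (t + 2 * PI) - u t) <= 0).
    { apply le_epsilon. intros e He. destruct (Hlim (e / 2)) as [n Hn]; [lra |].
      replace (u (t + 2 * PI)%R - u t)%C with ((w n t - u t) - (w n (t + 2 * PI)%R - u (t + 2 * PI)%R))%C.
      2: { rewrite (proj1 (proj2 (Hw n))). ring. }
      eapply Rle_trans; [apply Cmod_minus_le |].
      generalize (Hn t) (Hn (t + 2 * PI)); lra. }
    assert (E : (u (t + 2 * PI)%R - u t)%C = RtoC 0).
    { apply Cmod_eq_0. generalize (Cmod_ge_0 (u (t + 2 * PI)%R - u t)); lra. }
    replace (u (t + 2 * PI)) with (u t + (u (t + 2 * PI)%R - u t))%C by ring. rewrite E; ring.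
  + intros t. replace (u t) with (u t - 0)%C by ring.
    apply (Cmod_le_uniform_limit w u (fun _ => 0%C)); trivial. intros n s.
    replace (w n s - 0)%C with (w n s) by ring. apply (Hw n).
- exists u. assert (Pu' := Pu). destruct Pu' as [Cu [Peru Bu]].
  assert (Z : (average (N (W u)) / al = 0)%C).
  { replace (average (N (W u)) / al)%C with (u 0%R - T u 0%R)%C.
    rewrite Hu; ring. unfold T. rewrite J0. ring. }
  assert (EW : forall t, W u t = u t).
  { intros t. rewrite <- (Hu t). unfold T. rewrite Z. unfold W. ring. }
  assert (EN : average (N (W u)) = average (N u)).
  { unfold average. f_equal; f_equal; apply RInt_ext; intros x _; unfold N; rewrite EW; reflexivity. }
  rewrite EN in Z.
  assert (Z' : average (N u) = 0%C).
  { replace (average (N u)) with (al * (average (N u) / al))%C by (field; trivial). rewrite Z; ring. }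
  split; [| exact Bu]. split; [| exact Peru].
  intros t. apply (is_derive_C_ext (W u)); [exact EW |].
  eapply is_derive_C_eq. apply is_derive_C_plus. apply is_derive_C_const.
  apply is_derive_C_cmult, periodic_primitive_derive, CN, Cu.
  rewrite Z'. unfold N, vfield, k. rewrite RtoC_div by trivial. field.
  intros E; apply Hmu; apply (f_equal fst) in E; exact E.
Qed.

(** * The derivative of the time-2 pi map *)

Lemma increment_bound (f f' : R -> C) D t :
  (forall t, 0 <= t <= 2 * PI -> is_derive_C f t (f' t)) ->
  (forall t, 0 <= t <= 2 * PI -> Cmod (f' t) <= D) ->
  0 <= t <= 2 * PI -> Cmod (f t - f 0) <= 8 * D.
Proof.
intros Hf HD Ht. generalize PI_8; intros Hpi.
assert (0 <= D) by (eapply Rle_trans; [apply Cmod_ge_0 | apply (HD t Ht)]).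
eapply Rle_trans; [apply (mean_value_C f f' 0 t D) |]; try lra.
intros; apply Hf; lra. intros; apply HD; lra. nra.
Qed.

Lemma C_basis (y : C) : (RtoC (Re y) * 1 + RtoC (Im y) * Ci)%C = y.
Proof. C_calc. Qed.

(** The variational equation is solved for the two initial values 1 and i only
    and its solution is extended by real linearity, which makes L linear by
    construction.  The be-term of the linearization drops out of L at order mu
    since it has mean zero along constants. *)
Lemma flow_derivative {al be om M r d a h B}
    (F : reduced_field al be om M r d a h B) eps mu x0 :
  Rabs eps < d -> Rabs mu < d ->
  9 * ((Rabs eps + Rabs mu) * M) <= r / 8 -> 18 * (Rabs mu * M) <= 1 ->
  Cmod x0 <= r / 2 ->
  exists (Phi L : C -> C) (K : R),
    (forall x, Cmod (x - x0) <= r / 8 -> exists u, u 0 = x /\ u (2 * PI) = Phi x /\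
       forall t, 0 <= t <= 2 * PI -> is_derive_C u t (vfield a h eps mu t (u t))) /\
    (forall y z, L (y + z)%C = (L y + L z)%C) /\
    (forall s z, L (RtoC s * z)%C = (RtoC s * L z)%C) /\
    (forall x, Cmod (x - x0) <= r / 8 ->
       Cmod (Phi x - Phi x0 - L (x - x0)%C) <= K * Cmod (x - x0) * Cmod (x - x0)) /\
    (8 * Rabs mu * (M * M) <= om -> forall y,
       Cmod (L y - (1 + RtoC (2 * PI * mu) * al) * y) <= 2 * PI * Rabs mu * (8 * om) * Cmod y).
Proof.
intros He Hm S1 S2 Hx0.
assert (Hom := om_gt0 F).
assert (HM := M_ge1 F). assert (HM' := lin_part_le_M F).
assert (Hr := r_gt0 F).
assert (mu0 : 0 <= Rabs mu) by apply Rabs_pos.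
assert (e0 : 0 <= Rabs eps) by apply Rabs_pos.
generalize PI_8; intros Hpi.
assert (Flow : forall x, exists u, Cmod (x - x0) <= r / 8 ->
  (forall t, continuousC u t) /\ u 0 = x /\ (forall t, Cmod (u t - x) <= r / 8) /\
  (forall t, 0 <= t <= 2 * PI -> is_derive_C u t (vfield a h eps mu t (u t)))).
{ intros x. destruct (Rle_lt_dec (Cmod (x - x0)) (r / 8)) as [Hx | Hx].
  2: { exists (fun _ => x). intros; lra. }
  assert (Bz : forall z, Cmod (z - x) <= r / 8 -> Cmod z <= r).
  { intros z Hz. replace z with (z - x + (x - x0) + x0)%C by ring.
    eapply Rle_trans; [apply Cmod_triangle |]. generalize (Cmod_triangle (z - x) (x - x0)); lra. }
  destruct (cauchy_problem (vfield a h eps mu) x (r / 8) ((Rabs eps + Rabs mu) * M) (Rabs mu * M))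
    as [u Hu]; try lra.
  - intros u Hu t. eapply vfield_cont; eauto.
  - intros; eapply vfield_bound; eauto.
  - intros t y z Hy Hz. unfold vfield.
    replace (RtoC eps * a t eps + RtoC mu * h t y mu - (RtoC eps * a t eps + RtoC mu * h t z mu))%C
     with (RtoC mu * (h t y mu - h t z mu))%C by ring.
    rewrite Cmod_mult, Cmod_R, Rmult_assoc. apply Rmult_le_compat_l; trivial.
    eapply Rle_trans; [apply (h_lip F); auto |].
    rewrite Rminus_diag, Rabs_R0; lra.
  - nra.
  - exists u. tauto. }
pose (u := fun x => proj1_sig (constructive_indefinite_description _ (Flow x))).
assert (Hu : forall x, Cmod (x - x0) <= r / 8 ->
  (forall t, continuousC (u x) t) /\ u x 0 = x /\ (forall t, Cmod (u x t - x) <= r / 8) /\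
  (forall t, 0 <= t <= 2 * PI -> is_derive_C (u x) t (vfield a h eps mu t (u x t)))).
{ intros x. unfold u. destruct (constructive_indefinite_description _ (Flow x)) as [v Hv]. exact Hv. }
clearbody u. clear Flow.
assert (Bu : forall x, Cmod (x - x0) <= r / 8 -> forall t, Cmod (u x t) <= r).
{ intros x Hx t. destruct (Hu x Hx) as [_ [_ [Hz _]]]. specialize (Hz t).
  replace (u x t) with (u x t - x + (x - x0) + x0)%C by ring.
  eapply Rle_trans; [apply Cmod_triangle |]. generalize (Cmod_triangle (u x t - x) (x - x0)); lra. }
assert (X0 : Cmod (x0 - x0) <= r / 8).
{ replace (x0 - x0)%C with (RtoC 0) by ring. rewrite Cmod_0; lra. }
destruct (Hu x0 X0) as [Cu0 [U0 [_ Du0]]].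
assert (Bu0 := Bu x0 X0).
set (u0 := u x0) in *.
pose (A := fun t y => B t (u0 t) mu y).
assert (A_add : forall t y z, A t (y + z)%C = (A t y + A t z)%C).
{ intros; apply (B_add F); trivial. }
assert (A_scal : forall t s z, A t (RtoC s * z)%C = (RtoC s * A t z)%C).
{ intros; apply (B_scal F); trivial. }
assert (A_minus : forall t y z, A t (y - z)%C = (A t y - A t z)%C).
{ intros; apply (B_minus F); trivial. }
assert (A_lip : forall t y, Cmod (A t y) <= M * Cmod y).
{ intros; apply (B_lip F); trivial. }
assert (A_basis : forall t y, A t y = (RtoC (Re y) * A t 1%C + RtoC (Im y) * A t Ci)%C).
{ intros t y. rewrite <- (C_basis y) at 1. rewrite A_add, !A_scal. reflexivity. }
assert (A_cont : forall y, (forall t, continuousC y t) -> forall t, continuousC (fun t => A t (y t)) t).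
{ intros y Cy t.
  apply (continuous_ext (U := C_R_NormedModule)
    (fun t => RtoC (Re (y t)) * A t 1%C + RtoC (Im (y t)) * A t Ci)%C).
  { intros s; symmetry; apply A_basis. }
  destruct (proj1 (continuousC_pair y t) (Cy t)) as [c1 c2].
  assert (c3 : forall z, continuousC (fun t => A t z) t).
  { intros z. apply (B_cont F); trivial. }
  apply continuousC_plus; apply continuousC_mult; trivial.
  apply (continuousC_RtoC _ _ c1). apply (continuousC_RtoC _ _ c2). }
assert (Lin : forall x, Cmod x = 1 -> exists Y, (forall t, continuousC Y t) /\ Y 0 = x /\
   (forall t, Cmod (Y t - x) <= 1) /\ (forall t, 0 <= t <= 2 * PI -> is_derive_C Y t (RtoC mu * A t (Y t))%C)).
{ intros x Hx. apply (cauchy_problem (fun t y => RtoC mu * A t y)%C x 1 (Rabs mu * (M * 2)) (Rabs mu * M)); try lra.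
  - intros y Cy t. apply continuousC_mult; [apply continuousC_const | apply A_cont, Cy].
  - intros t z Hz. rewrite Cmod_mult, Cmod_R. apply Rmult_le_compat_l; trivial.
    eapply Rle_trans; [apply A_lip |]. apply Rmult_le_compat_l; [lra |].
    generalize (Cmod_le_plus z x); lra.
  - intros t y z _ _. replace (RtoC mu * A t y - RtoC mu * A t z)%C with (RtoC mu * A t (y - z)%C)%C.
    rewrite Cmod_mult, Cmod_R, Rmult_assoc. apply Rmult_le_compat_l; trivial.
    rewrite A_minus; ring.
  - nra. }
destruct (Lin 1%C Cmod_1) as [Y1 [CY1 [Y10 [BY1 DY1]]]].
assert (Cmod_Ci : Cmod Ci = 1).
{ unfold Cmod, Ci; simpl. replace (0 * (0 * 1) + 1 * (1 * 1)) with 1 by ring. apply sqrt_1. }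
destruct (Lin Ci Cmod_Ci) as [Y2 [CY2 [Y20 [BY2 DY2]]]].
pose (Y := fun y t => (RtoC (Re y) * Y1 t + RtoC (Im y) * Y2 t)%C).
assert (Y_0 : forall y, Y y 0 = y) by (intros y; unfold Y; rewrite Y10, Y20; apply C_basis).
assert (CY : forall y t, continuousC (Y y) t).
{ intros y t. apply continuousC_plus; apply continuousC_mult; auto; apply continuousC_const. }
assert (DY : forall y t, 0 <= t <= 2 * PI -> is_derive_C (Y y) t (RtoC mu * A t (Y y t))%C).
{ intros y t Ht. eapply is_derive_C_eq. apply is_derive_C_plus; apply is_derive_C_cmult; auto.
  unfold Y. rewrite A_add, !A_scal. ring. }
assert (BY : forall y t, Cmod (Y y t) <= 4 * Cmod y).
{ intros y t. unfold Y. eapply Rle_trans; [apply Cmod_triangle |].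
  rewrite !Cmod_mult, !Cmod_R.
  assert (Cmod (Y1 t) <= 2) by (generalize (Cmod_le_plus (Y1 t) 1) (BY1 t); rewrite Cmod_1; lra).
  assert (Cmod (Y2 t) <= 2) by (generalize (Cmod_le_plus (Y2 t) Ci) (BY2 t); rewrite Cmod_Ci; lra).
  assert (Rabs (Re y) <= Cmod y) by (eapply Rle_trans; [apply Rmax_l | apply Rmax_Cmod]).
  assert (Rabs (Im y) <= Cmod y) by (eapply Rle_trans; [apply Rmax_r | apply Rmax_Cmod]).
  assert (Rabs (Re y) * Cmod (Y1 t) <= Cmod y * 2) by (apply Rmult_le_compat; trivial using Rabs_pos, Cmod_ge_0).
  assert (Rabs (Im y) * Cmod (Y2 t) <= Cmod y * 2) by (apply Rmult_le_compat; trivial using Rabs_pos, Cmod_ge_0).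
  lra. }
exists (fun x => u x (2 * PI)), (fun y => Y y (2 * PI)), (64 * M).
split; [| split; [| split; [| split]]].
- intros x Hx. destruct (Hu x Hx) as [_ [P1 [_ P2]]]. exists (u x); auto.
- intros y z. unfold Y. C_calc.
- intros s z. unfold Y. C_calc.
- intros x Hx. destruct (Hu x Hx) as [Cux [Ux0 [_ Dux]]]. specialize (Bu x Hx).
  set (y := (x - x0)%C) in *.
  pose (D := fun t => (u x t - u0 t)%C).
  assert (CD : forall t, continuousC D t) by (intros; apply continuousC_minus; auto).
  assert (D0 : D 0 = y) by (unfold D, y; rewrite Ux0, U0; reflexivity).
  destruct (Cmod_attains_max D 0 (2 * PI)) as [t0 [Ht0 Hmax]]; [lra | auto |].
  set (m := Cmod (D t0)) in *. assert (0 <= m) by apply Cmod_ge_0.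
  assert (Hm2 : m <= 2 * Cmod y).
  { assert (Z : Cmod (D t0 - D 0) <= 8 * (Rabs mu * (M * m))).
    { apply (increment_bound D (fun t => RtoC mu * (h t (u x t) mu - h t (u0 t) mu))%C); trivial.
      - intros t Ht. eapply is_derive_C_eq. apply is_derive_C_minus; auto. unfold vfield; ring.
      - intros t Ht. rewrite Cmod_mult, Cmod_R. apply Rmult_le_compat_l; trivial.
        eapply Rle_trans; [apply (h_lip F); auto |].
        rewrite Rminus_diag, Rabs_R0, Rmult_0_r, Rplus_0_r.
        apply Rmult_le_compat_l; [lra | apply (Hmax t Ht)]. }
    rewrite D0 in Z.
    assert (18 * (Rabs mu * M) * m <= 1 * m) by (apply Rmult_le_compat_r; trivial).
    generalize (Cmod_le_plus (D t0) y). fold m. lra. }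
  pose (E := fun t => (D t - Y y t)%C).
  assert (CE : forall t, continuousC E t) by (intros; apply continuousC_minus; auto).
  destruct (Cmod_attains_max E 0 (2 * PI)) as [t1 [Ht1 Emax]]; [lra | auto |].
  set (n := Cmod (E t1)) in *. assert (0 <= n) by apply Cmod_ge_0.
  assert (Hn : n <= 8 * (Rabs mu * (M * m * m + M * n))).
  { assert (E0 : E 0 = 0%C) by (unfold E; rewrite D0, Y_0; ring).
    unfold n at 1. replace (E t1) with (E t1 - E 0)%C by (rewrite E0; ring).
    apply (increment_bound E (fun t => RtoC mu * ((h t (u x t) mu - h t (u0 t) mu - A t (u x t - u0 t)%C) + A t (E t)))%C); trivial.
    - intros t Ht. eapply is_derive_C_eq. apply is_derive_C_minus; [apply is_derive_C_minus; auto | auto].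
      unfold E, D. rewrite (A_minus t (u x t - u0 t)%C). unfold vfield; ring.
    - intros t Ht. rewrite Cmod_mult, Cmod_R. apply Rmult_le_compat_l; trivial.
      eapply Rle_trans; [apply Cmod_triangle |]. apply Rplus_le_compat.
      + eapply Rle_trans; [apply (B_taylor F); auto |].
        specialize (Hmax t Ht). fold (D t).
        apply Rmult_le_compat; trivial; try apply Cmod_ge_0.
        generalize (Cmod_ge_0 (D t)); nra. apply Rmult_le_compat_l; lra.
      + eapply Rle_trans; [apply A_lip |]. apply Rmult_le_compat_l; [lra | auto]. }
  assert (Hn2 : n <= M * m * m).
  { assert (18 * (Rabs mu * M) * n <= 1 * n) by (apply Rmult_le_compat_r; trivial).
    assert (18 * (Rabs mu * M) * (m * m) <= 1 * (m * m)) by (apply Rmult_le_compat_r; nra).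
    assert (m * m <= M * m * m) by nra. lra. }
  apply Rle_trans with n.
  + apply (Emax (2 * PI)). lra.
  + eapply Rle_trans; [exact Hn2 |].
    assert (m * m <= 2 * Cmod y * (2 * Cmod y)) by (apply Rmult_le_compat; trivial).
    assert (M * (m * m) <= M * (2 * Cmod y * (2 * Cmod y))) by (apply Rmult_le_compat_l; lra).
    assert (0 <= M * (Cmod y * Cmod y)) by (generalize (Cmod_ge_0 y); intros; apply Rmult_le_pos; nra).
    lra.
- intros S3 y.
  set (f := fun t => (RtoC mu * A t (Y y t))%C).
  assert (Cf : forall t, continuousC f t).
  { intros t; apply continuousC_mult; [apply continuousC_const | apply A_cont, CY]. }
  assert (Yy : forall t, 0 <= t <= 2 * PI -> Cmod (Y y t - y) <= 8 * (Rabs mu * (M * (4 * Cmod y)))).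
  { intros t Ht. rewrite <- (Y_0 y) at 2. apply (increment_bound (Y y) f); trivial. intros; apply DY; trivial.
    intros s _. unfold f. rewrite Cmod_mult, Cmod_R. apply Rmult_le_compat_l; trivial.
    eapply Rle_trans; [apply A_lip |]. apply Rmult_le_compat_l; [lra | apply BY]. }
  assert (K : Cmod (average f - RtoC mu * (al * y)) <= Rabs mu * (8 * om * Cmod y)).
  { apply (average_near f _ 0%C (RtoC mu * be * Cconj y)%C); trivial.
    intros t Ht.
    replace (f t - _)%C with (RtoC mu * ((A t (Y y t) - (al * Y y t + be * Cconj (Y y t) * cis (2 * t)))
      + (al * (Y y t - y) + be * Cconj (Y y t - y) * cis (2 * t))))%C.
    2: { unfold f. rewrite Cminus_conj. ring. }
    rewrite Cmod_mult, Cmod_R. apply Rmult_le_compat_l; trivial.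
    eapply Rle_trans; [apply Cmod_triangle |].
    assert (X1 := B_strict F t (u0 t) mu (Y y t) (Bu0 t) Hm). fold (A t (Y y t)) in X1.
    assert (X2 := lin_part_bound al be (Y y t - y) t).
    assert (X3 : om * Cmod (Y y t) <= om * (4 * Cmod y)) by (apply Rmult_le_compat_l; [lra | apply BY]).
    assert (X4 : (Cmod al + Cmod be) * Cmod (Y y t - y) <= M * (8 * (Rabs mu * (M * (4 * Cmod y))))).
    { apply Rmult_le_compat; auto using Cmod_ge_0.
      generalize (Cmod_ge_0 al) (Cmod_ge_0 be); lra. lra. }
    assert (X5 : 8 * Rabs mu * (M * M) * Cmod y <= om * Cmod y) by (apply Rmult_le_compat_r; trivial using Cmod_ge_0).
    lra. }
  rewrite (average_primitive (Y y) f), Y_0 in K; trivial. 2: intros; apply DY; trivial.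
  replace (Y y (2 * PI)%R - (1 + RtoC (2 * PI * mu) * al) * y)%C with
   (RtoC (2 * PI) * ((Y y (2 * PI)%R - y) / RtoC (2 * PI) - RtoC mu * (al * y)))%C.
  2: { rewrite (RtoC_mult (2 * PI) mu). field. apply RtoC_2PI_neq0. }
  rewrite Cmod_mult, Cmod_R, (Rabs_pos_eq (2 * PI)) by lra.
  replace (2 * PI * Rabs mu * (8 * om) * Cmod y) with (2 * PI * (Rabs mu * (8 * om * Cmod y))) by ring.
  apply Rmult_le_compat_l; lra.
Qed.

(** * Eigenvalues *)

(** L is real, so it acts separately on the real part x and the imaginary part
    y of a complex eigenvector; the identity is |lam z|^2 = |L z|^2. *)
Lemma eigenvalue_modulus (L : C -> C) (lam : C) :
  (forall y z, L (y + z)%C = (L y + L z)%C) ->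
  (forall s z, L (RtoC s * z)%C = (RtoC s * L z)%C) ->
  is_eigenvalue L lam ->
  exists x y : C, ~ (x = 0%C /\ y = 0%C) /\
    Cmod lam * Cmod lam * (Cmod x * Cmod x + Cmod y * Cmod y) =
    Cmod (L x) * Cmod (L x) + Cmod (L y) * Cmod (L y).
Proof.
intros La Ls [z1 [z2 [Hz [E1 E2]]]].
assert (Lb : forall y, L y = (RtoC (Re y) * L 1%C + RtoC (Im y) * L Ci)%C).
{ intros y. rewrite <- (C_basis y) at 1. rewrite La, !Ls. reflexivity. }
(* Vectors of R^2 are complex numbers here. *)
exists (Re z1, Re z2), (Im z1, Im z2). split.
- intros [Hx Hy]. apply Hz. injection Hx; injection Hy; intros.
  split; apply injective_projections; assumption.
- rewrite (Lb (Re z1, Re z2)), (Lb (Im z1, Im z2)), !Cmod_sqr.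
  destruct z1 as [x1 y1], z2 as [x2 y2], lam as [l1 l2].
  unfold Re, Im in *; simpl in *.
  destruct (L (RtoC 1)) as [m11 m21], (L Ci) as [m12 m22]; simpl in *.
  assert (e1 := f_equal fst E1). assert (e2 := f_equal snd E1).
  assert (e3 := f_equal fst E2). assert (e4 := f_equal snd E2). simpl in *.
  replace (x1 * m11 - 0 * m21 + (x2 * m12 - 0 * m22)) with (l1 * x1 - l2 * y1) by lra.
  replace (x1 * m21 + 0 * m11 + (x2 * m22 + 0 * m12)) with (l1 * x2 - l2 * y2) by lra.
  replace (y1 * m11 - 0 * m21 + (y2 * m12 - 0 * m22)) with (l1 * y1 + l2 * x1) by lra.
  replace (y1 * m21 + 0 * m11 + (y2 * m22 + 0 * m12)) with (l1 * y2 + l2 * x2) by lra.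
  ring.
Qed.

Lemma eigenvalue_inside (L : C -> C) :
  (forall y z, L (y + z)%C = (L y + L z)%C) ->
  (forall s z, L (RtoC s * z)%C = (RtoC s * L z)%C) ->
  (forall y : C, y <> 0%C -> Cmod (L y) < Cmod y) ->
  forall lam, is_eigenvalue L lam -> Cmod lam < 1.
Proof.
intros La Ls HL lam Hlam.
destruct (eigenvalue_modulus L lam La Ls Hlam) as [x [y [Hxy E]]].
assert (L0 : forall z : C, Cmod (L z) * Cmod (L z) <= Cmod z * Cmod z /\
   (z <> 0%C -> Cmod (L z) * Cmod (L z) < Cmod z * Cmod z)).
{ assert (P : forall z : C, z <> 0%C -> Cmod (L z) * Cmod (L z) < Cmod z * Cmod z).
  { intros z Hz. specialize (HL z Hz). generalize (Cmod_ge_0 (L z)); nra. }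
  intros z; split; [| apply P].
  destruct (Ceq_dec z 0) as [-> | Hz]; [| left; auto].
  replace (L 0%C) with (RtoC 0). lra.
  replace (RtoC 0) with (RtoC 0 * 0)%C at 2 by ring. rewrite Ls; ring. }
destruct (Rlt_le_dec (Cmod lam) 1) as [| H1]; trivial. exfalso.
assert (1 <= Cmod lam * Cmod lam) by nra.
assert (0 <= Cmod x * Cmod x + Cmod y * Cmod y) by nra.
assert (S : Cmod x * Cmod x + Cmod y * Cmod y <= Cmod (L x) * Cmod (L x) + Cmod (L y) * Cmod (L y)).
{ rewrite <- E. rewrite <- (Rmult_1_l (_ + _)) at 1. apply Rmult_le_compat_r; trivial. }
destruct (Ceq_dec x 0) as [Hx | Hx].
- destruct (Ceq_dec y 0) as [Hy | Hy]; [tauto |].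
  generalize (proj2 (L0 y) Hy) (proj1 (L0 x)); lra.
- generalize (proj2 (L0 x) Hx) (proj1 (L0 y)); lra.
Qed.

Lemma eigenvalue_outside (L : C -> C) :
  (forall y z, L (y + z)%C = (L y + L z)%C) ->
  (forall s z, L (RtoC s * z)%C = (RtoC s * L z)%C) ->
  (forall y : C, y <> 0%C -> Cmod y < Cmod (L y)) ->
  forall lam, is_eigenvalue L lam -> 1 < Cmod lam.
Proof.
intros La Ls HL lam Hlam.
destruct (eigenvalue_modulus L lam La Ls Hlam) as [x [y [Hxy E]]].
assert (L0 : forall z : C, Cmod z * Cmod z <= Cmod (L z) * Cmod (L z) /\
   (z <> 0%C -> Cmod z * Cmod z < Cmod (L z) * Cmod (L z))).
{ assert (P : forall z : C, z <> 0%C -> Cmod z * Cmod z < Cmod (L z) * Cmod (L z)).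
  { intros z Hz. specialize (HL z Hz). generalize (Cmod_ge_0 z); nra. }
  intros z; split; [| apply P].
  destruct (Ceq_dec z 0) as [-> | Hz]; [| left; auto].
  rewrite Cmod_0. generalize (Rle_0_sqr (Cmod (L 0%C))); unfold Rsqr; lra. }
destruct (Rlt_le_dec 1 (Cmod lam)) as [| H1]; trivial. exfalso.
assert (Cmod lam * Cmod lam <= 1) by (generalize (Cmod_ge_0 lam); nra).
assert (0 <= Cmod x * Cmod x + Cmod y * Cmod y) by nra.
assert (S : Cmod (L x) * Cmod (L x) + Cmod (L y) * Cmod (L y) <= Cmod x * Cmod x + Cmod y * Cmod y).
{ rewrite <- E. rewrite <- (Rmult_1_l (_ + _)) at 2. apply Rmult_le_compat_r; trivial. }
destruct (Ceq_dec x 0) as [Hx | Hx].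
- destruct (Ceq_dec y 0) as [Hy | Hy]; [tauto |].
  generalize (proj2 (L0 y) Hy) (proj1 (L0 x)); lra.
- generalize (proj2 (L0 x) Hx) (proj1 (L0 y)); lra.
Qed.

Lemma near_scaling_expanding (L : C -> C) (al : C) (s c : R) :
  (forall y, Cmod (L y - (1 + RtoC s * al) * y) <= c * Cmod y) ->
  c < s * Re al ->
  forall y : C, y <> 0%C -> Cmod y < Cmod (L y).
Proof.
intros HL Hs y Hy. assert (0 < Cmod y) by (apply Cmod_gt_0, Hy).
assert (1 + s * Re al <= Cmod (1 + RtoC s * al)).
{ eapply Rle_trans; [| apply Rmax_Cmod]. eapply Rle_trans; [| apply Rmax_l].
  eapply Rle_trans; [| apply Rle_abs]. simpl. unfold Re; lra. }
specialize (HL y). rewrite Cmod_minus_sym in HL.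
generalize (Cmod_le_plus ((1 + RtoC s * al) * y) (L y)). rewrite Cmod_mult. intros. nra.
Qed.

Lemma near_scaling_contracting (L : C -> C) (al : C) (s c : R) :
  (forall y, Cmod (L y - (1 + RtoC s * al) * y) <= c * Cmod y) ->
  2 * c < - (s * Re al) -> - (s * Re al) <= 1 ->
  s * s * (Cmod al * Cmod al) <= - (s * Re al) ->
  forall y : C, y <> 0%C -> Cmod (L y) < Cmod y.
Proof.
intros HL Hs Hs1 Hs2 y Hy. assert (0 < Cmod y) by (apply Cmod_gt_0, Hy).
assert (K : Cmod (1 + RtoC s * al) <= 1 + s * Re al / 2).
{ apply Rsqr_incr_0_var; [| lra]. unfold Rsqr. rewrite Cmod_sqr.
  rewrite Cmod_sqr in Hs2. simpl. unfold Re, Im in *. simpl.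
  generalize (Rle_0_sqr (s * fst al)); unfold Rsqr. intros. nra. }
specialize (HL y).
generalize (Cmod_le_plus (L y) ((1 + RtoC s * al) * y)). rewrite Cmod_mult. intros. nra.
Qed.

(** 1 + 2 pi mu al has modulus 1 + 2 pi mu Re al + O(mu^2), and the error
    16 pi |mu| om is at most a quarter of 2 pi |mu Re al|. *)
Lemma spectrum_near_scaling (L : C -> C) (al : C) (mu om M : R) :
  (forall y z, L (y + z)%C = (L y + L z)%C) ->
  (forall s z, L (RtoC s * z)%C = (RtoC s * L z)%C) ->
  (forall y, Cmod (L y - (1 + RtoC (2 * PI * mu) * al) * y) <=
     2 * PI * Rabs mu * (8 * om) * Cmod y) ->
  0 < om -> 32 * om <= Rabs (Re al) -> 1 <= M -> Cmod al <= M -> mu <> 0 ->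
  8 * Rabs mu * (M * M) <= om -> 8 * Rabs mu * (M * M) <= / 4 ->
  (mu * Re al < 0 -> forall lam, is_eigenvalue L lam -> Cmod lam < 1) /\
  (forall lam, is_eigenvalue L lam -> Cmod lam <> 1).
Proof.
intros La Ls HL Hom Hal HM aM w1 S1 S2.
assert (mu0 := Rabs_pos_lt _ w1).
assert (al1 : Rabs (Re al) <= Cmod al) by (eapply Rle_trans; [apply Rmax_l | apply Rmax_Cmod]).
assert (MM : M <= M * M) by nra.
assert (MMmu : M * Rabs mu <= M * M * Rabs mu) by (apply Rmult_le_compat_r; lra).
generalize PI_8; intros Hpi.
assert (pm : 0 < 2 * PI * Rabs mu) by nra.
assert (Alt : (mu * Re al < 0 -> forall y : C, y <> 0%C -> Cmod (L y) < Cmod y) /\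
              (0 < mu * Re al -> forall y : C, y <> 0%C -> Cmod y < Cmod (L y))).
{ assert (Eabs : Rabs (mu * Re al) = Rabs mu * Rabs (Re al)) by apply Rabs_mult.
  assert (om32 : 2 * PI * Rabs mu * (32 * om) <= 2 * PI * Rabs mu * Rabs (Re al))
    by (apply Rmult_le_compat_l; lra).
  assert (omp : 0 < 2 * PI * Rabs mu * om) by (apply Rmult_lt_0_compat; lra).
  split; intros Hs.
  - rewrite Rabs_left in Eabs by trivial.
    assert (Es : - (2 * PI * mu * Re al) = 2 * PI * Rabs mu * Rabs (Re al)).
    { replace (- (2 * PI * mu * Re al)) with (2 * PI * (- (mu * Re al))) by ring.
      rewrite Eabs; ring. }
    assert (p8 : 2 * PI * Rabs mu <= 8 * Rabs mu) by (apply Rmult_le_compat_r; lra).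
    assert (A0 : 0 <= Rabs (Re al)) by apply Rabs_pos.
    apply (near_scaling_contracting L al _ _ HL).
    + rewrite Es. lra.
    + rewrite Es. apply Rle_trans with (8 * Rabs mu * M); [apply Rmult_le_compat; lra | lra].
    + rewrite Es.
      assert (sq : 2 * PI * mu * (2 * PI * mu) = 2 * PI * Rabs mu * (2 * PI * Rabs mu)).
      { assert (sqmu : mu * mu = Rabs mu * Rabs mu) by (rewrite <- Rabs_mult; symmetry; apply Rabs_pos_eq; nra).
        replace (2 * PI * mu * (2 * PI * mu)) with (2 * PI * (2 * PI) * (mu * mu)) by ring.
        rewrite sqmu; ring. }
      rewrite sq, Rmult_assoc. apply Rmult_le_compat_l; [lra |].
      apply Rle_trans with (8 * Rabs mu * (M * M)); [| lra].
      apply Rmult_le_compat; try lra. generalize (Cmod_ge_0 al); nra.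
      apply Rmult_le_compat; trivial using Cmod_ge_0.
  - rewrite Rabs_pos_eq in Eabs by lra.
    apply (near_scaling_expanding L al _ _ HL).
    replace (2 * PI * mu * Re al) with (2 * PI * (mu * Re al)) by ring.
    rewrite Eabs. lra. }
destruct Alt as [Contr Expand]. split.
- intros Hs. apply (eigenvalue_inside L La Ls (Contr Hs)).
- intros lam Hlam. destruct (Rtotal_order (mu * Re al) 0) as [s | [s | s]].
  + assert (Cmod lam < 1) by (apply (eigenvalue_inside L La Ls (Contr s)), Hlam). lra.
  + exfalso. apply Rmult_integral in s as [s | s]; [tauto |].
    rewrite s, Rabs_R0 in Hal. lra.
  + assert (1 < Cmod lam) by (apply (eigenvalue_outside L La Ls (Expand s)), Hlam). lra.
Qed.

(** * From smooth functions to the reduced field *)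

Lemma continuous_pair_fun {U V : UniformSpace} (f : R -> U) (g : R -> V) (t : R) :
  continuous f t -> continuous g t ->
  continuous (U := prod_UniformSpace U V) (fun s => (f s, g s)) t.
Proof.
intros Hf Hg.
apply (continuous_comp_2 (X := prod_UniformSpace U V) f g (fun x y => (x, y)) t Hf Hg).
apply (continuous_ext (fun x => x)).
{ intros [x y]; reflexivity. }
apply continuous_id.
Qed.

(** By compactness finitely many of the local radii suffice; as Q s e is
    monotone in e, the smallest of them serves everywhere. *)
Lemma compact_uniform (Q : R -> R -> Prop) (a b : R) :
  (forall s e e', 0 < e' <= e -> Q s e -> Q s e') ->
  (forall t, a <= t <= b -> exists e, 0 < e /\ forall s, Rabs (s - t) < e -> Q s e) ->
  exists e, 0 < e /\ forall s, a <= s <= b -> Q s e.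
Proof.
intros Hmon Hloc.
assert (Hex : forall t, exists e : posreal, a <= t <= b -> forall s, Rabs (s - t) < e -> Q s e).
{ intros t. destruct (classic (a <= t <= b)) as [Ht | Ht].
  - destruct (Hloc t Ht) as [e [He He']]. exists (mkposreal e He). intros _. exact He'.
  - exists (mkposreal 1 Rlt_0_1). intros; tauto. }
(* The compactness theorem asks for a radius as a function of the point. *)
pose (delta := fun t => proj1_sig (constructive_indefinite_description _ (Hex t))).
assert (Hdelta : forall t, a <= t <= b -> forall s, Rabs (s - t) < delta t -> Q s (delta t)).
{ intros t. unfold delta. destruct (constructive_indefinite_description _ (Hex t)) as [e He]. exact He. }
destruct (compactness_value_1d a b delta) as [e He].
exists e. split; [apply cond_pos |]. intros s Hs.
destruct (NNPP _ (He s Hs)) as [t [Ht [H1 H2]]].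
apply (Hmon s (delta t)). split; [apply cond_pos | exact H2]. apply Hdelta; trivial.
Qed.

(** G is locally Lipschitz near each (t, 0); compactness of a period makes the
    constants uniform in t. *)
Lemma forcing_bounds (eta : R) (G : R -> R -> C) :
  0 < eta -> smooth_R_R_C eta G ->
  (forall t eps, Rabs eps < eta -> G (t + 2 * PI) eps = G t eps) ->
  exists M d, 0 < M /\ 0 < d /\ d <= eta /\
  forall t eps, Rabs eps < d -> Cmod (G t eps) <= M /\
    forall eps', Rabs eps' < d -> Cmod (G t eps - G t eps') <= M * Rabs (eps - eps').
Proof.
intros Heta HG Hper.
(* One number serves both as radius and, inverted, as bound. *)
pose (Q := fun s e => forall eps, Rabs eps < e -> Cmod (G s eps) <= / e /\
    forall eps', Rabs eps' < e -> Cmod (G s eps - G s eps') <= / e * Rabs (eps - eps')).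
destruct (compact_uniform Q 0 (2 * PI)) as [e [He HQ]].
- intros s e e' He H eps Heps.
  assert (/ e <= / e') by (apply Rinv_le_contravar; lra).
  destruct (H eps ltac:(lra)) as [H1 H2]. split; [lra |].
  intros eps' Heps'. specialize (H2 eps' ltac:(lra)).
  apply Rle_trans with (1 := H2). apply Rmult_le_compat_r; trivial using Rabs_pos.
- intros t _.
  destruct (Ck_on_S_lipschitz (E := prod_NormedModule R_AbsRing R_NormedModule R_NormedModule)
    (fun x => Rabs (snd x) < eta) (fun x => G (fst x) (snd x)) (t, 0)) as [M [r [HM [Hr HL]]]].
  + apply finitely_tested_prod; apply finitely_tested_R.
  + exists (mkposreal eta Heta). intros [x y] [_ Hy]. simpl in *.
    replace y with (y - 0) by ring. exact Hy.
  + apply (HG 1%nat).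
  + assert (HL' : forall s s' eps eps', Rabs (s - t) + Rabs eps < r -> Rabs (s' - t) + Rabs eps' < r ->
      Cmod (G s eps - G s' eps') <= M * (Rabs (s - s') + Rabs (eps - eps'))).
    { intros s s' eps eps' H1 H2.
      assert (A1 := norm_pair_le (E := R_NormedModule) (F := R_NormedModule) (s - t) (eps - 0)).
      assert (A2 := norm_pair_le (E := R_NormedModule) (F := R_NormedModule) (s' - t) (eps' - 0)).
      assert (A3 := norm_pair_le (E := R_NormedModule) (F := R_NormedModule) (s - s') (eps - eps')).
      change (@norm R_AbsRing R_NormedModule) with Rabs in A1, A2, A3.
      rewrite Rminus_0_r in A1 at 2. rewrite Rminus_0_r in A2 at 2.
      eapply Rle_trans; [apply (HL (s, eps) (s', eps')) |].
      - eapply Rle_lt_trans; [exact A1 | exact H1].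
      - eapply Rle_lt_trans; [exact A2 | exact H2].
      - apply Rmult_le_compat_l; [lra | exact A3]. }
    set (N := M * r + Cmod (G t 0) + M).
    assert (HN : 0 < N).
    { generalize (Cmod_ge_0 (G t 0)); unfold N. assert (0 < M * r) by nra. lra. }
    exists (Rmin (r / 2) (/ N)). split.
    { apply Rmin_pos; [lra | apply Rinv_0_lt_compat, HN]. }
    intros s Hs eps Heps.
    assert (m1 := Rmin_l (r / 2) (/ N)). assert (m2 := Rmin_r (r / 2) (/ N)).
    assert (m0 : 0 < Rmin (r / 2) (/ N)) by (apply Rmin_pos; [lra | apply Rinv_0_lt_compat, HN]).
    assert (m3 : N <= / Rmin (r / 2) (/ N)).
    { rewrite <- (Rinv_inv N) at 1. apply Rinv_le_contravar; trivial. }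
    split.
    * eapply Rle_trans; [| exact m3]. eapply Rle_trans; [apply (Cmod_le_plus _ (G t 0)) |].
      assert (X := HL' s t eps 0 ltac:(lra)). rewrite Rminus_diag, Rabs_R0, Rminus_0_r in X.
      specialize (X ltac:(lra)).
      assert (M * (Rabs (s - t) + Rabs eps) <= M * r) by (apply Rmult_le_compat_l; lra).
      unfold N. lra.
    * intros eps' Heps'.
      assert (X := HL' s s eps eps' ltac:(lra) ltac:(lra)). rewrite Rminus_diag, Rabs_R0, Rplus_0_l in X.
      apply Rle_trans with (1 := X). apply Rmult_le_compat_r; [apply Rabs_pos |].
      assert (M <= N) by (unfold N; generalize (Cmod_ge_0 (G t 0)); assert (0 < M * r) by nra; lra). lra.
- exists (/ e), (Rmin e eta). split; [apply Rinv_0_lt_compat, He |].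
  split; [apply Rmin_pos; lra |]. split; [apply Rmin_r |].
  intros t eps Heps.
  assert (n1 := Rmin_l e eta). assert (n2 := Rmin_r e eta).
  destruct (reduce_period t) as [s [Hs Es]].
  assert (Et : forall eps, Rabs eps < eta -> G t eps = G s eps).
  { intros x Hx. apply (Es (fun t => G t x)). intros; apply Hper, Hx. }
  rewrite (Et eps) by lra. destruct (HQ s Hs eps ltac:(lra)) as [H1 H2]. split; trivial.
  intros eps' Heps'. rewrite (Et eps') by lra. apply H2; lra.
Qed.

Lemma is_derive_C_unique f t l l' : is_derive_C f t l -> is_derive_C f t l' -> l = l'.
Proof.
intros H1 H2. apply is_derive_C_pair in H1; apply is_derive_C_pair in H2.
destruct H1 as [A1 B1], H2 as [A2 B2].
apply is_derive_unique in A1, B1, A2, B2.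
apply injective_projections; [change (Re l = Re l') | change (Im l = Im l')]; congruence.
Qed.

(** With w = q e^{-it} - i v, the derivative of H at (-i v, 0) sends k to
    alpha1 k + be conj k, and conjugation by e^{it} turns this into
    alpha1 y + be conj y e^{2it}.  All Taylor estimates of H hold on one ball
    around (-i v, 0); it is shrunk until the Lipschitz constant of H minus its
    linear part is at most om. *)
Lemma reduction v eta (G : R -> R -> C) (H : C -> R -> C) alpha1 :
  0 < eta -> smooth_R_R_C eta G ->
  (forall t eps, Rabs eps < eta -> G (t + 2 * PI) eps = G t eps) ->
  smooth_C_R_C eta H ->
  (exists M, forall w mu, Rabs mu < eta -> Cmod (H w mu) <= M) ->
  is_wirtinger (fun w => H w 0) (- (Ci * v))%C alpha1 ->
  Re alpha1 <> 0 ->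
  exists be om M r d B,
    reduced_field alpha1 be om M r d (fun t eps => cis t * G t eps)%C
      (fun t q mu => cis t * H (q * cis (- t) + - (Ci * v))%C mu)%C B.
Proof.
intros Heta HG Gper HH [Mb Hb] [fx [fy [Hfx [Hfy Eal]]]] Hal.
set (z0 := (- (Ci * v))%C) in *.
pose (E := prod_NormedModule R_AbsRing C_R_NormedModule R_NormedModule).
pose (f := fun x : E => H (fst x) (snd x)).
pose (U := fun x : E => Rabs (snd x) < eta).
destruct (Ck_on_2_taylor (E := E) U f (z0, 0)) as [Df [Hdf [Cdf [Mt [rt [HMt [Hrt [HU [HL HT]]]]]]]]].
{ apply finitely_tested_prod; [apply finitely_tested_prod |]; apply finitely_tested_R. }
{ exists (mkposreal eta Heta). intros [x y] [_ Hy]. simpl in *. unfold U; simpl.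
  replace y with (y - 0) by ring. exact Hy. }
{ apply (HH 2%nat). }
set (x0 := (z0, 0) : E) in *.
assert (Ux0 : U x0) by (unfold U, x0; simpl; rewrite Rabs_R0; exact Heta).
assert (lin : forall x, U x -> is_linear (V := C_R_NormedModule) (Df x)) by (intros x Hx; apply (Hdf x Hx)).
assert (Cf : forall x, U x -> continuous (U := C_R_NormedModule) f x).
{ intros x Hx. apply (filterdiff_continuous (V := C_R_NormedModule) f x). eexists; apply Hdf, Hx. }
assert (Cpath : forall (w : R -> C) mu, Rabs mu < eta -> (forall t, continuousC w t) ->
   forall g : E -> C, (forall x, U x -> continuous (U := C_R_NormedModule) g x) ->
   forall t, continuousC (fun t => g (w t, mu)) t).
{ intros w mu Hmu Cw g Cg t.
  apply (continuous_comp (U := R_UniformSpace) (V := E) (W := C_R_NormedModule) (fun t => (w t, mu)) g).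
  apply (continuous_pair_fun (U := C_R_NormedModule) (V := R_NormedModule)). apply Cw. apply continuous_const.
  apply Cg. exact Hmu. }
assert (Dsplit : forall x (k : C), U x -> Df x (k, 0) = (RtoC (Re k) * Df x (RtoC 1, 0) + RtoC (Im k) * Df x (Ci, 0))%C).
{ intros x k Hx.
  replace ((k, 0) : E) with (plus (G := E) (scal (V := E) (Re k) (RtoC 1, 0)) (scal (V := E) (Im k) (Ci, 0))).
  - rewrite (linear_plus _ (lin x Hx)), !(linear_scal _ (lin x Hx)).
    apply injective_projections; simpl; unfold scal, plus; simpl; unfold mult; simpl; ring.
  - apply injective_projections; [apply injective_projections |]; simpl;
     unfold scal, plus; simpl; unfold mult; simpl; unfold Re, Im; ring. }
assert (Hline : forall k : C, is_derive_C (fun s => H (z0 + k * RtoC s)%C 0) 0 (Df x0 (k, 0))).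
{ intros k.
  assert (Ez : plus (G := E) x0 (scal (V := E) 0 (k, 0)) = x0).
  { unfold x0. apply injective_projections; [apply injective_projections |]; simpl;
     unfold scal, plus; simpl; unfold mult; simpl; ring. }
  apply (is_derive_C_ext (fun s => f (plus (G := E) x0 (scal (V := E) s (k, 0))))).
  - intros s. unfold f, x0; simpl. f_equal.
    + apply injective_projections; simpl; unfold scal, plus; simpl; unfold mult; simpl; ring.
    + unfold scal, plus; simpl; unfold mult; simpl; ring.
  - apply (derivative_along_line (E := E) f (Df x0) x0 (k, 0) 0).
    exact (eq_ind x0 (fun z => filterdiff (V := C_R_NormedModule) f (locally z) (Df x0))
      (Hdf x0 Ux0) _ (eq_sym Ez)). }
assert (Efx : Df x0 (RtoC 1, 0) = fx).
{ apply (is_derive_C_unique (fun s => H (z0 + RtoC s)%C 0) 0); trivial.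
  apply (is_derive_C_ext (fun s => H (z0 + RtoC 1 * RtoC s)%C 0)); [| apply Hline].
  intros s; f_equal; ring. }
assert (Efy : Df x0 (Ci, 0) = fy).
{ apply (is_derive_C_unique (fun s => H (z0 + Ci * RtoC s)%C 0) 0); trivial. }
set (be := ((fx + Ci * fy) / RtoC 2)%C).
assert (EA : forall k : C, Df x0 (k, 0) = (alpha1 * k + be * Cconj k)%C).
{ intros k. rewrite Dsplit, Efx, Efy, Eal by trivial. unfold be.
  apply injective_projections; simpl; unfold Re, Im; field. }
destruct (linear_norm _ (lin x0 Ux0)) as [C1 [HC1 BC1]].
destruct (forcing_bounds eta G Heta HG Gper) as [Mg [dg [HMg [Hdg [Hdg' HGb]]]]].
set (om := Rabs (Re alpha1) / 32).
assert (Hom : 0 < om) by (unfold om; generalize (Rabs_pos_lt _ Hal); lra).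
(* On the ball of radius rr the linearization error is 3 Mt rr <= om. *)
set (rr := Rmin rt (om / (3 * Mt))).
assert (Hrr : 0 < rr) by (apply Rmin_pos; trivial; apply Rdiv_lt_0_compat; lra).
assert (Hrr1 : rr <= rt) by apply Rmin_l.
assert (Hrr2 : 3 * Mt * rr <= om).
{ apply Rle_trans with (3 * Mt * (om / (3 * Mt))). apply Rmult_le_compat_l; [lra | apply Rmin_r].
  right; field; lra. }
clearbody rr.
set (M := 1 + Cmod alpha1 + Cmod be + om + C1 + Mt + Rabs Mb + Mg).
generalize (Cmod_ge_0 alpha1) (Cmod_ge_0 be) (Rabs_pos Mb); intros Hal0 Hbe0 HMb0.
set (d := Rmin (Rmin 1 eta) (Rmin dg (rr / 3))).
assert (Hd : 0 < d) by (repeat apply Rmin_pos; lra).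
assert (Hd1 : d <= 1) by (unfold d; eapply Rle_trans; [apply Rmin_l | apply Rmin_l]).
assert (Hd2 : d <= eta) by (unfold d; eapply Rle_trans; [apply Rmin_l | apply Rmin_r]).
assert (Hd3 : d <= dg) by (unfold d; eapply Rle_trans; [apply Rmin_r | apply Rmin_l]).
assert (Hd4 : d <= rr / 3) by (unfold d; eapply Rle_trans; [apply Rmin_r | apply Rmin_r]).
clearbody d.
assert (normC : forall z : C, norm (V := C_R_NormedModule) z = Cmod z).
{ intros z; symmetry; apply Cmod_norm. }
assert (npair : forall (z : C) (s : R), norm (V := E) (z, s) <= Cmod z + Rabs s).
{ intros z s. rewrite <- normC. apply (norm_pair_le (E := C_R_NormedModule) (F := R_NormedModule)). }
assert (N0 : norm (minus (G := E) x0 x0) = 0) by (rewrite minus_eq_zero; apply (norm_zero (V := E))).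
(* The argument of H; for small q and mu it stays in the ball of radius rr. *)
pose (pt := fun t (q : C) (mu : R) => ((q * cis (- t) + z0)%C, mu) : E).
assert (ptU : forall t q mu, Rabs mu < d -> U (pt t q mu)) by (intros; unfold U, pt; simpl; lra).
assert (ptm : forall (t : R) (q q' : C) (mu mu' : R),
  minus (G := E) (pt t q mu) (pt t q' mu') = (((q - q') * cis (- t))%C, mu - mu')).
{ intros. unfold pt. apply injective_projections; [| reflexivity].
  apply injective_projections; simpl; unfold minus, plus, opp; simpl; ring. }
assert (ptm0 : forall t q mu, Cmod q <= rr / 3 -> Rabs mu < d -> norm (minus (G := E) (pt t q mu) x0) < rr).
{ intros t q mu Hq Hmu.
  replace x0 with (pt t 0%C 0).
  - rewrite ptm. eapply Rle_lt_trans; [apply npair |]. rewrite Cmod_mult, Cmod_cis, Rminus_0_r.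
    replace (q - 0)%C with q by ring. lra.
  - unfold pt, x0. f_equal. ring. }
assert (Cw : forall u, (forall t, continuousC u t) -> forall t, continuousC (fun t => u t * cis (- t) + z0)%C t).
{ intros u Cu t. apply continuousC_plus; [apply continuousC_mult; trivial | apply continuousC_const].
  apply (continuous_ext (U := C_R_NormedModule) (fun t => cis (-1 * t))).
  intros s; f_equal; ring. apply continuousC_cis. }
assert (Ccis : forall t, continuousC cis t).
{ intros t. apply (continuous_ext (U := C_R_NormedModule) (fun t => cis (1 * t))).
  intros s; f_equal; ring. apply continuousC_cis. }
assert (conj_cis : forall (k : C) t, (cis t * (alpha1 * (k * cis (- t)) + be * Cconj (k * cis (- t))))%C =
   (alpha1 * k + be * Cconj k * cis (2 * t))%C).
{ intros k t. rewrite Cmult_conj, Cconj_cis, Ropp_involutive.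
  replace (2 * t) with (t + t) by ring. rewrite cis_plus.
  replace (cis t * (alpha1 * (k * cis (- t)) + be * (Cconj k * cis t)))%C with
   (alpha1 * k * (cis t * cis (- t)) + be * Cconj k * (cis t * cis t))%C by ring.
  rewrite cis_opp_r; ring. }
exists be, om, M, (rr / 3), d,
  (fun t q mu y => cis t * Df (pt t q mu) ((y * cis (- t))%C, 0))%C.
constructor.
- exact Hom.
- unfold om; lra.
- unfold M; lra.
- unfold M; lra.
- lra.
- exact Hd.
- exact Hd1.
- intros t eps He. rewrite Cmod_mult, Cmod_cis, Rmult_1_l.
  destruct (HGb t eps ltac:(lra)). unfold M; lra.
- intros t eps eps' He He'.
  replace (cis t * G t eps - cis t * G t eps')%C with (cis t * (G t eps - G t eps'))%C by ring.
  rewrite Cmod_mult, Cmod_cis, Rmult_1_l.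
  destruct (HGb t eps ltac:(lra)) as [_ X]. eapply Rle_trans; [apply X; lra |].
  apply Rmult_le_compat_r; [apply Rabs_pos | unfold M; lra].
- intros eps He t. apply continuousC_mult; [apply Ccis |].
  destruct (HG 1%nat) as [DG [HDG _]].
  apply (continuous_comp (U := R_UniformSpace)
    (V := prod_NormedModule R_AbsRing R_NormedModule R_NormedModule) (W := C_R_NormedModule)
    (fun t => (t, eps)) (fun x => G (fst x) (snd x))).
  apply (continuous_pair_fun (U := R_NormedModule) (V := R_NormedModule)). apply continuous_id. apply continuous_const.
  apply (filterdiff_continuous (U := prod_NormedModule R_AbsRing R_NormedModule R_NormedModule) (V := C_R_NormedModule)).
  eexists; apply HDG. simpl; lra.
- intros eps He t. rewrite cis_period, Gper by lra. reflexivity.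
- intros t q mu Hmu. rewrite Cmod_mult, Cmod_cis, Rmult_1_l.
  eapply Rle_trans; [apply Hb; lra |]. generalize (Rle_abs Mb); unfold M; lra.
- intros t q q' mu mu' Hq Hq' Hmu Hmu'.
  rewrite <- conj_cis, <- EA.
  set (k := ((q - q') * cis (- t))%C).
  assert (Ek : Cmod k = Cmod (q - q')) by (unfold k; rewrite Cmod_mult, Cmod_cis; ring).
  set (x := pt t q mu). set (y := pt t q' mu').
  change (H (q * cis (- t) + z0)%C mu) with (f x). change (H (q' * cis (- t) + z0)%C mu') with (f y).
  assert (Exy : minus (G := E) x y = (k, mu - mu')) by apply ptm.
  assert (Bx : norm (minus (G := E) x x0) < rr) by (apply ptm0; trivial).
  assert (By : norm (minus (G := E) y x0) < rr) by (apply ptm0; trivial).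
  assert (Bxy : norm (minus (G := E) x y) <= 2 * rr).
  { rewrite (minus_trans x0). eapply Rle_trans; [apply norm_triangle |].
    rewrite <- (norm_opp (minus x0 y)), opp_minus. lra. }
  replace (cis t * f x - cis t * f y - cis t * Df x0 (k, 0))%C with
   (cis t * ((f x - f y - Df y (minus (G := E) x y)) + (Df y (minus (G := E) x y) - Df x0 (minus (G := E) x y))
     + Df x0 (RtoC 0, (mu - mu')%R)))%C.
  2: { assert (Lxy : Df x0 (minus (G := E) x y) = (Df x0 (k, 0) + Df x0 (RtoC 0, (mu - mu')%R))%C).
       { rewrite Exy. exact (linear_pair (E := C_R_NormedModule) (F := R_NormedModule) (Df x0) k (mu - mu') (lin x0 Ux0)). }
       rewrite Lxy. ring. }
  rewrite Cmod_mult, Cmod_cis, Rmult_1_l.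
  assert (Z1 := HT x y ltac:(lra) ltac:(lra)).
  assert (Z2 := HL y x0 (minus (G := E) x y) ltac:(lra) ltac:(rewrite N0; lra)).
  assert (Z3 := BC1 (RtoC 0, mu - mu')).
  change (norm (V := C_R_NormedModule) (Df x0 (RtoC 0, mu - mu')) <= C1 * norm (V := E) (RtoC 0, mu - mu')) in Z3.
  rewrite normC in Z3.
  assert (Z4 := npair (RtoC 0) (mu - mu')). rewrite Cmod_0, Rplus_0_l in Z4.
  assert (Z5 : norm (minus (G := E) x y) <= Cmod (q - q') + Rabs (mu - mu')).
  { rewrite Exy, <- Ek. apply npair. }
  set (n := norm (minus (G := E) x y)) in *.
  assert (n0 : 0 <= n) by apply norm_ge_0.
  eapply Rle_trans; [apply Cmod_triangle |]. eapply Rle_trans; [apply Rplus_le_compat_r, Cmod_triangle |].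
  assert (Z6 : Mt * n * n <= Mt * (2 * rr) * n).
  { apply Rmult_le_compat_r; trivial. apply Rmult_le_compat_l; lra. }
  assert (Z7 : Mt * norm (minus (G := E) y x0) * n <= Mt * rr * n).
  { apply Rmult_le_compat_r; trivial. apply Rmult_le_compat_l; lra. }
  assert (Z8 : 3 * Mt * rr * n <= om * n) by (apply Rmult_le_compat_r; trivial).
  assert (Z9 : om * n <= om * (Cmod (q - q') + Rabs (mu - mu'))) by (apply Rmult_le_compat_l; lra).
  assert (Z10 : C1 * norm (V := E) (RtoC 0, mu - mu') <= C1 * Rabs (mu - mu')) by (apply Rmult_le_compat_l; lra).
  assert (Z11 : (om + C1) * Rabs (mu - mu') <= M * Rabs (mu - mu')).
  { apply Rmult_le_compat_r; [apply Rabs_pos | unfold M; lra]. }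
  lra.
- intros mu u Hmu Cu t. apply continuousC_mult; [apply Ccis |].
  apply (Cpath (fun t => u t * cis (- t) + z0)%C mu ltac:(lra) (Cw u Cu) f Cf).
- intros t q mu. rewrite cis_period.
  replace (cis (- (t + 2 * PI))) with (cis (- t)); trivial.
  rewrite <- (cis_period (- (t + 2 * PI))). f_equal; ring.
- exists (H z0 0). intros t. rewrite Cmult_0_l, Cplus_0_l, Rmult_1_l. ring.
- intros t q mu y z Hmu.
  rewrite (Dsplit _ ((y + z) * cis (- t))%C), (Dsplit _ (y * cis (- t))%C),
    (Dsplit _ (z * cis (- t))%C) by auto. C_calc.
- intros t q mu s z Hmu.
  rewrite (Dsplit _ (RtoC s * z * cis (- t))%C), (Dsplit _ (z * cis (- t))%C) by auto. C_calc.
- intros mu u y Hmu Cu t. apply continuousC_mult; [apply Ccis |].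
  apply (continuous_ext (U := C_R_NormedModule) (fun t =>
    RtoC (Re (y * cis (- t))) * Df (pt t (u t) mu) (RtoC 1, 0) + RtoC (Im (y * cis (- t))) * Df (pt t (u t) mu) (Ci, 0))%C).
  { intros s. symmetry; apply Dsplit. auto. }
  assert (Cy : continuousC (fun t => y * cis (- t))%C t).
  { apply (continuous_ext (U := C_R_NormedModule) (fun t => y * cis (-1 * t))%C).
    intros s; do 2 f_equal; ring. apply continuousC_mult; [apply continuousC_const | apply continuousC_cis]. }
  destruct (proj1 (continuousC_pair _ t) Cy) as [c1 c2].
  apply continuousC_plus; apply continuousC_mult.
  apply (continuousC_RtoC _ _ c1).
  apply (Cpath (fun t => u t * cis (- t) + z0)%C mu ltac:(lra) (Cw u Cu) (fun x => Df x (RtoC 1, 0)) (Cdf _)).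
  apply (continuousC_RtoC _ _ c2).
  apply (Cpath (fun t => u t * cis (- t) + z0)%C mu ltac:(lra) (Cw u Cu) (fun x => Df x (Ci, 0)) (Cdf _)).
- intros t q mu y Hq Hmu. rewrite <- conj_cis, <- EA.
  set (k := (y * cis (- t))%C).
  assert (Ek : Cmod k = Cmod y) by (unfold k; rewrite Cmod_mult, Cmod_cis; ring).
  replace (cis t * Df (pt t q mu) (k, 0) - cis t * Df x0 (k, 0))%C with
   (cis t * (Df (pt t q mu) (k, 0) - Df x0 (k, 0)))%C by ring.
  rewrite Cmod_mult, Cmod_cis, Rmult_1_l.
  assert (Bx := ptm0 t q mu Hq Hmu).
  eapply Rle_trans; [apply HL; [lra | rewrite N0; lra] |].
  assert (Z := npair k 0). rewrite Rabs_R0, Ek, Rplus_0_r in Z.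
  generalize (Cmod_ge_0 y) (norm_ge_0 (minus (G := E) (pt t q mu) x0)); intros.
  apply Rle_trans with (om * norm (V := E) (k, 0)).
  + apply Rmult_le_compat_r; [apply norm_ge_0 |].
    assert (Mt * norm (minus (G := E) (pt t q mu) x0) <= Mt * rr) by (apply Rmult_le_compat_l; lra). nra.
  + apply Rmult_le_compat_l; [lra | exact Z].
- intros t q q' mu Hq Hq' Hmu.
  set (x := pt t q mu). set (y := pt t q' mu).
  change (H (q * cis (- t) + z0)%C mu) with (f x). change (H (q' * cis (- t) + z0)%C mu) with (f y).
  assert (Exy : minus (G := E) x y = (((q - q') * cis (- t))%C, 0)).
  { unfold x, y. rewrite ptm. f_equal. ring. }
  rewrite <- Exy.
  replace (cis t * f x - cis t * f y - cis t * Df y (minus (G := E) x y))%C with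
   (cis t * (f x - f y - Df y (minus (G := E) x y)))%C by ring.
  rewrite Cmod_mult, Cmod_cis, Rmult_1_l.
  assert (Bx := ptm0 t q mu Hq Hmu). assert (By := ptm0 t q' mu Hq' Hmu).
  eapply Rle_trans; [apply HT; unfold x, y; lra |].
  assert (Z := npair ((q - q') * cis (- t))%C 0). rewrite <- Exy, Rabs_R0, Cmod_mult, Cmod_cis, Rplus_0_r, Rmult_1_r in Z.
  assert (n0 := norm_ge_0 (minus (G := E) x y)). assert (c0 := Cmod_ge_0 (q - q')).
  rewrite !Rmult_assoc. apply Rmult_le_compat; [lra | nra | unfold M; lra |].
  apply Rmult_le_compat; trivial.
Qed.

(** * Back to the equation for p *)

Definition forcing (G : R -> R -> C) (t eps : R) : C := (cis t * G t eps)%C.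

Definition reaction (v : C) (H : C -> R -> C) (t : R) (q : C) (mu : R) : C :=
  (cis t * H (q * cis (- t) + - (Ci * v))%C mu)%C.

(** The primitive of v e^{it} with mean zero, that is, the unperturbed wave
    whose center is the origin. *)
Definition circle (v : C) (t : R) : C := (- (Ci * v) * cis (1 * t))%C.

Lemma rhs_circle v G H eps mu t p :
  rhs v G H eps mu t p =
  (vfield (forcing G) (reaction v H) eps mu t (p - circle v t) + v * cis t)%C.
Proof.
unfold rhs, vfield, forcing, reaction, circle.
replace ((p - - (Ci * v) * cis (1 * t)) * cis (- t) + - (Ci * v))%C with (p * cis (- t))%C.
ring.
rewrite Rmult_1_l.
replace ((p - - (Ci * v) * cis t) * cis (- t) + - (Ci * v))%C with
  (p * cis (- t) + Ci * v * (cis t * cis (- t)) - Ci * v)%C by ring.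
rewrite cis_opp_r. ring.
Qed.

Lemma is_derive_C_circle v t : is_derive_C (circle v) t (v * cis t)%C.
Proof.
eapply is_derive_C_eq. apply is_derive_C_cmult, is_derive_C_cis.
rewrite Rmult_1_l. C_calc.
Qed.

Lemma circle_period v t : circle v (t + 2 * PI) = circle v t.
Proof. unfold circle. rewrite !Rmult_1_l, cis_period. reflexivity. Qed.

Lemma is_derive_add_circle v G H eps mu q t :
  is_derive_C q t (vfield (forcing G) (reaction v H) eps mu t (q t)) ->
  is_derive_C (fun t => q t + circle v t)%C t
    (rhs v G H eps mu t (q t + circle v t)%C).
Proof.
intros Hq. eapply is_derive_C_eq.
apply is_derive_C_plus; [exact Hq | apply is_derive_C_circle].
rewrite rhs_circle. f_equal. f_equal. ring.
Qed.

Lemma rotating_wave_add_circle v G H eps mu q :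
  periodic_solution (forcing G) (reaction v H) eps mu q ->
  rotating_wave (rhs v G H eps mu) (fun t => q t + circle v t)%C.
Proof.
intros [Hq Pq]. split.
- intros t. apply is_derive_add_circle, Hq.
- intros t. rewrite Pq, circle_period. reflexivity.
Qed.

Lemma rotating_wave_sub_circle v G H eps mu p :
  rotating_wave (rhs v G H eps mu) p ->
  periodic_solution (forcing G) (reaction v H) eps mu (fun t => p t - circle v t)%C.
Proof.
intros [Hp Pp]. split.
- intros t. eapply is_derive_C_eq.
  apply is_derive_C_minus; [exact (Hp t) | apply is_derive_C_circle].
  rewrite rhs_circle. ring.
- intros t. rewrite Pp, circle_period. reflexivity.
Qed.

Lemma average_sub_circle v p :
  (forall t, continuousC p t) -> average (fun t => p t - circle v t)%C = average p.
Proof.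
intros Cp.
assert (Cc : forall t, continuousC (circle v) t).
{ intros t. eapply is_derive_C_continuous, is_derive_C_circle. }
assert (E : average (circle v) = 0%C).
{ rewrite (average_derivative_periodic (fun t => - Ci * circle v t)%C (circle v)); trivial.
  - intros t. eapply is_derive_C_eq. apply is_derive_C_cmult, is_derive_C_circle.
    unfold circle. rewrite Rmult_1_l. ring.
  - intros t. rewrite circle_period. reflexivity. }
rewrite average_minus, E by trivial. ring.
Qed.

(** The size of q is not known beforehand, so a bound on H near -i v would not
    suffice: the global bound on H makes q' small, and then q stays close to its
    average. *)
Lemma periodic_solution_small {al be om M r d a h B}
    (F : reduced_field al be om M r d a h B) eps mu q :
  Rabs eps < d -> Rabs mu < d ->
  16 * ((Rabs eps + Rabs mu) * M) <= r ->
  periodic_solution a h eps mu q -> Cmod (average q) <= r / 2 ->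
  forall t, Cmod (q t) <= r.
Proof.
intros He Hm S [Dq Pq] Hc. apply periodic_le; trivial. intros t Ht.
eapply Rle_trans; [apply (Cmod_le_plus _ (average q)) |].
assert (Cmod (q t - average q) <= 8 * ((Rabs eps + Rabs mu) * M)).
{ apply (oscillation q _ _ Dq); trivial. intros; eapply vfield_bound; eauto. }
lra.
Qed.

Lemma filterdiff_quadratic (Phi L : C -> C) (x0 : C) (K rho : R) :
  (forall y z, L (y + z)%C = (L y + L z)%C) ->
  (forall s z, L (RtoC s * z)%C = (RtoC s * L z)%C) ->
  0 < rho ->
  (forall x, Cmod (x - x0) <= rho ->
     Cmod (Phi x - Phi x0 - L (x - x0)%C) <= K * Cmod (x - x0) * Cmod (x - x0)) ->
  filterdiff (K := R_AbsRing) (U := C_R_NormedModule) (V := C_R_NormedModule)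
    Phi (locally (T := C_R_NormedModule) x0) L.
Proof.
intros La Ls Hrho HK. split.
- assert (scalE : forall (k : R) (z : C), scal (V := C_R_NormedModule) k z = (RtoC k * z)%C).
  { intros k z. apply injective_projections; simpl; unfold scal; simpl; unfold mult; simpl; ring. }
  split.
  + exact La.
  + intros k x. rewrite !scalE. apply Ls.
  + exists (1 + Cmod (L 1%C) + Cmod (L Ci)).
    generalize (Cmod_ge_0 (L 1%C)) (Cmod_ge_0 (L Ci)); intros P1 P2.
    split; [lra |]. intros x.
    apply Rle_trans with (Cmod (L x)); [rewrite Cmod_norm; apply Rle_refl |].
    apply Rle_trans with ((1 + Cmod (L 1%C) + Cmod (L Ci)) * Cmod x);
      [| rewrite (Cmod_norm x); apply Rle_refl].
    rewrite <- (C_basis x) at 1. rewrite La, !Ls.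
    eapply Rle_trans; [apply Cmod_triangle |]. rewrite !Cmod_mult, !Cmod_R.
    assert (Rabs (Re x) <= Cmod x) by (eapply Rle_trans; [apply Rmax_l | apply Rmax_Cmod]).
    assert (Rabs (Im x) <= Cmod x) by (eapply Rle_trans; [apply Rmax_r | apply Rmax_Cmod]).
    generalize (Cmod_ge_0 x); nra.
- intros x Hx.
  assert (E : x = x0).
  { symmetry; apply (is_filter_lim_locally_unique (V := C_R_NormedModule) x0 x Hx). }
  subst x. intros [e He]. simpl.
  set (K' := Rabs K + 1).
  assert (HK' : 0 < K') by (unfold K'; generalize (Rabs_pos K); lra).
  assert (Hd : 0 < Rmin rho (e / K')) by (apply Rmin_pos; trivial; apply Rdiv_lt_0_compat; lra).
  generalize (locally_ball_norm (V := C_R_NormedModule) x0 (mkposreal _ Hd)).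
  apply filter_imp. intros x Bx.
  assert (Hx' : Cmod (x - x0) < Rmin rho (e / K')) by (rewrite Cmod_norm; exact Bx).
  assert (m1 := Rmin_l rho (e / K')). assert (m2 := Rmin_r rho (e / K')).
  apply Rle_trans with (Cmod (Phi x - Phi x0 - L (x - x0)%C)); [rewrite Cmod_norm; apply Rle_refl |].
  apply Rle_trans with (e * Cmod (x - x0)); [| rewrite (Cmod_norm (x - x0)); apply Rle_refl].
  eapply Rle_trans; [apply HK; lra |].
  generalize (Cmod_ge_0 (x - x0)); intros c0.
  apply Rmult_le_compat_r; trivial.
  apply Rle_trans with (K' * (e / K')).
  + apply Rle_trans with (K' * Cmod (x - x0)).
    apply Rmult_le_compat_r; trivial. unfold K'; generalize (Rle_abs K); lra.
    apply Rmult_le_compat_l; lra.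
  + right; field; lra.
Qed.

Lemma monodromy_add_circle v G H eps mu {al be om M r d B}
    (F : reduced_field al be om M r d (forcing G) (reaction v H) B) (q : R -> C) :
  Rabs eps < d -> Rabs mu < d ->
  9 * ((Rabs eps + Rabs mu) * M) <= r / 8 -> 18 * (Rabs mu * M) <= 1 ->
  8 * Rabs mu * (M * M) <= om ->
  Cmod (q 0) <= r / 2 ->
  exists L : C -> C,
    is_monodromy (rhs v G H eps mu) (fun t => q t + circle v t)%C L /\
    (forall y z, L (y + z)%C = (L y + L z)%C) /\
    (forall s z, L (RtoC s * z)%C = (RtoC s * L z)%C) /\
    (forall y, Cmod (L y - (1 + RtoC (2 * PI * mu) * al) * y) <=
       2 * PI * Rabs mu * (8 * om) * Cmod y).
Proof.
intros He Hm S1 S2 S3 Hq.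
assert (Hr := r_gt0 F).
destruct (flow_derivative F eps mu (q 0) He Hm S1 S2 Hq)
  as [Phi [L [K [HPhi [La [Ls [HK HL]]]]]]].
exists L. split; [| split; [exact La | split; [exact Ls | exact (HL S3)]]].
set (p0 := (q 0 + circle v 0)%C).
assert (Hr8 : 0 < r / 8) by lra.
assert (shift : forall x, (x - circle v 0 - q 0 = x - p0)%C) by (intros; unfold p0; ring).
exists (fun x => (Phi (x - circle v 0) + circle v 0)%C). split.
- generalize (locally_ball_norm (V := C_R_NormedModule) p0 (mkposreal _ Hr8)).
  apply filter_imp. intros x Bx.
  assert (Hx : Cmod (x - circle v 0 - q 0) <= r / 8).
  { rewrite shift, Cmod_norm. apply Rlt_le. exact Bx. }
  destruct (HPhi _ Hx) as [u [u0 [u1 Du]]].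
  exists (fun t => u t + circle v t)%C. split; [| split].
  + rewrite u0. ring.
  + rewrite u1. f_equal. rewrite <- (Rplus_0_l (2 * PI)). apply circle_period.
  + intros t Ht. apply is_derive_add_circle, Du, Ht.
- apply (filterdiff_quadratic _ L p0 K (r / 8)); trivial.
  intros x Hx. specialize (HK (x - circle v 0)%C). rewrite shift in HK.
  replace (Phi (x - circle v 0) + circle v 0 - (Phi (p0 - circle v 0) + circle v 0) - L (x - p0))%C
   with (Phi (x - circle v 0) - Phi (q 0) - L (x - p0))%C; [apply HK, Hx |].
  replace (p0 - circle v 0)%C with (q 0) by (unfold p0; ring). ring.
Qed.

Lemma rotating_wave_continuous X p : rotating_wave X p -> forall t, continuousC p t.
Proof. intros [Hp _] t. eapply is_derive_C_continuous, Hp. Qed.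

(** * The theorem *)

Lemma nbhd0_Cmod V : nbhd0 V -> exists e, 0 < e /\ forall z, Cmod z < e -> V z.
Proof.
intros HV. destruct (locally_norm_radius (E := C_R_NormedModule) _ _ HV) as [e [He H]].
exists e; split; trivial. intros z Hz. apply H.
apply Rle_lt_trans with (2 := Hz).
replace (minus (G := C_R_NormedModule) z (RtoC 0)) with z. rewrite Cmod_norm; apply Rle_refl.
apply injective_projections; simpl; unfold minus, plus, opp; simpl; ring.
Qed.

Lemma nbhd0_ball r : 0 < r -> nbhd0 (fun z => Cmod z < r).
Proof.
intros Hr. generalize (locally_ball_norm (V := C_R_NormedModule) (RtoC 0) (mkposreal r Hr)).
apply filter_imp. intros z Hz. apply Rle_lt_trans with (2 := Hz).
replace (minus (G := C_R_NormedModule) z (RtoC 0)) with z. rewrite Cmod_norm; apply Rle_refl.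
apply injective_projections; simpl; unfold minus, plus, opp; simpl; ring.
Qed.

Lemma wedge_open K delta eps mu :
  0 < K -> wedge K delta eps mu -> eps <> 0 ->
  exists e, 0 < e /\ forall eps' mu', Rabs (eps' - eps) < e -> Rabs (mu' - mu) < e ->
    wedge K delta eps' mu' /\ eps' <> 0.
Proof.
intros HK [H1 H2] H3.
assert (A := Rabs_pos_lt _ H3).
exists (Rmin (Rabs eps) (Rmin (delta - Rabs mu) ((K * Rabs mu - Rabs eps) / (1 + K)))).
split.
{ repeat apply Rmin_pos; try lra. apply Rdiv_lt_0_compat; lra. }
intros eps' mu' He Hm.
apply Rmin_Rgt_l in He; destruct He as [e1 He].
apply Rmin_Rgt_l in He; destruct He as [_ e3].
apply Rmin_Rgt_l in Hm; destruct Hm as [_ Hm].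
apply Rmin_Rgt_l in Hm; destruct Hm as [m2 m3].
apply Rgt_lt in e1, e3, m2, m3.
set (e := (K * Rabs mu - Rabs eps) / (1 + K)) in *.
assert (Ee : e + K * e = K * Rabs mu - Rabs eps) by (unfold e; field; lra).
assert (B1 := Rabs_triang_inv eps' eps). assert (B2 := Rabs_triang_inv mu' mu).
assert (B3 := Rabs_triang_inv mu mu'). rewrite (Rabs_minus_sym mu mu') in B3.
split; [split |].
- assert (K * (Rabs mu - e) < K * Rabs mu') by (apply Rmult_lt_compat_l; lra). lra.
- lra.
- intros ->. rewrite Rminus_0_l, Rabs_Ropp in e1. lra.
Qed.

Theorem theorem3p3 (v : C) (eta : R) (G : R -> R -> C) (H : C -> R -> C)
    (alpha1 : C)
    (eta_gt0 : 0 < eta)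
    (G_smooth : smooth_R_R_C eta G)
    (G_periodic : forall t eps : R, Rabs eps < eta ->
       G (t + 2 * PI) eps = G t eps)
    (H_smooth : smooth_C_R_C eta H)
    (H_bounded : exists M : R, forall (w : C) (mu : R), Rabs mu < eta ->
       Cmod (H w mu) <= M)
    (alpha1_def : is_wirtinger (fun w : C => H w 0) (- (Ci * v))%C alpha1)
    (g_neq0 : fourier_coeff (fun t : R => G t 0) (-1) <> RtoC 0)
    (alpha1_neq0 : Re alpha1 <> 0) :
  exists V0 : C -> Prop, nbhd0 V0 /\
  forall V : C -> Prop, nbhd0 V -> (forall z : C, V z -> V0 z) ->
  exists K delta : R, 0 < K /\ 0 < delta /\
  exists D : R -> R -> R -> C,
    (forall eps mu : R, wedge K delta eps mu -> eps <> 0 ->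
       unique (fun p : R -> C =>
                 rotating_wave (rhs v G H eps mu) p /\
                 hyperbolic (rhs v G H eps mu) p /\
                 V (average p))
              (D eps mu)) /\
    (exists O : R * R -> Prop,
       open_dense_subset
         (fun x : R * R => wedge K delta (fst x) (snd x) /\ fst x <> 0) O /\
       forall eps mu : R, O (eps, mu) -> average (D eps mu) <> RtoC 0) /\
    (forall eps mu : R, wedge K delta eps mu -> eps <> 0 ->
       mu * Re alpha1 < 0 -> anchoring (rhs v G H eps mu) (D eps mu)).
Proof.
destruct (reduction v eta G H alpha1 eta_gt0 G_smooth G_periodic H_smooth
  H_bounded alpha1_def alpha1_neq0) as [be [om [M [r [d [B F]]]]]].
change (reduced_field alpha1 be om M r d (forcing G) (reaction v H) B) in F.
assert (Hom := om_gt0 F). assert (Hal := om_small F).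
assert (HM := M_ge1 F). assert (HM' := lin_part_le_M F).
assert (Hd := d_gt0 F). assert (Hr := r_gt0 F).
assert (al1 : Rabs (Re alpha1) <= Cmod alpha1) by (eapply Rle_trans; [apply Rmax_l | apply Rmax_Cmod]).
assert (be0 := Cmod_ge_0 be).
assert (MM : M <= M * M) by nra.
set (g := average (fun t => forcing G t 0)).
assert (Hg : 0 < Cmod g).
{ apply Cmod_gt_0. intros E. apply g_neq0. rewrite <- E. unfold g, fourier_coeff, forcing.
  f_equal. apply functional_extensionality. intros t.
  replace (- (-1 * t)) with t by ring. ring. }
exists (fun z => Cmod z < r / 2). split; [apply nbhd0_ball; lra |].
intros V HV HVr.
destruct (nbhd0_Cmod V HV) as [rV [HrV HVin]].
destruct (periodic_solution_exists F (Rmin (r / 2) (rV / 2)))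
  as [K0 [delta0 [HK0 [Hdelta0 Ex]]]].
{ apply Rmin_pos; lra. } { apply Rmin_l. }
set (rho := Rmin (r / 2) (rV / 2)) in Ex.
assert (rho1 : rho <= r / 2) by apply Rmin_l. assert (rho2 : rho <= rV / 2) by apply Rmin_r.
clearbody rho.
set (K := Rmin 1 K0).
assert (K1 : K <= 1) by apply Rmin_l. assert (K2 : K <= K0) by apply Rmin_r.
assert (HK : 0 < K) by (apply Rmin_pos; lra).
clearbody K.
(* All smallness conditions on mu have the form C M^2 |mu| < X with C <= 200. *)
set (X := Rmin (Rmin om (/ 4)) (Rmin r (Cmod g))).
assert (HX : 0 < X) by (repeat apply Rmin_pos; lra).
assert (X1 : X <= om) by (unfold X; eapply Rle_trans; [apply Rmin_l | apply Rmin_l]).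
assert (X2 : X <= / 4) by (unfold X; eapply Rle_trans; [apply Rmin_l | apply Rmin_r]).
assert (X3 : X <= r) by (unfold X; eapply Rle_trans; [apply Rmin_r | apply Rmin_l]).
assert (X4 : X <= Cmod g) by (unfold X; eapply Rle_trans; [apply Rmin_r | apply Rmin_r]).
clearbody X.
set (delta := Rmin (Rmin d delta0) (X / (200 * (M * M)))).
assert (q1 : 0 < X / (200 * (M * M))) by (apply Rdiv_lt_0_compat; nra).
assert (Hdelta : 0 < delta) by (repeat apply Rmin_pos; lra).
exists K, delta. split; [exact HK |]. split; [exact Hdelta |].
assert (W : forall eps mu, wedge K delta eps mu -> mu <> 0 /\ Rabs mu < delta0 /\
  Rabs eps <= K0 * Rabs mu /\ Rabs eps <= Rabs mu /\ Rabs eps < d /\ Rabs mu < d /\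
  200 * (M * M) * Rabs mu < X).
{ intros eps mu [W1 W2]. assert (p0 := Rabs_pos eps). assert (p1 := Rabs_pos mu).
  apply Rmin_Rgt_l in W2; destruct W2 as [W2 W3].
  apply Rmin_Rgt_l in W2; destruct W2 as [W2 W4]. apply Rgt_lt in W2, W3, W4.
  apply (Rmult_lt_compat_l (200 * (M * M))) in W3; [| nra].
  replace (200 * (M * M) * (X / (200 * (M * M)))) with X in W3 by (field; nra).
  assert (K * Rabs mu <= 1 * Rabs mu) by (apply Rmult_le_compat_r; lra).
  assert (K * Rabs mu <= K0 * Rabs mu) by (apply Rmult_le_compat_r; lra).
  repeat split; try lra. intros ->. rewrite Rabs_R0 in W1. lra. }
clearbody delta.
(* Existence, with the stability of the wave that was constructed. *)
assert (Main : forall eps mu, wedge K delta eps mu -> exists p : R -> C,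
  rotating_wave (rhs v G H eps mu) p /\ hyperbolic (rhs v G H eps mu) p /\ V (average p) /\
  (mu * Re alpha1 < 0 -> anchoring (rhs v G H eps mu) p)).
{ intros eps mu Hw. destruct (W eps mu Hw) as [w1 [w2 [w3 [w4 [w5 [w6 w7]]]]]].
  assert (mu0 := Rabs_pos_lt _ w1). assert (MMmu : M * Rabs mu <= M * M * Rabs mu) by (apply Rmult_le_compat_r; lra).
  assert (em : (Rabs eps + Rabs mu) * M <= 2 * (M * Rabs mu)).
  { replace (2 * (M * Rabs mu)) with ((Rabs mu + Rabs mu) * M) by ring. apply Rmult_le_compat_r; lra. }
  destruct (Ex eps mu w3 w1 w2 w5) as [q [Sq Bq]].
  assert (Cq : forall t, continuousC q t) by (intros t; eapply is_derive_C_continuous, Sq).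
  assert (Wq := rotating_wave_add_circle v G H eps mu q Sq).
  destruct (monodromy_add_circle v G H eps mu F q) as [L [Mon [La [Ls HL]]]]; try lra.
  { eapply Rle_trans; [apply Bq | lra]. }
  exists (fun t => q t + circle v t)%C. split; [exact Wq |].
  destruct (spectrum_near_scaling L alpha1 mu om M La Ls HL) as [Inside Off]; try lra.
  split; [| split].
  - exists L. split; [exact Mon | exact Off].
  - apply HVin.
    rewrite <- (average_sub_circle v) by (eapply rotating_wave_continuous, Wq).
    replace (average _) with (average q - 0)%C.
    + apply Rle_lt_trans with rho; [| lra]. apply average_near_const; trivial.
      intros t _. replace (q t - 0)%C with (q t) by ring. apply Bq.
    + replace (fun t => q t + circle v t - circle v t)%C with q. ring.
      apply functional_extensionality; intros t; ring.
  - intros Hs. exists L. split; [exact Mon | exact (Inside Hs)]. }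
(* Every wave with center in V comes from a small q. *)
assert (Red : forall eps mu p, wedge K delta eps mu -> rotating_wave (rhs v G H eps mu) p ->
  V (average p) -> exists q, q = (fun t => p t - circle v t)%C /\
   periodic_solution (forcing G) (reaction v H) eps mu q /\ (forall t, Cmod (q t) <= r) /\
   average q = average p).
{ intros eps mu p Hw Hp Hc. destruct (W eps mu Hw) as [w1 [w2 [w3 [w4 [w5 [w6 w7]]]]]].
  assert (mu0 := Rabs_pos_lt _ w1). assert (MMmu : M * Rabs mu <= M * M * Rabs mu) by (apply Rmult_le_compat_r; lra).
  assert (em : (Rabs eps + Rabs mu) * M <= 2 * (M * Rabs mu)).
  { replace (2 * (M * Rabs mu)) with ((Rabs mu + Rabs mu) * M) by ring. apply Rmult_le_compat_r; lra. }
  assert (Eav := average_sub_circle v p (rotating_wave_continuous _ _ Hp)).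
  assert (Sq := rotating_wave_sub_circle v G H eps mu p Hp).
  exists (fun t => p t - circle v t)%C. repeat split; trivial; try apply Sq.
  apply (periodic_solution_small F eps mu); trivial. lra.
  rewrite Eav. apply Rlt_le, HVr, Hc. }
pose (Good := fun eps mu p => rotating_wave (rhs v G H eps mu) p /\
   hyperbolic (rhs v G H eps mu) p /\ V (average p)).
pose (D := fun eps mu => epsilon (inhabits (fun _ : R => RtoC 0)) (Good eps mu)).
assert (GoodD : forall eps mu, wedge K delta eps mu -> Good eps mu (D eps mu)).
{ intros eps mu Hw. unfold D. apply epsilon_spec.
  destruct (Main eps mu Hw) as [p [P1 [P2 [P3 _]]]]. exists p. repeat split; trivial; apply P1. }
assert (Comp : forall eps mu eps' mu' p p', wedge K delta eps mu -> wedge K delta eps' mu' ->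
  Good eps mu p -> Good eps' mu' p' ->
  Rabs mu * Cmod alpha1 * Cmod (average p - average p') <= 220 * (M * M) * (Rabs (eps - eps') + Rabs (mu - mu')) /\
  forall t, Cmod (p t - p' t) <= 2 * Cmod (average p - average p') + 64 * M * (Rabs (eps - eps') + Rabs (mu - mu'))).
{ intros eps mu eps' mu' p p' Hw Hw' [P1 [_ P3]] [P1' [_ P3']].
  destruct (Red eps mu p Hw P1 P3) as [q [Eq [Sq [Bq Aq]]]].
  destruct (Red eps' mu' p' Hw' P1' P3') as [q' [Eq' [Sq' [Bq' Aq']]]].
  destruct (W eps mu Hw) as [w1 [w2 [w3 [w4 [w5 [w6 w7]]]]]].
  destruct (W eps' mu' Hw') as [w1' [w2' [w3' [w4' [w5' [w6' w7']]]]]].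
  assert (0 < M * M * Rabs mu) by (apply Rmult_lt_0_compat; [nra | apply Rabs_pos_lt, w1]).
  destruct (comparison F eps eps' mu mu' q q') as [C1 C2]; trivial; try lra.
  rewrite Aq, Aq' in C1, C2. split; [exact C1 |]. intros t.
  replace (p t - p' t)%C with (q t - q' t)%C by (rewrite Eq, Eq'; ring). apply C2. }
assert (al0 : 0 < Cmod alpha1) by lra.
assert (Uniq : forall eps mu p p', wedge K delta eps mu -> Good eps mu p -> Good eps mu p' -> p = p').
{ intros eps mu p p' Hw Hp Hp'.
  destruct (Comp eps mu eps mu p p' Hw Hw Hp Hp') as [C1 C2].
  rewrite !Rminus_diag, !Rabs_R0, Rplus_0_r, Rmult_0_r in C1, C2.
  destruct (W eps mu Hw) as [w1 _]. assert (mu0 := Rabs_pos_lt _ w1).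
  assert (c0 := Cmod_ge_0 (average p - average p')).
  assert (cz : Cmod (average p - average p') = 0).
  { assert (0 < Rabs mu * Cmod alpha1) by (apply Rmult_lt_0_compat; trivial). nra. }
  apply functional_extensionality. intros t. specialize (C2 t). rewrite cz in C2.
  assert (E : (p t - p' t)%C = RtoC 0).
  { apply Cmod_eq_0. generalize (Cmod_ge_0 (p t - p' t)); lra. }
  replace (p t) with (p' t + (p t - p' t))%C by ring. rewrite E; ring. }
exists D. split; [| split].
- intros eps mu Hw _. split; [apply GoodD, Hw |].
  intros p' Hp'. apply (Uniq eps mu); trivial. apply GoodD, Hw.
- exists (fun x => (wedge K delta (fst x) (snd x) /\ fst x <> 0) /\ average (D (fst x) (snd x)) <> RtoC 0).
  split; [split; [| split] |].
  + intros [eps mu] [[Hw He] Hav]. simpl in Hw, He, Hav.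
    destruct (wedge_open K delta eps mu HK Hw He) as [e [Hepos Hopen]].
    destruct (W eps mu Hw) as [w1 _]. assert (mu0 := Rabs_pos_lt _ w1).
    assert (c0 : 0 < Cmod (average (D eps mu))) by (apply Cmod_gt_0, Hav).
    set (e2 := Rabs mu * Cmod alpha1 * Cmod (average (D eps mu)) / (440 * (M * M))).
    assert (e2pos : 0 < e2).
    { unfold e2. apply Rdiv_lt_0_compat; [| nra]. repeat apply Rmult_lt_0_compat; trivial. }
    assert (Hmin : 0 < Rmin e e2) by (apply Rmin_pos; trivial).
    (* A wave centered at 0 at (eps', mu') would contradict comparison. *)
    exists (mkposreal _ Hmin). intros [eps' mu'] [B1 B2]. simpl.
    assert (b1 : Rabs (eps' - eps) < Rmin e e2) by exact B1.
    assert (b2 : Rabs (mu' - mu) < Rmin e e2) by exact B2.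
    assert (m1 := Rmin_l e e2). assert (m2 := Rmin_r e e2).
    destruct (Hopen eps' mu') as [Hw' He']; try lra.
    split; [split; trivial |]. intros Z.
    destruct (Comp eps mu eps' mu' (D eps mu) (D eps' mu') Hw Hw' (GoodD _ _ Hw) (GoodD _ _ Hw')) as [C1 _].
    rewrite Z in C1. replace (average (D eps mu) - 0)%C with (average (D eps mu)) in C1 by ring.
    rewrite (Rabs_minus_sym eps), (Rabs_minus_sym mu mu') in C1.
    assert (220 * (M * M) * (Rabs (eps' - eps) + Rabs (mu' - mu)) < 220 * (M * M) * (2 * e2))
      by (apply Rmult_lt_compat_l; [nra | lra]).
    replace (220 * (M * M) * (2 * e2)) with (Rabs mu * Cmod alpha1 * Cmod (average (D eps mu))) in H0
      by (unfold e2; field; nra).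
    lra.
  + intros x [Hx _]. exact Hx.
  + intros [eps mu] [Hw He] N HN. simpl in Hw, He.
    destruct (Ceq_dec (average (D eps mu)) 0) as [Z | Z].
    2: { exists (eps, mu). split; [apply (locally_singleton _ _ HN) | simpl; auto]. }
    destruct HN as [[n Hn] HN].
    destruct (wedge_open K delta eps mu HK Hw He) as [e [Hepos Hopen]].
    assert (Hmin : 0 < Rmin e n) by (apply Rmin_pos; trivial).
    assert (m1 := Rmin_l e n). assert (m2 := Rmin_r e n).
    (* If the center vanishes at (eps, mu), it does not at (eps', mu). *)
    set (eps' := eps + Rmin e n / 2).
    assert (Hdist : Rabs (eps' - eps) = Rmin e n / 2).
    { unfold eps'. replace (eps + Rmin e n / 2 - eps) with (Rmin e n / 2) by ring.
      apply Rabs_pos_eq; lra. }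
    destruct (Hopen eps' mu) as [Hw' He']; [lra | rewrite Rminus_diag, Rabs_R0; lra |].
    exists (eps', mu). split.
    { apply HN. split; simpl.
      - change (Rabs (eps' - eps) < n). lra.
      - apply (ball_center (M := R_UniformSpace) mu (mkposreal n Hn)). }
    simpl. split; [split; trivial |]. intros Z'.
    destruct (GoodD _ _ Hw) as [P1 [_ P3]]. destruct (GoodD _ _ Hw') as [P1' [_ P3']].
    destruct (Red eps mu _ Hw P1 P3) as [q [Eq [Sq [Bq Aq]]]].
    destruct (Red eps' mu _ Hw' P1' P3') as [q' [Eq' [Sq' [Bq' Aq']]]].
    destruct (W eps mu Hw) as [w1 [w2 [w3 [w4 [w5 [w6 w7]]]]]].
    destruct (W eps' mu Hw') as [_ [_ [_ [w4' [w5' _]]]]].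
    assert (MMmu : M * Rabs mu <= M * M * Rabs mu) by (apply Rmult_le_compat_r; [apply Rabs_pos | lra]).
    assert (mp : 0 < M * M * Rabs mu) by (apply Rmult_lt_0_compat; [nra | apply Rabs_pos_lt, w1]).
    assert (ME : M * (Rabs eps + Rabs eps') <= M * (2 * Rabs mu)) by (apply Rmult_le_compat_l; lra).
    assert (E : eps = eps').
    { apply (average_injective_eps F eps eps' mu q q'); trivial; fold g; try lra.
      rewrite Aq, Aq', Z, Z'. reflexivity. }
    unfold eps' in E. lra.
  + intros eps mu [_ Hav]. exact Hav.
- intros eps mu Hw _ Hs. destruct (Main eps mu Hw) as [p [P1 [P2 [P3 P4]]]].
  rewrite (Uniq eps mu (D eps mu) p Hw (GoodD _ _ Hw) (conj P1 (conj P2 P3))). auto.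
Qed.
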